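(* Let $\mathbf g\in L^2_T(\partial G)$. A quadruple $(\mathbf u,\mathbf u_1,u_2,\mathbf u_3)\in\mathcal H$ solves the two-scale equation $$\mathcal B((\mathbf u, \mathbf u_1, u_2, \mathbf u_3), (\boldsymbol\psi, \boldsymbol\psi_1, \psi_2, \boldsymbol\psi_3))=\int_{\partial G}\mathbf g\cdot \boldsymbol\psi_T^*\,d\sigma \qquad \forall (\boldsymbol\psi, \boldsymbol\psi_1, \psi_2, \boldsymbol\psi_3)\in \mathcal H$$ if and only if $\mathbf u\in\mathbf H_{\mathrm{imp}}(G)$ solves the effective macroscopic scattering problem $$\int_G (\varepsilon^{-1})_{\hom} \operatorname{curl} \mathbf u\cdot \operatorname{curl}\boldsymbol\psi^*-k^2\mu_{\hom} \mathbf u\cdot \boldsymbol\psi^*\, dx-ik\int_{\partial G}\mathbf u_T\cdot\boldsymbol\psi_T^*\,d\sigma =\int_{\partial G} \mathbf g \cdot \boldsymbol\psi_T^*\, d\sigma \qquad \forall \boldsymbol\psi\in \mathbf H_{\mathrm{imp}}(G)$$ and the correctors are $$\mathbf u_1=\chi_{\Omega}\chi_{\Sigma^*}\sum_j (\operatorname{curl} \mathbf u)_j\mathbf w_j^1,\qquad u_2=\chi_\Omega\chi_{\Sigma^*}\sum_j k^2\mathbf u_j w_j^2,\qquad \mathbf u_3=\chi_\Omega\chi_\Sigma\sum_j k^2\mathbf u_j\mathbf w_j^3 .$$ Here $(\varepsilon^{-1})_{\hom}$ and $\mu_{\hom}$ are the identity in $G\setminus\overline\Omega$, and in $\Omega$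 they are given by $$\bigl((\varepsilon^{-1})_{\hom}\bigr)_{j,l}:=\int_{\Sigma^*} \varepsilon^{-1}_0 (\mathbf e_l+\operatorname{curl}_y \mathbf w_l^1)\cdot \mathbf e_j\, dy,\qquad \bigl(\mu_{\hom}\bigr)_{j,l}:=\int_Y(\mathbf e_l+k^2\chi_{\Sigma^*}\nabla_y w_l^2+k^2\chi_\Sigma \mathbf w_l^3)\cdot \mathbf e_j\, dy,$$ where, for $l=1,2,3$, $\mathbf w_l^1\in \widetilde{\mathbf H}_\sharp(\operatorname{curl}, \Sigma^* )$, $w_l^2\in H^1_{\sharp, 0}(\Sigma^* )$ and $\mathbf w_l^3\in \mathbf H_0(\operatorname{curl}, \Sigma)$ solve the cell problems $$\int_{\Sigma^*}\varepsilon^{-1}_0(\mathbf e_l+\operatorname{curl}_y \mathbf w_l^1)\cdot \operatorname{curl}_y \boldsymbol\psi_1^*\,dy= 0 \quad \forall \boldsymbol\psi_1\in \widetilde{\mathbf H}_{\sharp}(\operatorname{curl}, \Sigma^* ),$$ $$\int_{\Sigma^*}(\mathbf e_l+k^2\nabla_y w_l^2)\cdot \nabla_y \psi_2^*\, dy = 0\quad \forall \psi_2\in H^1_{\sharp,0}(\Sigma^* ),$$ $$\int_\Sigma \varepsilon^{-1}_1 \operatorname{curl}_y \mathbf w_l^3\cdot \operatorname{curl}_y \boldsymbol\psi_3^*-k^2\mathbf w_l^3\cdot \boldsymbol\psi_3^*\, dy=\int_\Sigma \mathbf e_l\cdot \boldsymbol\psi_3^*\,dy \quad\forall \boldsymbol\psi_3\in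 \mathbf H_0(\operatorname{curl}, \Sigma).$$
   Context: Setting. $\Omega\subset\subset G\subset\mathbb R^3$ are bounded, simply connected domains with $C^2$ boundary; $\mathbf n$ is the outer unit normal of $G$. $Y:=[-\tfrac12,\tfrac12)^3$; $\Sigma\subset\subset Y$ is a connected domain with $C^2$ boundary whose complement $\Sigma^*=Y\setminus\Sigma$ is simply connected. The wavenumber satisfies $k\ge k_0>0$. Functions are complex valued, ${}^*$ is complex conjugation, $\cdot$ is the real (bilinear) scalar product, $\mathbf e_j$ is the $j$-th unit vector of $\mathbb R^3$, $\chi_D$ is the characteristic function of $D$ ($\chi_\Sigma,\chi_{\Sigma^*}$ are functions of $y$). Coefficients: $\varepsilon_0\in L^\infty_\sharp(Y;\mathbb R)$ is uniformly positive, $\varepsilon_1^{-1}\in L^\infty_\sharp(Y;\mathbb C)$ with $\operatorname{Im}\varepsilon_1>0$ and $\operatorname{Re}\varepsilon_1>0$; both depend on $y$. Spaces. $L^2_T(\partial G)=\{\mathbf v\in[L^2(\partial G)]^3:\mathbf v\cdot\mathbf n=0\}$; $\mathbf u_T:=(\mathbf n\times\mathbf u)\times\mathbf n$; $\mathbf H(\operatorname{curl},D)$ is standard; $\mathbf H_0(\operatorname{curl},\Sigma)$ is the subspace of vanishing tangential trace; $\mathbf H_{\mathrm{imp}}(G)=\{\mathbf u\in\mathbf H(\operatorname{curl},G):\mathbf u_T\in L^2_T(\partial G)\}$. The subscript $\sharp$ denotes $Y$-periodic functions; $H^1_{\sharp,0}(Y)=\{\phi\in H^1_\sharp(Y):\int_Y\phi=0\}$.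 $H^1_{\sharp,0}(\Sigma^* )$ and $\mathbf H_\sharp(\operatorname{curl},\Sigma^* )$ are the restrictions to $\Sigma^*$ of functions in $H^1_{\sharp,0}(Y)$ and $\mathbf H_\sharp(\operatorname{curl},Y)$, and $\widetilde{\mathbf H}_\sharp(\operatorname{curl},\Sigma^* ):=\mathbf H_\sharp(\operatorname{curl},\Sigma^* )/\ker(\operatorname{curl}_y|_{\Sigma^*})$. $L^2(\Omega;X)$ is the Bochner space. Two-scale form. $\mathcal H:=\mathbf H_{\mathrm{imp}}(G)\times L^2(\Omega; \widetilde{\mathbf H}_\sharp(\operatorname{curl}, \Sigma^* ))\times L^2(\Omega; H^1_{\sharp, 0}(\Sigma^* ))\times L^2(\Omega; \mathbf H_0(\operatorname{curl}, \Sigma))$ and $$\begin{aligned}\mathcal B&((\mathbf v, \mathbf v_1, v_2, \mathbf v_3), (\boldsymbol\psi, \boldsymbol\psi_1, \psi_2, \boldsymbol\psi_3))\\&:=\int_\Omega\int_{\Sigma^*}\varepsilon^{-1}_0(\operatorname{curl} \mathbf v+\operatorname{curl}_y\mathbf v_1)\cdot (\operatorname{curl} \boldsymbol\psi+\operatorname{curl}_y \boldsymbol\psi_1)^* +\int_\Omega\int_\Sigma \varepsilon^{-1}_1 \operatorname{curl}_y \mathbf v_3\cdot \operatorname{curl}_y \boldsymbol\psi_3^*\\&\quad-k^2\int_\Omega\int_Y (\mathbf v+\chi_{\Sigma^*}\nabla_y v_2+\chi_\Sigma \mathbf v_3)\cdot (\boldsymbol\psi+\chi_{\Sigma^*}\nabla_y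 \psi_2+\chi_{\Sigma}\boldsymbol\psi_3)^*\\&\quad +\int_{G\setminus \overline{\Omega}}\operatorname{curl}\mathbf v\cdot \operatorname{curl}\boldsymbol\psi^*-k^2\mathbf v\cdot \boldsymbol\psi^*-ik\int_{\partial G} \mathbf v_T \cdot \boldsymbol\psi_T^*.\end{aligned}$$
   Formalization: The corrector identity for u_2 is stated only up to functions with zero y-gradient on Σ* (constants in y): H^1_{♯,0}(Σ* ) as defined contains constants, so for g=0, u=u_1=u_3=0 the choice u_2=1 also solves the two-scale equation and the exact identity fails. *)

(* Defs.v *)
From HB Require Import structures.
From mathcomp Require Import all_boot all_order all_algebra.
From mathcomp Require Import all_classical all_reals all_analysis.
From mathcomp Require Import complex.

Set Implicit Arguments.
Unset Strict Implicit.
Unset Printing Implicit Defensive.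

Import Order.TTheory GRing.Theory Num.Theory.
Import numFieldNormedType.Exports.

Local Open Scope classical_set_scope.
Local Open Scope ring_scope.

(* The same carrier R * R * R is used with its product topology (pt3) and with
   the product of the Borel sigma-algebras, which carries lebesgue_measure
   (mpt3). *)
Notation pt3 R := (Real.sort R * Real.sort R * Real.sort R)%type.
Notation mpt3 R := (measurableTypeR R * measurableTypeR R * measurableTypeR R)%type.

Section Geometry.
Variable R : realType.
Implicit Types (A D U : set (pt3 R)) (f rho : pt3 R -> R) (x y : pt3 R).

Definition leb3 := ((@lebesgue_measure R \x @lebesgue_measure R)
                    \x @lebesgue_measure R)%E.
HB.instance Definition _ := Measure.on leb3.

Definition measurable3 A : Prop := @measurable _ (mpt3 R) A.

Definition coord3 x (j : 'I_3) : R := nth 0 [:: x.1.1; x.1.2; x.2] j.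

Definition unit3 (j : 'I_3) : pt3 R :=
  ((j == 0)%:R, (j == 1)%:R, (j == 2)%:R).

Definition dist3 x y : R := Num.sqrt (\sum_(j < 3) (coord3 x j - coord3 y j) ^+ 2).

Definition partial (j : 'I_3) f : pt3 R -> R := fun x => 'D_(unit3 j) f x.

Definition iter_partial (s : seq 'I_3) f : pt3 R -> R := foldr partial f s.

Definition Cm_on (m : nat) U f : Prop :=
  forall s : seq 'I_3,
    ((size s <= m)%N -> forall x, U x -> {for x, continuous (iter_partial s f)}) /\
    ((size s < m)%N -> forall x j, U x -> derivable (iter_partial s f) x (unit3 j)).

Definition grad f x : 'cV[R]_3 := \col_j partial j f x.

Definition norm_cV (v : 'cV[R]_3) : R := Num.sqrt (\sum_j v j 0 ^+ 2).

Definition bdry D : set (pt3 R) := closure D `\` D^°.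

Definition cpt_included A D : Prop := compact (closure A) /\ closure A `<=` D^°.

Definition path_in A (g : R -> pt3 R) : Prop :=
  {within `[0, 1], continuous g} /\ forall t, 0 <= t <= 1 -> A (g t).

Definition simply_connected A : Prop :=
  [/\ A !=set0,
      forall x y, A x -> A y -> exists g, [/\ path_in A g, g 0 = x & g 1 = y]
    & forall g, path_in A g -> g 0 = g 1 ->
      exists h : R * R -> pt3 R,
        [/\ {within [set st : R * R | (0 <= st.1 <= 1) && (0 <= st.2 <= 1)], continuous h},
            forall s t, 0 <= s <= 1 -> 0 <= t <= 1 -> A (h (s, t)),
            forall t, 0 <= t <= 1 -> h (0, t) = g t /\ h (1, t) = g 0
          & forall s, 0 <= s <= 1 -> h (s, 0) = g 0 /\ h (s, 1) = g 0]].

Definition domain3 D : Prop := [/\ D !=set0, open D & connected D].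

Definition bounded3 D : Prop := exists M : R, forall x, D x -> dist3 x 0 <= M.

Definition C2_defining D U rho : Prop :=
  [/\ open U, Cm_on 2 U rho, forall x, U x -> grad rho x != 0
    & forall x, U x -> (D x <-> rho x < 0)].

Definition C2_boundary D : Prop :=
  forall p, bdry D p -> exists U rho, U p /\ C2_defining D U rho.

Definition outer_unit_normal D (n : pt3 R -> 'cV[R]_3) : Prop :=
  forall p, bdry D p -> exists U rho,
    [/\ U p, C2_defining D U rho & n p = (norm_cV (grad rho p))^-1 *: grad rho p].

(* Two-dimensional Hausdorff measure, from countable covers by sets F i of
   Euclidean diameter at most r i; the factor pi / 4 makes it the area of
   planar sets. *)
Definition hausdorff2_delta (delta : R) A : \bar R :=
  ereal_inf [set s | exists (F : nat -> set (pt3 R)) (r : nat -> R),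
    [/\ A `<=` \bigcup_i F i,
        forall i, 0 <= r i <= delta,
        forall i x y, F i x -> F i y -> dist3 x y <= r i
      & s = (\sum_(0 <= i <oo) (pi / 4 * r i ^+ 2)%:E)%E]].

Definition hausdorff2 A : \bar R :=
  ereal_sup [set hausdorff2_delta delta A | delta in [set d : R | 0 < d]].

Definition surface_measure D (sigma : {measure set (mpt3 R) -> \bar R}) : Prop :=
  forall A, measurable3 A -> sigma A = hausdorff2 (A `&` bdry D).

Definition Ycell : set (pt3 R) :=
  [set y | forall j, - 2^-1 <= coord3 y j < 2^-1].

Definition periodic3 (T : Type) (f : pt3 R -> T) : Prop :=
  forall y j, f (y + unit3 j) = f y.

End Geometry.

Section ComplexFields.
Variable R : realType.
Local Notation C := R[i].
Implicit Types (D : set (pt3 R)) (mu : {measure set (mpt3 R) -> \bar R}).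

Definition sfield := pt3 R -> C.
Definition vfield := pt3 R -> 'cV[C]_3.

Definition cplx (r : R) : C := Complex r 0.
Definition imagi : C := Complex 0 1.

Definition cint mu D (f : pt3 R -> C) : C :=
  Complex (\int[mu]_(x in D) complex.Re (f x))%R
          (\int[mu]_(x in D) complex.Im (f x))%R.

Definition sqn (z : C) : R := complex.Re z ^+ 2 + complex.Im z ^+ 2.

Definition cmeasurable D (f : sfield) : Prop :=
  @measurable_fun _ _ (mpt3 R) R D (fun x => complex.Re (f x)) /\
  @measurable_fun _ _ (mpt3 R) R D (fun x => complex.Im (f x)).

Definition sL2 mu D (f : sfield) : Prop :=
  cmeasurable D f /\ (\int[mu]_(x in D) (sqn (f x))%:E < +oo)%E.

Definition L2 mu D (v : vfield) : Prop := forall j, sL2 mu D (fun x => v x j 0).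

Definition dot (a b : 'cV[C]_3) : C := \sum_j a j 0 * b j 0.

Definition conjv (a : 'cV[C]_3) : 'cV[C]_3 := map_mx Num.conj a.

(* Indices are taken in Z/3. *)
Definition cross (a b : 'cV[C]_3) : 'cV[C]_3 :=
  \col_(j < 3) (a (j + 1) 0 * b (j + 2) 0 - a (j + 2) 0 * b (j + 1) 0).

Definition cplxv (a : 'cV[R]_3) : 'cV[C]_3 := map_mx cplx a.

Definition evec (l : 'I_3) : 'cV[C]_3 := delta_mx l 0.

Definition chi D (y : pt3 R) : C := cplx (\1_D y).

Definition test_function D (eta : pt3 R -> R) : Prop :=
  [/\ forall m, Cm_on m setT eta, compact (closure [set x | eta x != 0])
    & closure [set x | eta x != 0] `<=` D].

Definition vtest D (eta : 'I_3 -> pt3 R -> R) : Prop :=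
  forall j, test_function D (eta j).

Definition tvec (eta : 'I_3 -> pt3 R -> R) : vfield :=
  fun x => \col_j cplx (eta j x).

Definition tcurl (eta : 'I_3 -> pt3 R -> R) : vfield :=
  fun x => \col_(j < 3) cplx (partial (j + 1) (eta (j + 2)) x
                              - partial (j + 2) (eta (j + 1)) x).

End ComplexFields.

Notation gcurl R := (vfield R * vfield R)%type.
Notation ggrad R := (sfield R * vfield R)%type.
Notation gimp R := (gcurl R * vfield R)%type.

Section Spaces.
Variable R : realType.
Local Notation C := R[i].
Local Notation leb := (@leb3 R).
Implicit Types (D : set (pt3 R)) (sigma : {measure set (mpt3 R) -> \bar R}).

(* Elements of H(curl, D), H^1(D) are handled as pairs: the function together
   with its weak curl, resp. gradient, which it determines almost everywhere.
   An element of H_imp(G) carries in addition its trace n x u. *)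
Definition fld (p : gcurl R) : vfield R := p.1.
Definition curl (p : gcurl R) : vfield R := p.2.
Definition sfld (p : ggrad R) : sfield R := p.1.
Definition gradient (p : ggrad R) : vfield R := p.2.

Definition weak_curl D (p : gcurl R) : Prop :=
  forall eta, vtest D eta ->
    cint leb D (fun x => dot (fld p x) (tcurl eta x)) =
    cint leb D (fun x => dot (curl p x) (tvec eta x)).

Definition weak_grad D (p : ggrad R) : Prop :=
  forall eta j, test_function D eta ->
    cint leb D (fun x => sfld p x * cplx (partial j eta x)) =
    - cint leb D (fun x => gradient p x j 0 * cplx (eta x)).

Definition Hcurl D : set (gcurl R) :=
  [set p | [/\ L2 leb D (fld p), L2 leb D (curl p) & weak_curl D p]].

(* Green's formula: this is the duality pairing of the tangential trace n x u
   on the boundary of D with eta. *)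
Definition trace_pairing D (p : gcurl R) (eta : 'I_3 -> pt3 R -> R) : C :=
  cint leb D (fun x => dot (curl p x) (tvec eta x) - dot (fld p x) (tcurl eta x)).

Definition H0curl D : set (gcurl R) :=
  [set p | Hcurl D p /\ forall eta, vtest setT eta -> trace_pairing D p eta = 0].

Definition L2T D (n : pt3 R -> 'cV[R]_3) sigma : set (vfield R) :=
  [set v | L2 sigma (bdry D) v /\
    {ae sigma, forall x, bdry D x -> dot (v x) (cplxv (n x)) = 0}].

Definition utan (n : pt3 R -> 'cV[R]_3) (u : gimp R) : vfield R :=
  fun x => cross (u.2 x) (cplxv (n x)).

Definition Himp D n sigma : set (gimp R) :=
  [set u | [/\ Hcurl D u.1, L2T D n sigma u.2, L2T D n sigma (utan n u)
    & forall eta, vtest setT eta ->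
        trace_pairing D u.1 eta =
        cint sigma (bdry D) (fun x => dot (u.2 x) (tvec eta x))]].

Definition sL2loc (f : sfield R) : Prop :=
  forall K : set (pt3 R), compact K -> sL2 leb K f.
Definition L2loc (v : vfield R) : Prop :=
  forall K : set (pt3 R), compact K -> L2 leb K v.

Definition Hcurl_per : set (gcurl R) :=
  [set p | [/\ periodic3 (fld p), periodic3 (curl p), L2loc (fld p),
     L2loc (curl p) & weak_curl setT p]].

Definition H1_per0 : set (ggrad R) :=
  [set p | [/\ periodic3 (sfld p), periodic3 (gradient p),
      sL2loc (sfld p) & L2loc (gradient p)]
   /\ weak_grad setT p /\ cint leb (@Ycell R) (sfld p) = 0].

Definition restr (S T : Type) D (X : set ((pt3 R -> S) * (pt3 R -> T))) :
    set ((pt3 R -> S) * (pt3 R -> T)) :=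
  [set p | exists2 q, X q & forall y, D y -> p.1 y = q.1 y /\ p.2 y = q.2 y].

Definition Hcurl_per_on D : set (gcurl R) := restr D Hcurl_per.
Definition H1_per0_on D : set (ggrad R) := restr D H1_per0.

Definition ae_zero (T : nmodType) D (v : pt3 R -> T) : Prop :=
  {ae leb, forall y, D y -> v y = 0}.

Definition ker_curl D : set (gcurl R) :=
  [set p | Hcurl_per_on D p /\ ae_zero D (curl p)].
Definition ker_grad D : set (ggrad R) :=
  [set p | H1_per0_on D p /\ ae_zero D (gradient p)].
Definition null_curl D : set (gcurl R) :=
  [set p | ae_zero D (fld p) /\ ae_zero D (curl p)].

Definition sqnv (a : 'cV[C]_3) : R := \sum_j sqn (a j 0).

Definition norm_Hcurl D (p : gcurl R) : R :=
  Num.sqrt (\int[leb]_(y in D) (sqnv (fld p y) + sqnv (curl p y)))%R.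

Definition norm_H1 D (p : ggrad R) : R :=
  Num.sqrt (\int[leb]_(y in D) (sqn (sfld p y) + sqnv (gradient p y)))%R.

Definition qnorm_Hcurl D (p : gcurl R) : R :=
  inf [set norm_Hcurl D (p - q) | q in ker_curl D].

(* L^2(D; X) for a space X of representatives with seminorm N: square
   integrable maps that are strongly measurable, i.e. limits of simple
   functions (every class has a representative for which the convergence
   holds everywhere on D). *)
Definition bochner_L2 (V : lmodType C) D (X : set V) (N : V -> R) :
    set (pt3 R -> V) :=
  [set U | [/\ forall x, D x -> X (U x),
    exists s : nat -> pt3 R -> V,
      [/\ forall m x, X (s m x),
          forall m, finite_set (range (s m)),
          forall m a, measurable3 (s m @^-1` [set a])
        & forall x, D x -> N (s m x - U x) @[m --> \oo] --> (0 : R)]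
    & (\int[leb]_(x in D) (N (U x) ^+ 2)%:E < +oo)%E]].

Definition Linfty_per (f : sfield R) : Prop :=
  [/\ periodic3 f, cmeasurable (@Ycell R) f
    & exists M : R, {ae leb, forall y, @Ycell R y -> sqn (f y) <= M}].

End Spaces.

Section Problems.
Variable R : realType.
Local Notation C := R[i].
Local Notation leb := (@leb3 R).
Local Notation Y := (@Ycell R).
Variables (Omega G Sigma : set (pt3 R)) (n : pt3 R -> 'cV[R]_3)
  (sigma : {measure set (mpt3 R) -> \bar R})
  (k : R) (eps0 : pt3 R -> R) (eps1 : pt3 R -> C).

Definition Sigma_star : set (pt3 R) := Y `\` Sigma.
Local Notation Sstar := Sigma_star.

Definition eps0V (y : pt3 R) : C := cplx (eps0 y)^-1.

Definition quad := (gimp R * (pt3 R -> gcurl R) * (pt3 R -> ggrad R)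
                    * (pt3 R -> gcurl R))%type.

Definition HH : set quad :=
  [set q | let: (v, v1, v2, v3) := q in
    [/\ Himp G n sigma v,
        bochner_L2 Omega (Hcurl_per_on Sstar) (qnorm_Hcurl Sstar) v1,
        bochner_L2 Omega (H1_per0_on Sstar) (norm_H1 Sstar) v2
      & bochner_L2 Omega (H0curl Sigma) (norm_Hcurl Sigma) v3]].

Definition BB (p q : quad) : C :=
  let: (v, v1, v2, v3) := p in
  let: (psi, psi1, psi2, psi3) := q in
  cint leb Omega (fun x => cint leb Sstar (fun y =>
    eps0V y * dot (curl v.1 x + curl (v1 x) y)
                  (conjv (curl psi.1 x + curl (psi1 x) y))))
  + cint leb Omega (fun x => cint leb Sigma (fun y =>
    (eps1 y)^-1 * dot (curl (v3 x) y) (conjv (curl (psi3 x) y))))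
  - cplx (k ^+ 2) * cint leb Omega (fun x => cint leb Y (fun y =>
      dot (fld v.1 x + chi Sstar y *: gradient (v2 x) y
                     + chi Sigma y *: fld (v3 x) y)
          (conjv (fld psi.1 x + chi Sstar y *: gradient (psi2 x) y
                              + chi Sigma y *: fld (psi3 x) y))))
  + cint leb (G `\` closure Omega) (fun x =>
      dot (curl v.1 x) (conjv (curl psi.1 x))
      - cplx (k ^+ 2) * dot (fld v.1 x) (conjv (fld psi.1 x)))
  - imagi R * cplx k *
    cint sigma (bdry G) (fun x => dot (utan n v x) (conjv (utan n psi x))).

Definition boundary_load (g : vfield R) (psi : gimp R) : C :=
  cint sigma (bdry G) (fun x => dot (g x) (conjv (utan n psi x))).

Definition two_scale_solution (g : vfield R) (p : quad) : Prop :=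
  forall q, HH q -> BB p q = boundary_load g q.1.1.1.

Definition cell1 (l : 'I_3) (w : gcurl R) : Prop :=
  Hcurl_per_on Sstar w /\ forall psi, Hcurl_per_on Sstar psi ->
    cint leb Sstar (fun y =>
      eps0V y * dot (evec R l + curl w y) (conjv (curl psi y))) = 0.

Definition cell2 (l : 'I_3) (w : ggrad R) : Prop :=
  H1_per0_on Sstar w /\ forall psi, H1_per0_on Sstar psi ->
    cint leb Sstar (fun y =>
      dot (evec R l + cplx (k ^+ 2) *: gradient w y)
          (conjv (gradient psi y))) = 0.

Definition cell3 (l : 'I_3) (w : gcurl R) : Prop :=
  H0curl Sigma w /\ forall psi, H0curl Sigma psi ->
    cint leb Sigma (fun y =>
      (eps1 y)^-1 * dot (curl w y) (conjv (curl psi y))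
      - cplx (k ^+ 2) * dot (fld w y) (conjv (fld psi y)))
    = cint leb Sigma (fun y => dot (evec R l) (conjv (fld psi y))).

Variables (w1 : 'I_3 -> gcurl R) (w2 : 'I_3 -> ggrad R) (w3 : 'I_3 -> gcurl R).

Definition eps_hom_cell : 'M[C]_3 := \matrix_(j, l)
  cint leb Sstar (fun y => eps0V y * dot (evec R l + curl (w1 l) y) (evec R j)).

Definition mu_hom_cell : 'M[C]_3 := \matrix_(j, l)
  cint leb Y (fun y =>
    dot (evec R l + (cplx (k ^+ 2) * chi Sstar y) *: gradient (w2 l) y
                  + (cplx (k ^+ 2) * chi Sigma y) *: fld (w3 l) y) (evec R j)).

(* The coefficients are specified off the Lebesgue-null interface bdry Omega
   only; the formula gives the value 0 there. *)
Definition effective (A : 'M[C]_3) (x : pt3 R) : 'M[C]_3 :=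
  chi (G `\` closure Omega) x *: 1%:M + chi Omega x *: A.

Definition effective_solution (g : vfield R) (u : gimp R) : Prop :=
  forall psi, Himp G n sigma psi ->
    cint leb G (fun x =>
      dot (effective eps_hom_cell x *m curl u.1 x) (conjv (curl psi.1 x))
      - cplx (k ^+ 2) *
        dot (effective mu_hom_cell x *m fld u.1 x) (conjv (fld psi.1 x)))
    - imagi R * cplx k *
      cint sigma (bdry G) (fun x => dot (utan n u x) (conjv (utan n psi x)))
    = boundary_load g psi.

(* The corrector identities hold for almost every x in Omega as identities in
   the respective spaces of functions of y: modulo ker curl_y for the first,
   modulo ker grad_y (the constants, as Sigma_star is connected) for the
   second, and almost everywhere in Sigma for the third. *)
Definition correctors (p : quad) : Prop :=
  let: (u, u1, u2, u3) := p in
  [/\ {ae leb, forall x, Omega x ->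
         ker_curl Sstar (u1 x - \sum_j curl u.1 x j 0 *: w1 j)},
      {ae leb, forall x, Omega x ->
         ker_grad Sstar (u2 x - \sum_j (cplx (k ^+ 2) * fld u.1 x j 0) *: w2 j)}
    & {ae leb, forall x, Omega x ->
         null_curl Sigma (u3 x - \sum_j (cplx (k ^+ 2) * fld u.1 x j 0) *: w3 j)}].

End Problems.

(* Main.v *)
Require Import Defs.
From HB Require Import structures.
From mathcomp Require Import all_boot all_order all_algebra.
From mathcomp Require Import all_classical all_reals all_analysis.
From mathcomp Require Import measurable_realfun complex ring lra.

(** At a fixed macroscopic point the microscopic part of the two-scale form is a sum
    of L2 inner products over the two parts of the cell, and its arguments are the
    fields curl u + curl_y u1, u + grad_y u2 and u + u3. Writing u1, u2, u3 as the
    correctors plus residuals turns these arguments into combinations of the cell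
    fields, with the components of curl u and of u as coefficients, plus residuals.
    The cell problems make the cell fields orthogonal to microscopic test fields; in
    the inclusion, where the third cell problem has a zeroth-order term, the remaining
    products cancel between the rotation term and the induction term. What is left
    ([micro_residual]) is the density of the effective form plus a form in the
    residuals.

    If the residuals vanish, the two-scale form is therefore the effective form,
    whatever the microscopic test fields are ([BB_correctors], [effective_form]). This
    proves one direction, and in the other it gives the effective problem, by testing
    with purely macroscopic fields, as soon as the correctors are identified. To
    identify them, take the macroscopic test field zero and one residual as the
    microscopic test field ([micro_test]). For the first two residuals the form is then
    definite ([corrector1], [corrector2]). For the third it is not, but its imaginary
    part is, because the imaginary part of eps1 is positive; so the rotation of the
    residual vanishes, and then the real part is a multiple of the squared norm of the
    residual ([corrector3]).

    The analysis behind this is that residuals are admissible test fields and that the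
    integrals over Omega of the separate inner products exist. Both follow from closure
    properties of Bochner spaces over a seminormed space: they contain sums, products of
    scalar L2 functions with fixed vectors, and images under bounded linear maps
    ([bochnerD], [bochner_scale], [bochner_map]), and bounded forms of two Bochner
    functions are integrable ([bochner_form], [bochner_ip]). The quotient seminorm on
    H(curl) enters only through the bound of the curl by it
    ([L2norm_curl_le_qnorm]). *)

Set Implicit Arguments.
Unset Strict Implicit.
Unset Printing Implicit Defensive.

Import Order.TTheory GRing.Theory Num.Theory.
Import numFieldNormedType.Exports.
Local Open Scope classical_set_scope.
Local Open Scope ring_scope.

(** * Borel sets and Lebesgue measure of space *)

Section Cells.
Variable R : realType.
Local Notation leb := (@leb3 R).
Implicit Types (A D U K : set (pt3 R)).

(** The product topology has a countable base of rational boxes, so its open sets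
    belong to the product of the Borel sigma-algebras. *)
Lemma open_measurable3 U : open U -> measurable3 U.
Proof.
move=> oU.
pose B (c : rat * rat * rat * rat) : set (pt3 R) :=
  (ball (ratr c.1.1.1 : R) (ratr c.2) `*` ball (ratr c.1.1.2 : R) (ratr c.2))
   `*` ball (ratr c.1.2 : R) (ratr c.2).
have mB c : measurable3 (B c).
  by apply: measurableX; [apply: measurableX|]; rewrite ball_itv; exact: measurable_itv.
rewrite (_ : U = \bigcup_c (if `[< B c `<=` U >] then B c else set0)).
  apply: countable_bigcupT_measurable; first exact: countableP.
  by move=> c; case: asboolP => // _; exact: mB.
apply/seteqP; split=> [x Ux|x [c _]]; last by case: asboolP => // BU /BU.
have /nbhs_ballP[e /= e0 eU] : nbhs x U by exact: open_nbhs_nbhs.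
have /rat_in_itvoo[q] : 0 < e / 2 by rewrite divr_gt0.
rewrite in_itv/= => /andP[q0 qe].
have near_rat (t : R) : exists r : rat, `|ratr r - t| < ratr q.
  have /rat_in_itvoo[r] : t - ratr q < t + ratr q by lra.
  by rewrite in_itv/= => rt; exists r; rewrite ltr_distl; lra.
have [r1 h1] := near_rat x.1.1; have [r2 h2] := near_rat x.1.2.
have [r3 h3] := near_rat x.2.
exists (r1, r2, r3, q) => //=; case: asboolP => [_|]; first by split.
case=> y [[/= y1 y2] y3]; apply: eU.
have close (a b c : R) : ball a (ratr q) b -> `|a - c| < ratr q -> ball c e b.
  rewrite /ball/= => h h'; rewrite (le_lt_trans (ler_distD a _ _))//.
  by rewrite (distrC c); move: (ratr q : R) h h' q0 qe => s; lra.
by split; [split|]; rewrite /=; [exact: close y1 _|exact: close y2 _|exact: close y3 _].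
Qed.

Lemma closed_measurable3 A : closed A -> measurable3 A.
Proof.
rewrite -openC => /open_measurable3 mA; rewrite -[A]setCK.
exact: (@measurableC _ (mpt3 R)).
Qed.

Lemma compact_measurable3 K : compact K -> measurable3 K.
Proof.
by move=> cK; apply: closed_measurable3; apply: compact_closed cK; exact: norm_hausdorff.
Qed.

Lemma continuous_measurable3 (f : pt3 R -> R) D :
  (forall x, {for x, continuous f}) -> @measurable_fun _ _ (mpt3 R) R D f.
Proof.
move=> cf; apply: (@measurable_funS _ _ (mpt3 R) R setT) => //.
apply: (measurability _ (RGenOpens.measurableE R)).
move=> _ [_ [a [b ->]] <-]; rewrite setTI; apply: open_measurable3.
by apply: open_comp => [x _|]; [exact: cf|exact: interval_open].
Qed.

Definition cube (r : R) : set (pt3 R) := `[- r, r]%classic `*` `[- r, r]%classic `*` `[- r, r]%classic.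

Lemma cube_measurable r : measurable3 (cube r).
Proof. by apply: measurableX; [apply: measurableX|]; exact: measurable_itv. Qed.

Lemma cube_compact r : compact (cube r).
Proof. by do 2?[apply: compact_setX]; exact: segment_compact. Qed.

Lemma cube_finite r : (leb (cube r) < +oo)%E.
Proof.
rewrite /leb3 /cube product_measure1E//=; last exact: measurableX.
rewrite product_measure1E//=.
have h : (lebesgue_measure `[(- r)%R, r]%classic < +oo)%E.
  by rewrite lebesgue_measure_itv/=; case: ifP => // _; rewrite -EFinB ltry.
by rewrite !lte_mul_pinfty ?mule_ge0// ge0_fin_numE ?mule_ge0// lte_mul_pinfty//
  ge0_fin_numE.
Qed.

Lemma compact_finite K : compact K -> (leb K < +oo)%E.
Proof.
move=> cK; have [M [_ bK]] := compact_bounded cK.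
have KM : K `<=` cube (M + 1).
  move=> x /(bK (M + 1) (ltr_pwDr ltr01 (lexx _)))/=.
  rewrite !prod_normE/= !ge_max => /andP[/andP[h1 h2] h3].
  by split; [split|]; rewrite /= in_itv/= -ler_norml.
apply: le_lt_trans (cube_finite (M + 1)); apply: le_measure => //.
  by rewrite inE; exact: compact_measurable3.
by rewrite inE; exact: cube_measurable.
Qed.

Lemma Ycell_measurable : measurable3 (@Ycell R).
Proof.
rewrite (_ : @Ycell R = `[- 2^-1, 2^-1[%classic `*` `[- 2^-1, 2^-1[%classic `*`
  `[- 2^-1, 2^-1[%classic).
  by apply: measurableX; [apply: measurableX|]; exact: measurable_itv.
apply/seteqP; split => [x Yx|x [[h1 h2] h3]].
  by split; [split|]; rewrite /= in_itv/=; [exact: (Yx 0)|exact: (Yx 1)|exact: (Yx 2)].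
by case=> [[|[|[|//]]] i]; [move: h1|move: h2|move: h3]; rewrite /= in_itv.
Qed.

Lemma Ycell_sub_cube : @Ycell R `<=` cube 2^-1.
Proof.
move=> x Yx; split; [split|]; rewrite /= in_itv/=.
- by have /andP[-> /ltW ->] := Yx 0.
- by have /andP[-> /ltW ->] := Yx 1.
- by have /andP[-> /ltW ->] := Yx 2.
Qed.

End Cells.

(** * Complex scalars and complex-valued integrals *)

Section ComplexScalars.
Variable R : realType.
Local Notation C := R[i].
Local Notation Re := complex.Re.
Local Notation Im := complex.Im.
Implicit Types (z w c : C).

Lemma cReD z w : Re (z + w) = Re z + Re w. Proof. by case: z; case: w. Qed.
Lemma cImD z w : Im (z + w) = Im z + Im w. Proof. by case: z; case: w. Qed.
Lemma cReM z w : Re (z * w) = Re z * Re w - Im z * Im w.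
Proof. by case: z; case: w. Qed.
Lemma cImM z w : Im (z * w) = Re z * Im w + Im z * Re w.
Proof. by case: z => a b; case: w. Qed.
Lemma cRe_conj z : Re (Num.conj z) = Re z. Proof. by case: z. Qed.
Lemma cIm_conj z : Im (Num.conj z) = - Im z. Proof. by case: z. Qed.

Lemma complexP z w : Re z = Re w -> Im z = Im w -> z = w.
Proof. by case: z => a b; case: w => c d /= -> ->. Qed.

Lemma sqn_ge0 z : 0 <= sqn z. Proof. by rewrite addr_ge0 ?sqr_ge0. Qed.
Lemma sqn0 : sqn (0 : C) = 0. Proof. by rewrite /sqn/= expr0n addr0. Qed.
Lemma sqnM z w : sqn (z * w) = sqn z * sqn w.
Proof. by rewrite /sqn cReM cImM; ring. Qed.
Lemma sqn_conj z : sqn (Num.conj z) = sqn z.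
Proof. by rewrite /sqn cRe_conj cIm_conj sqrrN. Qed.
Lemma sqn_cplx (r : R) : sqn (cplx r) = r ^+ 2.
Proof. by rewrite /sqn/= expr0n addr0. Qed.

Lemma sqn_eq0 z : sqn z = 0 -> z = 0.
Proof.
move/eqP; rewrite paddr_eq0 ?sqr_ge0// !sqrf_eq0 => /andP[/eqP h1 /eqP h2].
exact: complexP.
Qed.

Lemma mul_conj z : z * Num.conj z = cplx (sqn z).
Proof.
by apply: complexP; rewrite ?cReM ?cImM !cRe_conj !cIm_conj /sqn/=; ring.
Qed.

Lemma cplx0 : cplx 0 = 0 :> C. Proof. by []. Qed.
Lemma cplx_inj : injective (@cplx R). Proof. by move=> a b []. Qed.
Lemma cplxM (r s : R) : cplx (r * s) = cplx r * cplx s.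
Proof. by apply: complexP; rewrite ?cReM ?cImM /=; ring. Qed.

(** A pointwise form of the triangle inequality that survives integration: the
    free parameter is optimised only after the squares have been integrated. *)
Lemma sqnD_le (t : R) z w : 0 < t ->
  sqn (z + w) <= (1 + t) * sqn z + (1 + t^-1) * sqn w.
Proof.
move=> t0; rewrite /sqn cReD cImD.
have young (a b : R) : (a + b) ^+ 2 <= (1 + t) * a ^+ 2 + (1 + t^-1) * b ^+ 2.
  have : 0 <= t^-1 * (t * a - b) ^+ 2 by rewrite mulr_ge0 ?sqr_ge0// invr_ge0 ltW.
  have -> : t^-1 * (t * a - b) ^+ 2 = t * a ^+ 2 - 2 * a * b + t^-1 * b ^+ 2.
    by field; rewrite gt_eqF.
  lra.
by have := young (Re z) (Re w); have := young (Im z) (Im w); lra.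
Qed.

(** Young's inequality. Its weight [t] is kept free because it is what later turns a
    bound by a sum of squares into a bound by a product of norms. *)
Lemma norm_mul_le (t a b : R) : 0 < t -> 2 * `|a * b| <= t * a ^+ 2 + t^-1 * b ^+ 2.
Proof.
move=> t0; suff h (e : R) : e ^+ 2 = 1 -> 2 * (e * (a * b)) <= t * a ^+ 2 + t^-1 * b ^+ 2.
  have h1 := h 1 (expr1n _ _); have h2 : 2 * (-1 * (a * b)) <= _ := h _ (sqrr_sign _ 1%N).
  by case: (ger0P (a * b)) => _; lra.
move=> e2; have : 0 <= t^-1 * (t * a - e * b) ^+ 2.
  by rewrite mulr_ge0 ?sqr_ge0// invr_ge0 ltW.
have -> : t^-1 * (t * a - e * b) ^+ 2 =
    t * a ^+ 2 - 2 * (e * (a * b)) + t^-1 * (e ^+ 2 * b ^+ 2).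
  by field; rewrite gt_eqF.
rewrite e2 mul1r; lra.
Qed.

Lemma norm_ReM_le (t : R) z w : 0 < t ->
  `|Re (z * w)| <= t * sqn z + t^-1 * sqn w.
Proof.
move=> t0; rewrite cReM (le_trans (ler_normB _ _))// /sqn.
have := norm_mul_le (Re z) (Re w) t0; have := norm_mul_le (Im z) (Im w) t0.
have := normr_ge0 (Re z * Re w); have := normr_ge0 (Im z * Im w); lra.
Qed.

Lemma norm_ImM_le (t : R) z w : 0 < t ->
  `|Im (z * w)| <= t * sqn z + t^-1 * sqn w.
Proof.
move=> t0; rewrite cImM (le_trans (ler_normD _ _))// /sqn.
have := norm_mul_le (Re z) (Im w) t0; have := norm_mul_le (Im z) (Re w) t0.
have := normr_ge0 (Re z * Im w); have := normr_ge0 (Im z * Re w); lra.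
Qed.

End ComplexScalars.

Section AlmostEverywhere.
Variables (R : realType) (mu : {measure set (mpt3 R) -> \bar R}).
Implicit Types (P Q : pt3 R -> Prop).

Lemma ae_imp P Q : (forall x, P x -> Q x) ->
  {ae mu, forall x, P x} -> {ae mu, forall x, Q x}.
Proof. by move=> PQ; apply: (@filterS _ _ (ae_filter_ringOfSetsType mu)). Qed.

Lemma ae_and P Q : {ae mu, forall x, P x} -> {ae mu, forall x, Q x} ->
  {ae mu, forall x, P x /\ Q x}.
Proof. by move=> hP hQ; apply: (@filterI _ _ (ae_filter_ringOfSetsType mu)). Qed.

End AlmostEverywhere.

Section ComplexIntegral.
Variable R : realType.
Local Notation C := R[i].
Local Notation Re := complex.Re.
Local Notation Im := complex.Im.
Variables (mu : {measure set (mpt3 R) -> \bar R}) (D : set (pt3 R)).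
Hypothesis mD : measurable3 D.
Implicit Types (f g : sfield R) (c : C).

Definition cintegrable f :=
  mu.-integrable D (EFin \o (fun x => Re (f x))) /\
  mu.-integrable D (EFin \o (fun x => Im (f x))).

Lemma eq_cint f g : (forall x, D x -> f x = g x) -> cint mu D f = cint mu D g.
Proof.
by move=> fg; congr Complex; apply: eq_Rintegral => x /set_mem/fg ->.
Qed.

Lemma eq_cintegrable f g : (forall x, D x -> f x = g x) ->
  cintegrable f -> cintegrable g.
Proof.
by move=> fg [h1 h2]; split; [move: h1|move: h2]; apply: eq_integrable => // x;
  move=> /set_mem/fg /= ->.
Qed.

Lemma cintegrable0 : cintegrable (fun=> 0).
Proof. by split; exact: integrable0. Qed.

Lemma cint0 : cint mu D (fun=> 0) = 0.
Proof. by rewrite /cint /Rintegral/= integral0. Qed.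

Lemma cintegrableD f g : cintegrable f -> cintegrable g ->
  cintegrable (fun x => f x + g x).
Proof.
move=> [f1 f2] [g1 g2]; split.
  by apply: eq_integrable (integrableD mD f1 g1) => // x _; rewrite /= cReD.
by apply: eq_integrable (integrableD mD f2 g2) => // x _; rewrite /= cImD.
Qed.

Lemma cintD f g : cintegrable f -> cintegrable g ->
  cint mu D (fun x => f x + g x) = cint mu D f + cint mu D g.
Proof.
move=> [f1 f2] [g1 g2]; apply: complexP; rewrite /= -RintegralD//;
  by apply: eq_Rintegral => x _; rewrite ?cReD ?cImD.
Qed.

Lemma cintegrableZ c f : cintegrable f -> cintegrable (fun x => c * f x).
Proof.
move=> [f1 f2]; split.
  apply: eq_integrable (integrableB mD (integrableZl mD (Re c) f1)
    (integrableZl mD (Im c) f2)) => // x _.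
  by rewrite /= cReM.
apply: eq_integrable (integrableD mD (integrableZl mD (Re c) f2)
  (integrableZl mD (Im c) f1)) => // x _.
by rewrite /= cImM.
Qed.

Lemma cintZ c f : cintegrable f ->
  cint mu D (fun x => c * f x) = c * cint mu D f.
Proof.
move=> [f1 f2]; apply: complexP; rewrite ?cReM ?cImM /= -!RintegralZl//.
- rewrite -RintegralB//; try exact: (integrableZl mD _ f1).
  + by apply: eq_Rintegral => x _; rewrite cReM.
  + exact: (integrableZl mD _ f2).
- rewrite -RintegralD//; try exact: (integrableZl mD _ f1).
  + by apply: eq_Rintegral => x _; rewrite cImM.
  + exact: (integrableZl mD _ f2).
Qed.

Lemma cintegrableB f g : cintegrable f -> cintegrable g ->
  cintegrable (fun x => f x - g x).
Proof.
move=> hf hg; apply: eq_cintegrable (cintegrableD hf (cintegrableZ (-1) hg)).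
by move=> x _; rewrite mulN1r.
Qed.

Lemma cintB f g : cintegrable f -> cintegrable g ->
  cint mu D (fun x => f x - g x) = cint mu D f - cint mu D g.
Proof.
move=> hf hg; rewrite -mulN1r -cintZ// -cintD//; last exact: cintegrableZ.
by apply: eq_cint => x _; rewrite mulN1r.
Qed.

Lemma cintegrable_sum (I : Type) (s : seq I) (F : I -> sfield R) :
  (forall i, cintegrable (F i)) -> cintegrable (fun x => \sum_(i <- s) F i x).
Proof.
move=> hF; elim: s => [|i s IH].
  by apply: eq_cintegrable cintegrable0 => x _; rewrite big_nil.
by apply: eq_cintegrable (cintegrableD (hF i) IH) => x _; rewrite big_cons.
Qed.

Lemma cint_sum (I : Type) (s : seq I) (F : I -> sfield R) :
  (forall i, cintegrable (F i)) ->
  cint mu D (fun x => \sum_(i <- s) F i x) = \sum_(i <- s) cint mu D (F i).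
Proof.
move=> hF; elim: s => [|i s IH].
  by rewrite big_nil -[RHS]cint0; apply: eq_cint => x _; rewrite big_nil.
rewrite big_cons -IH -cintD//; last exact: cintegrable_sum.
by apply: eq_cint => x _; rewrite big_cons.
Qed.

Lemma ae_eq_cint f g : cintegrable f -> cintegrable g ->
  {ae mu, forall x, D x -> f x = g x} -> cint mu D f = cint mu D g.
Proof.
move=> [f1 f2] [g1 g2] fg; congr Complex; congr fine; apply: ae_eq_integral => //.
- exact: measurable_int f1.
- exact: measurable_int g1.
- by apply: ae_imp fg => x h Dx; rewrite /= h.
- exact: measurable_int f2.
- exact: measurable_int g2.
- by apply: ae_imp fg => x h Dx; rewrite /= h.
Qed.

Lemma ae_ge0_Re_cint f : cintegrable f ->
  {ae mu, forall x, D x -> 0 <= Re (f x)} ->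
  (Re (cint mu D f))%:E = (\int[mu]_(x in D) `|(Re (f x))%:E|)%E.
Proof.
move=> [f1 _] f0; rewrite /= /Rintegral fineK; last exact: integrable_fin_num.
apply: ae_eq_integral => //; first exact: measurable_int f1.
  have /measurable_EFinP mf := measurable_int mu f1.
  by apply/measurable_EFinP; exact: measurableT_comp mf.
by apply: ae_imp f0 => x h Dx; rewrite /= ger0_norm// h.
Qed.

Lemma Re_cint_ge0 f : cintegrable f ->
  {ae mu, forall x, D x -> 0 <= Re (f x)} -> 0 <= Re (cint mu D f).
Proof.
move=> hf f0; rewrite -lee_fin ae_ge0_Re_cint//; exact: integral_ge0.
Qed.

(** Only the real part is inspected, since it is the part of the sesquilinear forms below
    that has a sign. *)
Lemma Re_cint_eq0 f : cintegrable f ->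
  {ae mu, forall x, D x -> 0 <= Re (f x)} ->
  Re (cint mu D f) = 0 -> {ae mu, forall x, D x -> Re (f x) = 0}.
Proof.
move=> hf f0 If; have := ae_ge0_Re_cint hf f0; rewrite If => /esym.
move/ae_eq_integral_abs => /(_ mD (measurable_int _ hf.1)).
by apply: ae_imp => x h /h /= [].
Qed.

End ComplexIntegral.

Lemma cint_setU (R : realType) (mu : {measure set (mpt3 R) -> \bar R})
    (A B : set (pt3 R)) (f : sfield R) : measurable3 A -> measurable3 B ->
  [disjoint A & B] -> cintegrable mu (A `|` B) f ->
  cint mu (A `|` B) f = cint mu A f + cint mu B f.
Proof.
by move=> mA mB AB [h1 h2]; rewrite /cint !Rintegral_setU.
Qed.

Lemma cintegrable_setU (R : realType) (mu : {measure set (mpt3 R) -> \bar R})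
    (A B : set (pt3 R)) (f : sfield R) : measurable3 A -> measurable3 B ->
  [disjoint A & B] -> cintegrable mu A f -> cintegrable mu B f ->
  cintegrable mu (A `|` B) f.
Proof.
move=> mA mB AB; have mAB : measurable3 (A `|` B) by exact: (@measurableU _ (mpt3 R)).
have glue (h : pt3 R -> \bar R) : mu.-integrable A h -> mu.-integrable B h ->
    mu.-integrable (A `|` B) h.
  move=> hA hB.
  have hA' : mu.-integrable (A `|` B) (h \_ A).
    by apply/(@integrable_restrict _ (mpt3 R) _ mu A mA) => //; rewrite setUK.
  have hB' : mu.-integrable (A `|` B) (h \_ B).
    by apply/(@integrable_restrict _ (mpt3 R) _ mu B mB) => //; rewrite setUC setUK.
  apply: eq_integrable (integrableD mAB hA' hB') => // x; rewrite inE => ABx.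
  rewrite /= !patchE; case: ABx => [Ax|Bx].
    rewrite mem_set// memNset ?adde0// => Bx.
    by move/disj_setPS: AB => /(_ x); apply.
  rewrite (mem_set Bx) memNset ?add0e// => Ax.
  by move/disj_setPS: AB => /(_ x); apply.
by move=> [a1 a2] [b1 b2]; split; exact: glue.
Qed.


(** * Square integrable scalar functions *)

Section SquareIntegrable.
Variable R : realType.
Local Notation C := R[i].
Local Notation Re := complex.Re.
Local Notation Im := complex.Im.
Variables (mu : {measure set (mpt3 R) -> \bar R}) (D : set (pt3 R)).
Hypothesis mD : measurable3 D.
Implicit Types (f g a : sfield R) (v w : vfield R) (c : C).

Definition snorm2 f : R := (\int[mu]_(x in D) sqn (f x))%R.

Lemma measurable_sqn f : cmeasurable D f ->
  @measurable_fun _ _ (mpt3 R) R D (fun x => sqn (f x)).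
Proof. by move=> [m1 m2]; apply: measurable_funD; exact: measurable_funX. Qed.

Lemma cmeasurable_cst c : cmeasurable D (fun=> c).
Proof. by split; exact: measurable_cst. Qed.

Lemma cmeasurableD f g : cmeasurable D f -> cmeasurable D g ->
  cmeasurable D (fun x => f x + g x).
Proof.
move=> [f1 f2] [g1 g2]; split.
  by under eq_fun do rewrite cReD; exact: measurable_funD.
by under eq_fun do rewrite cImD; exact: measurable_funD.
Qed.

Lemma cmeasurableM f g : cmeasurable D f -> cmeasurable D g ->
  cmeasurable D (fun x => f x * g x).
Proof.
move=> [f1 f2] [g1 g2]; split.
  by under eq_fun do rewrite cReM; apply: measurable_funB; exact: measurable_funM.
by under eq_fun do rewrite cImM; apply: measurable_funD; exact: measurable_funM.
Qed.

Lemma cmeasurable_conj f : cmeasurable D f ->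
  cmeasurable D (fun x => Num.conj (f x)).
Proof.
move=> [f1 f2]; split; first by under eq_fun do rewrite cRe_conj.
by under eq_fun do rewrite cIm_conj; exact: measurableT_comp.
Qed.

Lemma eq_cmeasurable f g : (forall x, D x -> f x = g x) ->
  cmeasurable D f -> cmeasurable D g.
Proof.
by move=> fg [h1 h2]; split; [move: h1|move: h2]; apply: eq_measurable_fun => x;
  move=> /set_mem/fg ->.
Qed.

Lemma sL2P f : sL2 mu D f <->
  cmeasurable D f /\ mu.-integrable D (EFin \o (fun x => sqn (f x))).
Proof.
have h : (\int[mu]_(x in D) (sqn (f x))%:E =
          \int[mu]_(x in D) `|(EFin \o (fun x => sqn (f x))) x|)%E.
  by apply: eq_integral => x _ /=; rewrite ger0_norm// sqn_ge0.
split=> [[mf f2]|[mf /integrableP[_ f2]]]; split => //; last by rewrite h.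
apply/integrableP; split; last by rewrite -h.
by apply/measurable_EFinP; exact: measurable_sqn.
Qed.

Lemma eq_sL2 f g : (forall x, D x -> f x = g x) -> sL2 mu D f -> sL2 mu D g.
Proof.
move=> fg [mf If]; split; first exact: eq_cmeasurable mf.
apply: le_lt_trans If; rewrite le_eqVlt; apply/orP; left; apply/eqP.
by apply: eq_integral => x /set_mem/fg ->.
Qed.

Lemma sL2_le f (h : pt3 R -> R) : cmeasurable D f ->
  mu.-integrable D (EFin \o h) -> (forall x, D x -> sqn (f x) <= h x) ->
  sL2 mu D f.
Proof.
move=> mf ih fh; apply/sL2P; split => //; apply: (le_integrable mD _ _ ih).
  by apply/measurable_EFinP; exact: measurable_sqn.
by move=> x Dx /=; rewrite lee_fin ger0_norm ?sqn_ge0// (le_trans (fh x Dx))// ler_norm.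
Qed.

Lemma sL2_0 : sL2 mu D (fun=> 0).
Proof.
by apply: (@sL2_le _ (fun=> 0)); [exact: cmeasurable_cst|exact: integrable0|
  move=> x _; rewrite sqn0].
Qed.

Lemma snorm2_ge0 f : 0 <= snorm2 f.
Proof. by apply: Rintegral_ge0 => x _; exact: sqn_ge0. Qed.

Lemma integrable_le_sqnD (t : R) f g : sL2 mu D f -> sL2 mu D g ->
  mu.-integrable D (EFin \o (fun x => (1 + t) * sqn (f x) + (1 + t^-1) * sqn (g x))).
Proof.
move=> /sL2P[_ f2] /sL2P[_ g2].
by apply: eq_integrable (integrableD mD (integrableZl mD (1 + t) f2)
   (integrableZl mD (1 + t^-1) g2)).
Qed.

Lemma sL2D f g : sL2 mu D f -> sL2 mu D g -> sL2 mu D (fun x => f x + g x).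
Proof.
move=> hf hg; apply: (sL2_le _ (integrable_le_sqnD 1 hf hg)).
  by apply: cmeasurableD; [case: hf|case: hg].
by move=> x _; exact: sqnD_le.
Qed.

Lemma snorm2D (t : R) f g : 0 < t -> sL2 mu D f -> sL2 mu D g ->
  snorm2 (fun x => f x + g x) <= (1 + t) * snorm2 f + (1 + t^-1) * snorm2 g.
Proof.
move=> t0 hf hg; have /sL2P[_ fg2] := sL2D hf hg.
have /sL2P[_ f2] := hf; have /sL2P[_ g2] := hg.
apply: (@le_trans _ _
    (\int[mu]_(x in D) ((1 + t) * sqn (f x) + (1 + t^-1) * sqn (g x)))%R).
  apply: le_Rintegral => //; first exact: integrable_le_sqnD.
  by move=> x _; exact: sqnD_le.
rewrite RintegralD ?RintegralZl//; [exact: (integrableZl mD _ f2)|exact: (integrableZl mD _ g2)].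
Qed.

Lemma sL2Z c f : sL2 mu D f -> sL2 mu D (fun x => c * f x).
Proof.
move=> /sL2P[mf f2]; apply: (sL2_le _ (integrableZl mD (sqn c) f2)).
  by apply: cmeasurableM => //; exact: cmeasurable_cst.
by move=> x _; rewrite sqnM.
Qed.

Lemma snorm2Z c f : sL2 mu D f -> snorm2 (fun x => c * f x) = sqn c * snorm2 f.
Proof.
move=> /sL2P[mf f2]; rewrite /snorm2 -RintegralZl//.
by apply: eq_Rintegral => x _; rewrite sqnM.
Qed.

Lemma eq_snorm2 f g : (forall x, D x -> f x = g x) -> snorm2 f = snorm2 g.
Proof. by move=> fg; apply: eq_Rintegral => x /set_mem/fg ->. Qed.

Lemma sL2_conj f : sL2 mu D f -> sL2 mu D (fun x => Num.conj (f x)).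
Proof.
move=> /sL2P[mf f2]; apply: (sL2_le _ f2); first exact: cmeasurable_conj.
by move=> x _; rewrite sqn_conj.
Qed.

Lemma sL2M f g : sL2 mu D f -> sL2 mu D g -> cintegrable mu D (fun x => f x * g x).
Proof.
move=> hf hg; have [m1 m2] := cmeasurableM hf.1 hg.1.
have /sL2P[_ f2] := hf; have /sL2P[_ g2] := hg.
have i2 := integrableD mD f2 g2.
split; apply: (le_integrable mD _ _ i2); first exact/measurable_EFinP.
- move=> x _ /=; rewrite lee_fin (le_trans (norm_ReM_le _ _ ltr01))//.
  by rewrite invr1 !mul1r ler_norm.
- exact/measurable_EFinP.
- move=> x _ /=; rewrite lee_fin (le_trans (norm_ImM_le _ _ ltr01))//.
  by rewrite invr1 !mul1r ler_norm.
Qed.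

Lemma cint_mul_le (t : R) f g : 0 < t -> sL2 mu D f -> sL2 mu D g ->
  `|Re (cint mu D (fun x => f x * g x))| <= t * snorm2 f + t^-1 * snorm2 g /\
  `|Im (cint mu D (fun x => f x * g x))| <= t * snorm2 f + t^-1 * snorm2 g.
Proof.
move=> t0 hf hg; have [i1 i2] := sL2M hf hg.
have /sL2P[_ f2] := hf; have /sL2P[_ g2] := hg.
have it := integrableZl mD t f2; have it' := integrableZl mD t^-1 g2.
have -> : t * snorm2 f + t^-1 * snorm2 g =
    (\int[mu]_(x in D) (t * sqn (f x) + t^-1 * sqn (g x)))%R.
  by rewrite (RintegralD mD it it') !RintegralZl.
split.
  rewrite (le_trans (le_normr_Rintegral mD i1))//.
  apply: le_Rintegral => //; [exact: integrable_norm|exact: (integrableD mD it it')|].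
  by move=> x _; exact: norm_ReM_le.
rewrite (le_trans (le_normr_Rintegral mD i2))//.
apply: le_Rintegral => //; [exact: integrable_norm|exact: (integrableD mD it it')|].
by move=> x _; exact: norm_ImM_le.
Qed.

Definition ess_bounded (M : R) a :=
  cmeasurable D a /\ {ae mu, forall x, D x -> sqn (a x) <= M}.

Lemma ess_bounded_sL2 (M : R) a f : 0 <= M -> ess_bounded M a -> sL2 mu D f ->
  sL2 mu D (fun x => a x * f x) /\ snorm2 (fun x => a x * f x) <= M * snorm2 f.
Proof.
move=> M0 [ma aM] hf; have /sL2P[mf f2] := hf.
have maf := cmeasurableM ma mf.
have le_int : (\int[mu]_(x in D) (sqn (a x * f x))%:E <=
          \int[mu]_(x in D) (M * sqn (f x))%:E)%E.
  apply: ae_ge0_le_integral => //.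
  - by move=> x _; rewrite lee_fin sqn_ge0.
  - by apply/measurable_EFinP; exact: measurable_sqn.
  - by move=> x _; rewrite lee_fin mulr_ge0// sqn_ge0.
  - by apply/measurable_EFinP/measurable_funM => //; exact: measurable_sqn.
  - by apply: ae_imp aM => x h Dx; rewrite lee_fin sqnM ler_wpM2r ?sqn_ge0// h.
have iM := integrableZl mD M f2.
have haf : sL2 mu D (fun x => a x * f x).
  by split => //; apply: le_lt_trans le_int _; exact: (integrable_lty mD iM).
split => //; rewrite /snorm2 -RintegralZl// /Rintegral fine_le//.
  by have /sL2P[_ /(integrable_fin_num mD)] := haf.
exact: (integrable_fin_num mD iM).
Qed.

Lemma cst_sL2 c : (mu D < +oo)%E -> sL2 mu D (fun=> c).
Proof.
move=> Dfin; apply: (@sL2_le _ (fun=> sqn c)) => //.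
by apply/integrableP; split; [exact: measurable_cst|
  rewrite integral_cst//= lte_mul_pinfty// lee_fin].
Qed.

End SquareIntegrable.

Lemma sL2S (R : realType) (mu : {measure set (mpt3 R) -> \bar R})
    (A B : set (pt3 R)) (f : sfield R) : measurable3 A -> measurable3 B ->
  A `<=` B -> sL2 mu B f -> sL2 mu A f.
Proof.
move=> mA mB AB /sL2P[[m1 m2] f2]; apply/sL2P; split.
  by split; [exact: measurable_funS m1|exact: measurable_funS m2].
exact: integrableS f2.
Qed.

(** * Square integrable vector fields *)

Section VectorFields.
Variable R : realType.
Local Notation C := R[i].
Local Notation Re := complex.Re.
Local Notation Im := complex.Im.
Variables (mu : {measure set (mpt3 R) -> \bar R}) (D : set (pt3 R)).
Hypothesis mD : measurable3 D.
Implicit Types (v w : vfield R) (a : sfield R) (c : C).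

Definition vnorm2 v : R := \sum_j snorm2 mu D (fun x => v x j 0).

Lemma L2_0 : L2 mu D 0.
Proof. by move=> j; apply: eq_sL2 (sL2_0 mu mD) => // x _; rewrite mxE. Qed.

Lemma L2D v w : L2 mu D v -> L2 mu D w -> L2 mu D (v + w).
Proof.
by move=> hv hw j; apply: eq_sL2 (sL2D mD (hv j) (hw j)) => // x _; rewrite mxE.
Qed.

Lemma L2Z c v : L2 mu D v -> L2 mu D (c *: v).
Proof.
by move=> hv j; apply: eq_sL2 (sL2Z mD c (hv j)) => // x _; rewrite mxE.
Qed.

Lemma eq_L2 v w : (forall x, D x -> v x = w x) -> L2 mu D v -> L2 mu D w.
Proof. by move=> vw hv j; apply: eq_sL2 (hv j) => // x /vw ->. Qed.

Lemma L2_conj v : L2 mu D v -> L2 mu D (fun x => conjv (v x)).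
Proof.
by move=> hv j; apply: eq_sL2 (sL2_conj mD (hv j)) => // x _; rewrite mxE.
Qed.

Lemma cst_L2 (b : 'cV[C]_3) : (mu D < +oo)%E -> L2 mu D (fun=> b).
Proof. by move=> Dfin j; exact: cst_sL2. Qed.

Lemma L2_dot v w : L2 mu D v -> L2 mu D w ->
  cintegrable mu D (fun x => dot (v x) (w x)).
Proof. by move=> hv hw; apply: cintegrable_sum => // j; exact: sL2M. Qed.

Lemma vnorm2_ge0 v : 0 <= vnorm2 v.
Proof. by apply: sumr_ge0 => j _; exact: snorm2_ge0. Qed.

Lemma vnorm2Z c v : L2 mu D v -> vnorm2 (c *: v) = sqn c * vnorm2 v.
Proof.
move=> hv; rewrite /vnorm2 mulr_sumr; apply: eq_bigr => j _.
by rewrite -snorm2Z//; apply: eq_snorm2 => // x _; rewrite mxE.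
Qed.

Lemma vnorm2D (t : R) v w : 0 < t -> L2 mu D v -> L2 mu D w ->
  vnorm2 (v + w) <= (1 + t) * vnorm2 v + (1 + t^-1) * vnorm2 w.
Proof.
move=> t0 hv hw; rewrite /vnorm2 !mulr_sumr -big_split/=; apply: ler_sum => j _.
apply: le_trans (snorm2D mD t0 (hv j) (hw j)).
by rewrite le_eqVlt; apply/orP; left; apply/eqP/eq_snorm2 => // x _; rewrite mxE.
Qed.

Lemma sqnv_ge0 (b : 'cV[C]_3) : 0 <= sqnv b.
Proof. by apply: sumr_ge0 => j _; exact: sqn_ge0. Qed.

Lemma sqnv_eq0 (b : 'cV[C]_3) : sqnv b = 0 -> b = 0.
Proof.
move/eqP; rewrite psumr_eq0; last by move=> j _; exact: sqn_ge0.
move/allP => h; apply/colP => j; rewrite mxE.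
by apply/sqn_eq0/eqP/(implyP (h j _)) => //; rewrite mem_index_enum.
Qed.

Lemma integrable_sqnv v : L2 mu D v ->
  mu.-integrable D (EFin \o (fun x => sqnv (v x))).
Proof.
move=> hv.
apply: eq_integrable (integrable_sum mD (index_enum _) (P := xpredT)
  (h := fun j x => (sqn (v x j 0))%:E) _) => //.
- by move=> x _; rewrite /= sumEFin.
- by move=> j _; have /sL2P[_] := hv j.
Qed.

Lemma Rintegral_sqnv v : L2 mu D v -> (\int[mu]_(x in D) sqnv (v x))%R = vnorm2 v.
Proof.
move=> hv; rewrite /Rintegral.
under eq_integral do rewrite -sumEFin.
rewrite integral_sum//; last by move=> j; have /sL2P[_] := hv j.
rewrite -sum_fine// => j _; have /sL2P[_] := hv j; exact: integrable_fin_num.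
Qed.

Definition ip v w : C := cint mu D (fun x => dot (v x) (conjv (w x))).

Lemma dotDl (a b c : 'cV[C]_3) : dot (a + b) c = dot a c + dot b c.
Proof. by rewrite /dot -big_split/=; apply: eq_bigr => j _; rewrite mxE mulrDl. Qed.
Lemma dotDr (a b c : 'cV[C]_3) : dot c (a + b) = dot c a + dot c b.
Proof. by rewrite /dot -big_split/=; apply: eq_bigr => j _; rewrite mxE mulrDr. Qed.
Lemma dotZl (z : C) (a b : 'cV[C]_3) : dot (z *: a) b = z * dot a b.
Proof. by rewrite /dot mulr_sumr; apply: eq_bigr => j _; rewrite mxE mulrA. Qed.
Lemma dotZr (z : C) (a b : 'cV[C]_3) : dot a (z *: b) = z * dot a b.
Proof. by rewrite /dot mulr_sumr; apply: eq_bigr => j _; rewrite mxE mulrCA. Qed.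
Lemma dot0l (a : 'cV[C]_3) : dot 0 a = 0.
Proof. by rewrite -(scale0r 0) dotZl mul0r. Qed.
Lemma dot0r (a : 'cV[C]_3) : dot a 0 = 0.
Proof. by rewrite -(scale0r 0) dotZr mul0r. Qed.
Lemma dot_suml (I : finType) (F : I -> 'cV[C]_3) (b : 'cV[C]_3) :
  dot (\sum_i F i) b = \sum_i dot (F i) b.
Proof. by elim/big_rec2: _ => [|i z a _ <-]; [exact: dot0l|exact: dotDl]. Qed.

Lemma conjvD (a b : 'cV[C]_3) : conjv (a + b) = conjv a + conjv b.
Proof. by rewrite /conjv map_mxD. Qed.
Lemma conjvZ (z : C) (a : 'cV[C]_3) : conjv (z *: a) = Num.conj z *: conjv a.
Proof. by rewrite /conjv map_mxZ. Qed.
Lemma conjv0 : conjv (0 : 'cV[C]_3) = 0.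
Proof. by rewrite /conjv map_mx0. Qed.

Lemma dot_conj (a : 'cV[C]_3) : dot a (conjv a) = cplx (sqnv a).
Proof.
rewrite /dot /sqnv; elim/big_rec2: _ => // j r z _ ->.
by rewrite mxE mul_conj; apply: complexP; rewrite ?cReD ?cImD //= addr0.
Qed.

Lemma ip_integrable v w : L2 mu D v -> L2 mu D w ->
  cintegrable mu D (fun x => dot (v x) (conjv (w x))).
Proof. by move=> hv hw; exact/L2_dot/L2_conj. Qed.

Lemma ipDl v v' w : L2 mu D v -> L2 mu D v' -> L2 mu D w ->
  ip (v + v') w = ip v w + ip v' w.
Proof.
move=> hv hv' hw; rewrite /ip -cintD//; try exact: ip_integrable.
by apply: eq_cint => // x _; rewrite -dotDl.
Qed.

Lemma ipDr v w w' : L2 mu D v -> L2 mu D w -> L2 mu D w' ->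
  ip v (w + w') = ip v w + ip v w'.
Proof.
move=> hv hv' hw; rewrite /ip -cintD//; try exact: ip_integrable.
by apply: eq_cint => // x _; rewrite -dotDr -conjvD.
Qed.

Lemma ipZl c v w : L2 mu D v -> L2 mu D w -> ip (c *: v) w = c * ip v w.
Proof.
move=> hv hw; rewrite /ip -cintZ//; try exact: ip_integrable.
by apply: eq_cint => // x _; rewrite -dotZl.
Qed.

Lemma ipZr c v w : L2 mu D v -> L2 mu D w -> ip v (c *: w) = Num.conj c * ip v w.
Proof.
move=> hv hw; rewrite /ip -cintZ//; try exact: ip_integrable.
by apply: eq_cint => // x _; rewrite -dotZr -conjvZ.
Qed.

Lemma ip_suml (v : 'I_3 -> vfield R) w : (forall j, L2 mu D (v j)) -> L2 mu D w ->
  ip (\sum_j v j) w = \sum_j ip (v j) w.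
Proof.
move=> hv hw; rewrite /ip -cint_sum//; last by move=> j; exact: ip_integrable.
by apply: eq_cint => // x _; rewrite fct_sumE dot_suml.
Qed.

Lemma ip_le (t : R) v w : 0 < t -> L2 mu D v -> L2 mu D w ->
  `|Re (ip v w)| <= t * vnorm2 v + t^-1 * vnorm2 w /\
  `|Im (ip v w)| <= t * vnorm2 v + t^-1 * vnorm2 w.
Proof.
move=> t0 hv hw; have hcw := L2_conj hw.
have -> : ip v w = \sum_j cint mu D (fun x => v x j 0 * conjv (w x) j 0).
  by rewrite -cint_sum// => j; exact: sL2M.
have nw j : snorm2 mu D (fun x => conjv (w x) j 0) = snorm2 mu D (fun x => w x j 0).
  by apply: eq_Rintegral => x _; rewrite mxE sqn_conj.
rewrite (big_morph _ (@cReD R) (id1 := 0)) // (big_morph _ (@cImD R) (id1 := 0)) //.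
by rewrite /vnorm2 !mulr_sumr -big_split/=; split; rewrite (le_trans (ler_norm_sum _ _ _))//;
  apply: ler_sum => j _; rewrite -nw; have [] := cint_mul_le mD t0 (hv j) (hcw j).
Qed.

Definition amul a v : vfield R := fun x => a x *: v x.

Lemma amulD a v w : amul a (v + w) = amul a v + amul a w.
Proof. by apply/funext => x; rewrite /amul scalerDr. Qed.

Lemma amulZ a c v : amul a (c *: v) = c *: amul a v.
Proof. by apply/funext => x; rewrite /amul !scalrfctE/= !scalerA mulrC. Qed.

Lemma amul_sum a (c : 'I_3 -> C) (v : 'I_3 -> vfield R) :
  amul a (\sum_j c j *: v j) = \sum_j c j *: amul a (v j).
Proof.
elim/big_rec2: _ => [|j w' w _ <-]; last by rewrite amulD amulZ.
by apply/funext => x; rewrite /amul scaler0.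
Qed.

Lemma amul_L2 (M : R) a v : 0 <= M -> ess_bounded mu D M a -> L2 mu D v ->
  L2 mu D (amul a v) /\ vnorm2 (amul a v) <= M * vnorm2 v.
Proof.
move=> M0 ha hv.
have h j := ess_bounded_sL2 mD M0 ha (hv j).
split=> [j|]; first by apply: eq_sL2 (h j).1 => // x _; rewrite mxE.
rewrite /vnorm2 mulr_sumr; apply: ler_sum => j _; apply: le_trans (h j).2.
by rewrite le_eqVlt; apply/orP; left; apply/eqP/eq_snorm2 => // x _; rewrite mxE.
Qed.

Lemma ip_amul a v w :
  cint mu D (fun x => a x * dot (v x) (conjv (w x))) = ip (amul a v) w.
Proof. by apply: eq_cint => x _; rewrite dotZl. Qed.

Lemma ae_eq_ip v v' w : L2 mu D v -> L2 mu D v' -> L2 mu D w ->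
  {ae mu, forall x, D x -> v x = v' x} -> ip v w = ip v' w.
Proof.
move=> hv hv' hw vv'; apply: ae_eq_cint => //; try exact: ip_integrable.
by apply: ae_imp vv' => x h /h ->.
Qed.

End VectorFields.

(** * Seminorms and their quotients *)

Section Seminorms.
Variable R : realType.
Local Notation C := R[i].
Variable V : lmodType C.
Implicit Types (X K : set V) (N Q : V -> R).

Definition linear_set X :=
  [/\ X 0, forall p q, X p -> X q -> X (p + q) & forall c p, X p -> X (c *: p)].

Definition seminorm_on X N :=
  [/\ forall p, X p -> 0 <= N p,
      forall p q, X p -> X q -> N (p + q) <= N p + N q
    & forall c p, X p -> N (c *: p) <= Num.sqrt (sqn c) * N p].

(** Squares of seminorms. The family of inequalities indexed by [t] is
    equivalent to the triangle inequality for the square root, but unlike the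
    latter it is stable under sums. *)
Definition square_norm_on X Q :=
  [/\ forall p, X p -> 0 <= Q p,
      forall (t : R) p q, 0 < t -> X p -> X q ->
        Q (p + q) <= (1 + t) * Q p + (1 + t^-1) * Q q
    & forall c p, X p -> Q (c *: p) <= sqn c * Q p].

Lemma linear_setN X p : linear_set X -> X p -> X (- p).
Proof. by case=> _ _ XZ Xp; rewrite -scaleN1r; exact: XZ. Qed.

Lemma linear_setB X p q : linear_set X -> X p -> X q -> X (p - q).
Proof. by move=> sX Xp Xq; have [_ XD _] := sX; apply: XD => //; exact: linear_setN. Qed.

Lemma linear_set_sum X (I : finType) (F : I -> V) : linear_set X ->
  (forall i, X (F i)) -> X (\sum_i F i).
Proof. by case=> X0 XD _ XF; apply: (big_ind X). Qed.

Lemma seminorm0 X N : linear_set X -> seminorm_on X N -> N 0 = 0.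
Proof.
move=> [X0 _ _] [N0 _ NZ]; apply/eqP; rewrite eq_le N0// andbT.
by have := NZ 0 _ X0; rewrite scale0r sqn0 sqrtr0 mul0r.
Qed.

Lemma seminormN X N p : linear_set X -> seminorm_on X N -> X p -> N (- p) = N p.
Proof.
move=> sX [N0 _ NZ] Xp.
have le q : X q -> N (- q) <= N q.
  move=> Xq; rewrite -scaleN1r (le_trans (NZ _ _ Xq))// /sqn/= oppr0 expr0n addr0.
  by rewrite sqrrN expr1n sqrtr1 mul1r.
apply/eqP; rewrite eq_le le//=; have := le (- p); rewrite opprK; apply.
exact: linear_setN.
Qed.

Lemma seminorm_dist X N p q : linear_set X -> seminorm_on X N -> X p -> X q ->
  `|N p - N q| <= N (p - q).
Proof.
move=> sX sN Xp Xq; have [_ ND _] := sN.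
have Xpq := linear_setB sX Xp Xq.
have h1 := ND _ _ Xpq Xq; rewrite subrK in h1.
have h2 := ND _ _ (linear_setN sX Xpq) Xp.
rewrite (seminormN sX sN Xpq) opprB subrK in h2.
by rewrite ler_norml; apply/andP; split; lra.
Qed.

(** Optimising Young's inequality over its parameter gives back the product. *)
Lemma le_opt (x a b : R) : 0 <= a -> 0 <= b ->
  (forall t, 0 < t -> x <= t * a ^+ 2 + t^-1 * b ^+ 2) -> x <= 2 * (a * b).
Proof.
move=> a0 b0 h; apply/ler_addgt0Pr => e e0.
(* The optimal weight b / a may be undefined; shifting both numbers by [d] costs
   at most d (a + b), which is at most [e]. *)
pose d := e / (a + b + 1).
have ab0 : 0 < a + b + 1 by lra.
have d0 : 0 < d by rewrite divr_gt0.
have ad : 0 < a + d by lra.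
have bd : 0 < b + d by lra.
have young (u w : R) : 0 <= u -> 0 <= w -> w / (u + d) * u ^+ 2 <= w * u.
  move=> u0 w0; have ud : 0 < u + d by lra.
  by rewrite mulrAC ler_pdivrMr// expr2 -mulrA ler_wpM2l// ler_wpM2l//; lra.
have := h ((b + d) / (a + d)) (divr_gt0 bd ad); rewrite invf_div => le_x.
have h1 := young a (b + d) a0 (ltW bd); have h2 := young b (a + d) b0 (ltW ad).
apply: (le_trans le_x); apply: (le_trans (lerD h1 h2)).
have de : d * (a + b) <= e.
  by rewrite /d mulrAC ler_pdivrMr// ler_wpM2l//; lra.
nra.
Qed.

Lemma square_norm_seminorm X Q :
  linear_set X -> square_norm_on X Q -> seminorm_on X (fun p => Num.sqrt (Q p)).
Proof.
move=> sX [Q0 QD QZ]; split.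
- by move=> p _; exact: sqrtr_ge0.
- move=> p q Xp Xq; have [_ XD _] := sX.
  rewrite -[leRHS]ger0_norm ?addr_ge0 ?sqrtr_ge0// -sqrtr_sqr ler_wsqrtr//.
  have h : Q (p + q) - Q p - Q q <= 2 * (Num.sqrt (Q p) * Num.sqrt (Q q)).
    apply: le_opt; rewrite ?sqrtr_ge0// => t t0; rewrite !sqr_sqrtr ?Q0//.
    by have := QD t _ _ t0 Xp Xq; lra.
  rewrite sqrrD !sqr_sqrtr ?Q0// -mulr_natl; lra.
- move=> c p Xp; rewrite -sqrtrM ?sqn_ge0// ler_wsqrtr//; exact: QZ.
Qed.

Lemma square_normD X Q1 Q2 : square_norm_on X Q1 -> square_norm_on X Q2 ->
  square_norm_on X (fun p => Q1 p + Q2 p).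
Proof.
move=> [A0 AD AZ] [B0 BD BZ]; split.
- by move=> p Xp; rewrite addr_ge0 ?A0 ?B0.
- move=> t p q t0 Xp Xq; have := AD t _ _ t0 Xp Xq; have := BD t _ _ t0 Xp Xq; lra.
- by move=> c p Xp; rewrite mulrDr lerD ?AZ ?BZ.
Qed.

Definition quotient_norm K N p := inf [set N (p - q) | q in K].

Section Quotient.
Variables (X K : set V) (N : V -> R).
Hypotheses (sX : linear_set X) (sK : linear_set K) (KX : K `<=` X).
Hypothesis sN : seminorm_on X N.

Lemma quotient_norm_le p q : X p -> K q -> quotient_norm K N p <= N (p - q).
Proof.
move=> Xp Kq; apply: ge_inf; last by exists q.
by exists 0 => _ [r /KX Kr <-]; case: sN => N0 _ _; apply: N0; exact: linear_setB.
Qed.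

Lemma le_quotient_norm p r : (forall q, K q -> r <= N (p - q)) ->
  r <= quotient_norm K N p.
Proof.
move=> h; apply: lb_le_inf => [|_ [q Kq <-]]; last exact: h.
by exists (N (p - 0)); exists 0 => //; case: sK.
Qed.

(** The triangle inequality comes from adding competitors for the two infima, and
    homogeneity from scaling a competitor; a factor [0] is treated apart because it
    cannot be divided out. *)
Lemma quotient_norm_seminorm : seminorm_on X (quotient_norm K N).
Proof.
have [N0 ND NZ] := sN; have [K0 KD KZ] := sK; split.
- by move=> p Xp; apply: le_quotient_norm => q /KX Kq; apply: N0; exact: linear_setB.
- move=> p q Xp Xq; have [_ XD _] := sX.
  rewrite -lerBlDr; apply: le_quotient_norm => r Kr.
  rewrite lerBlDr [leRHS]addrC -lerBlDr; apply: le_quotient_norm => s Ks.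
  rewrite lerBlDr; apply: (le_trans (quotient_norm_le (XD _ _ Xp Xq) (KD _ _ Kr Ks))).
  rewrite [leRHS]addrC opprD addrACA; apply: ND; apply: linear_setB => //; exact: KX.
- move=> c p Xp.
  have [c0|c0] := eqVneq (Num.sqrt (sqn c)) 0.
    rewrite c0 mul0r; have [_ _ XZ] := sX.
    rewrite (le_trans (quotient_norm_le (XZ c p Xp) K0))// subr0.
    by rewrite (le_trans (NZ _ _ Xp))// c0 mul0r.
  have {}c0 : 0 < Num.sqrt (sqn c) by rewrite lt0r c0 sqrtr_ge0.
  rewrite mulrC -ler_pdivrMr//; apply: le_quotient_norm => q Kq.
  have [_ _ XZ] := sX.
  rewrite ler_pdivrMr// mulrC (le_trans (quotient_norm_le (XZ c p Xp) (KZ c q Kq)))//.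
  by rewrite -scalerBr NZ//; apply: linear_setB => //; exact: KX.
Qed.

End Quotient.
End Seminorms.

Import HBSimple.

(** * Simple functions and Bochner spaces *)

Section SimpleFunctions.
Variable R : realType.

Definition simple3 (T : Type) (s : pt3 R -> T) :=
  finite_set (range s) /\ forall a, measurable3 (s @^-1` [set a]).

Lemma simple3_preimage (T : Type) (s : pt3 R -> T) (B : set T) :
  simple3 s -> measurable3 (s @^-1` B).
Proof.
move=> [fs ms].
rewrite (_ : s @^-1` B = \bigcup_(a in range s `&` B) (s @^-1` [set a])).
  apply: (@fin_bigcup_measurable _ (mpt3 R)) => [|a _]; last exact: ms.
  exact: finite_setIl.
by apply/seteqP; split=> [x Bx|x [a [_ Ba] /= ->]//]; exists (s x).
Qed.

Lemma simple3_comp (T T' : Type) (f : T -> T') (s : pt3 R -> T) :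
  simple3 s -> simple3 (f \o s).
Proof.
move=> ss; split=> [|a]; last exact: (simple3_preimage (f @^-1` [set a]) ss).
by rewrite -(image_comp s f); apply: finite_image; case: ss.
Qed.

Lemma simple3_pair (T T' : Type) (s : pt3 R -> T) (s' : pt3 R -> T') :
  simple3 s -> simple3 s' -> simple3 (fun x => (s x, s' x)).
Proof.
move=> [fs ms] [fs' ms']; split=> [|[a a']].
  apply: sub_finite_set (finite_setX fs fs').
  by move=> _ [x _ <-]; split; exists x.
rewrite (_ : _ @^-1` _ = (s @^-1` [set a]) `&` (s' @^-1` [set a'])).
  by apply: (@measurableI _ (mpt3 R)); [exact: ms|exact: ms'].
by apply/seteqP; split=> [x /= [-> ->]//|x /= [-> ->]].
Qed.

Lemma simple3_cst (T : Type) (a : T) : simple3 (fun=> a).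
Proof.
split=> [|b]; first by apply: sub_finite_set (finite_set1 a) => _ [x _ <-].
have [->|ab] := pselect (a = b).
  by rewrite (_ : _ @^-1` _ = setT); [exact: measurableT|apply/seteqP; split].
by rewrite (_ : _ @^-1` _ = set0); [exact: measurable0|apply/seteqP; split].
Qed.

Lemma simple3_measurable (s : pt3 R -> R) (D : set (pt3 R)) :
  simple3 s -> @measurable_fun _ _ (mpt3 R) R D s.
Proof.
move=> ss mD B mB; apply: (@measurableI _ (mpt3 R)) => //.
exact: simple3_preimage.
Qed.

(** Simple approximation of the real and imaginary parts; the distance is written in
    the form in which homogeneity of a seminorm produces it. *)
Lemma cmeasurable_approx (D : set (pt3 R)) (c : sfield R) : measurable3 D ->
  cmeasurable D c -> exists s : nat -> sfield R, (forall m, simple3 (s m)) /\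
    forall x, D x -> (Num.sqrt (sqn (s m x - c x)) : R) @[m --> \oo] --> (0 : R).
Proof.
have approx (f : pt3 R -> R) : measurable3 D -> @measurable_fun _ _ (mpt3 R) R D f ->
    exists s : nat -> pt3 R -> R, (forall m, simple3 (s m)) /\
      forall x, D x -> s m x @[m --> \oo] --> f x.
  move=> mD /measurable_EFinP mf.
  have [g gf] := approximation_sfun mD mf.
  exists (fun m => HBSimple.SimpleFun.sort (g m)); split=> [m|x Dx]; last by have /fine_cvgP[] := gf x Dx.
  by split=> [|a]; [exact: (@fimfunP _ _ (g m))|
    exact: (@measurable_sfunP _ _ (mpt3 R) _ (g m))].
move=> mD [m1 m2]; have [s1 [ss1 c1]] := approx _ mD m1.
have [s2 [ss2 c2]] := approx _ mD m2.
exists (fun m x => Complex (s1 m x) (s2 m x)); split=> [m|x Dx].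
  exact: (simple3_comp (fun z => Complex z.1 z.2) (simple3_pair (ss1 m) (ss2 m))).
have d1 : (s1 m x - complex.Re (c x)) @[m --> \oo] --> (0 : R).
  by rewrite -(subrr (complex.Re (c x))); apply: cvgB (c1 x Dx) (cvg_cst _).
have d2 : (s2 m x - complex.Im (c x)) @[m --> \oo] --> (0 : R).
  by rewrite -(subrr (complex.Im (c x))); apply: cvgB (c2 x Dx) (cvg_cst _).
have h : ((s1 m x - complex.Re (c x)) ^+ 2 + (s2 m x - complex.Im (c x)) ^+ 2)
    @[m --> \oo] --> (0 : R).
  have -> : 0 = 0 * 0 + 0 * 0 :> R by ring.
  exact: (cvgD (cvgM d1 d1) (cvgM d2 d2)).
rewrite -sqrtr0; apply: continuous_cvg; first exact: sqrt_continuous.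
suff -> : (fun m => sqn (Complex (s1 m x) (s2 m x) - c x)) = (fun m =>
  (s1 m x - complex.Re (c x)) ^+ 2 + (s2 m x - complex.Im (c x)) ^+ 2) by [].
by apply/funext => m; case: (c x).
Qed.

End SimpleFunctions.

Section Bochner.
Variable R : realType.
Local Notation C := R[i].
Local Notation leb := (@leb3 R).
Variable D : set (pt3 R).
Hypothesis mD : measurable3 D.

(** The measurability clause of [bochner_L2], separated from the integrability clause:
    limits of simple maps give the former, domination gives the latter. *)
Definition strongly_measurable (V : lmodType C) (X : set V) (N : V -> R)
    (U : pt3 R -> V) :=
  exists s : nat -> pt3 R -> V,
    [/\ forall m x, X (s m x), forall m, simple3 (s m)
      & forall x, D x -> N (s m x - U x) @[m --> \oo] --> (0 : R)].

Section OneSpace.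
Variables (V : lmodType C) (X : set V) (N : V -> R).
Hypotheses (sX : linear_set X) (sN : seminorm_on X N).
Implicit Types U W : pt3 R -> V.

Lemma cvg_seminorm (s : nat -> V) u : X u -> (forall m, X (s m)) ->
  N (s m - u) @[m --> \oo] --> (0 : R) -> N (s m) @[m --> \oo] --> N u.
Proof.
move=> Xu Xs cs.
apply/cvgrPdist_le => e e0; move/cvgrPdist_le: cs => /(_ e e0).
apply: filterS => m; rewrite sub0r normrN => h.
rewrite distrC (le_trans (seminorm_dist sX sN (Xs m) Xu))//.
by rewrite (le_trans _ h)// ler_norm.
Qed.

(** Every function of a simple map is measurable, and a seminorm is continuous for the
    convergence that it defines. Additivity of the integral of its square needs this. *)
Lemma strongly_measurable_norm U : (forall x, D x -> X (U x)) ->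
  strongly_measurable X N U -> @measurable_fun _ _ (mpt3 R) R D (fun x => N (U x)).
Proof.
move=> XU [s [Xs ss cs]].
apply: (@measurable_fun_cvg _ (mpt3 R) _ _ (fun m x => N (s m x))).
  by move=> m; apply: (simple3_measurable (s := fun x => N (s m x))); exact: (simple3_comp N (ss m)).
by move=> x Dx; apply: cvg_seminorm (cs x Dx) => //; exact: XU.
Qed.

Lemma bochner_intro U (h : pt3 R -> R) : (forall x, D x -> X (U x)) ->
  strongly_measurable X N U -> leb.-integrable D (EFin \o h) ->
  (forall x, D x -> N (U x) ^+ 2 <= h x) -> bochner_L2 D X N U.
Proof.
move=> XU sU ih Uh; split => //.
  have [s [Xs ss cs]] := sU; exists s; split=> //; first by move=> m; case: (ss m).
  by move=> m; case: (ss m).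
apply: le_lt_trans (integrable_lty mD (integrable_abse ih)).
apply: ge0_le_integral => //.
- by move=> x _; rewrite lee_fin sqr_ge0.
- apply/measurable_EFinP/measurable_funX; exact: strongly_measurable_norm.
- by apply: measurableT_comp => //; exact: measurable_int ih.
- by move=> x Dx; rewrite lee_fin (le_trans (Uh x Dx))// ler_norm.
Qed.

Lemma bochner_elim U : bochner_L2 D X N U ->
  [/\ forall x, D x -> X (U x), strongly_measurable X N U
    & leb.-integrable D (EFin \o (fun x => N (U x) ^+ 2))].
Proof.
move=> [XU [s [Xs fs ms cs]] IU].
have sU : strongly_measurable X N U.
  by exists s; split => // m; split.
split => //; apply/integrableP; split.
  by apply/measurable_EFinP/measurable_funX; exact: strongly_measurable_norm.
apply: le_lt_trans IU; rewrite le_eqVlt; apply/orP; left; apply/eqP.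
by apply: eq_integral => x _ /=; rewrite ger0_norm// sqr_ge0.
Qed.

Lemma bochner0 : bochner_L2 D X N (fun=> 0).
Proof.
have [X0 _ _] := sX; apply: (@bochner_intro _ (fun=> 0)) => //.
- exists (fun _ _ => 0); split => //; first by move=> _; exact: simple3_cst.
  by move=> x _; rewrite subrr (seminorm0 sX sN); exact: cvg_cst.
- exact: integrable0.
- by move=> x _; rewrite (seminorm0 sX sN) expr0n.
Qed.

Lemma bochnerD U W : bochner_L2 D X N U -> bochner_L2 D X N W ->
  bochner_L2 D X N (fun x => U x + W x).
Proof.
move=> /bochner_elim[XU [s [Xs ss cs]] IU] /bochner_elim[XW [r [Xr sr cr]] IW].
have [X0 XD _] := sX; have [N0 ND _] := sN.
have I2 := integrableD mD (integrableZl mD 2 IU) (integrableZl mD 2 IW).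
apply: (@bochner_intro _ (fun x => 2 * N (U x) ^+ 2 + 2 * N (W x) ^+ 2)) => //.
- by move=> x Dx; apply: XD; [exact: XU|exact: XW].
- exists (fun m x => s m x + r m x); split.
  + by move=> m x; exact: XD.
  + move=> m; exact: (simple3_comp (fun p => p.1 + p.2) (simple3_pair (ss m) (sr m))).
  + move=> x Dx.
    have lim0 : N (s m x - U x) + N (r m x - W x) @[m --> \oo] --> (0 : R).
      by rewrite -[0]addr0; exact: cvgD (cs x Dx) (cr x Dx).
    apply: squeeze_cvgr (cvg_cst 0) lim0.
    near=> m; have Xd := linear_setB sX (Xs m x) (XU x Dx).
    have Xd' := linear_setB sX (Xr m x) (XW x Dx).
    by rewrite opprD addrACA N0 ?ND//; exact: XD.
- move=> x Dx; have h := ND _ _ (XU x Dx) (XW x Dx).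
  have h0 := N0 _ (XD _ _ (XU x Dx) (XW x Dx)).
  apply: (@le_trans _ _ ((N (U x) + N (W x)) ^+ 2)).
    by rewrite ler_sqr ?nnegrE// (le_trans h0).
  by have := sqr_ge0 (N (U x) - N (W x)); rewrite sqrrB sqrrD; lra.
Unshelve. all: by end_near. Qed.

Lemma bochner_scale (c : sfield R) w : sL2 leb D c -> X w ->
  bochner_L2 D X N (fun x => c x *: w).
Proof.
move=> c2 Xw; have [X0 XD XZ] := sX; have [N0 ND NZ] := sN.
have [_ ic] := (sL2P _ _ _).1 c2.
apply: (@bochner_intro _ (fun x => N w ^+ 2 * sqn (c x))) => //.
- by move=> x _; exact: XZ.
- have [s [ss cs]] := cmeasurable_approx mD c2.1.
  exists (fun m x => s m x *: w); split.
  + by move=> m x; exact: XZ.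
  + by move=> m; exact: (simple3_comp (fun z => z *: w) (ss m)).
  + move=> x Dx.
    have lim0 : Num.sqrt (sqn (s m x - c x)) * N w @[m --> \oo] --> (0 : R).
      by rewrite -(mul0r (N w)); apply: cvgMr_tmp; exact: cs.
    apply: squeeze_cvgr (cvg_cst 0) lim0.
    by near=> m; rewrite -scalerBl N0 ?NZ//; exact: XZ.
- exact: (integrableZl mD _ ic).
- move=> x _; rewrite mulrC -(sqr_sqrtr (sqn_ge0 (c x))) -exprMn.
  by rewrite ler_sqr ?nnegrE ?NZ ?N0 ?mulr_ge0 ?sqrtr_ge0 ?N0//; exact: XZ.
Unshelve. all: by end_near. Qed.

Lemma bochner_sum (n : nat) (F : 'I_n -> pt3 R -> V) :
  (forall i, bochner_L2 D X N (F i)) ->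
  bochner_L2 D X N (fun x => \sum_i F i x).
Proof.
move=> hF; have -> : (fun x => \sum_i F i x) = \sum_i F i.
  by apply/funext => x; rewrite fct_sumE.
by apply: (big_ind (bochner_L2 D X N)) => //; [exact: bochner0|exact: bochnerD].
Qed.

(** Biadditivity and boundedness make the form continuous, so that it is measurable as a
    limit of simple functions; the product of the seminorms dominates it. *)
Lemma bochner_form (b : V -> V -> R) (M : R) U W :
  (forall p q r, X p -> X q -> X r -> b (p - q) r = b p r - b q r) ->
  (forall p q r, X p -> X q -> X r -> b r (p - q) = b r p - b r q) ->
  (forall p q, X p -> X q -> `|b p q| <= M * (N p * N q)) ->
  bochner_L2 D X N U -> bochner_L2 D X N W ->
  leb.-integrable D (EFin \o (fun x => b (U x) (W x))).
Proof.
move=> bl br bM.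
move=> /bochner_elim[XU [s [Xs ss cs]] IU] /bochner_elim[XW [r [Xr sr cr]] IW].
have [N0 _ _] := sN.
have mb : @measurable_fun _ _ (mpt3 R) R D (fun x => b (U x) (W x)).
  apply: (@measurable_fun_cvg _ (mpt3 R) _ _ (fun m x => b (s m x) (r m x))).
    move=> m; apply: (simple3_measurable (s := fun x => b (s m x) (r m x))).
    exact: (simple3_comp (fun p => b p.1 p.2) (simple3_pair (ss m) (sr m))).
  move=> x Dx; have XUx := XU x Dx; have XWx := XW x Dx.
  have lim0 : M * (N (s m x - U x) * N (r m x)) + M * (N (U x) * N (r m x - W x))
      @[m --> \oo] --> (0 : R).
    have -> : 0 = M * (0 * N (W x)) + M * (N (U x) * 0) by ring.
    apply: cvgD; apply: cvgMl_tmp.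
      by apply: cvgM (cs x Dx) _; exact: cvg_seminorm (cr x Dx).
    by apply: cvgMl_tmp; exact: cr.
  apply/subr_cvg0; apply: norm_cvg0; apply: squeeze_cvgr (cvg_cst 0) lim0.
  near=> m; rewrite normr_ge0/=.
  have Xd := linear_setB sX (Xs m x) XUx; have Xd' := linear_setB sX (Xr m x) XWx.
  have -> : b (s m x) (r m x) - b (U x) (W x) =
      b (s m x - U x) (r m x) + b (U x) (r m x - W x).
    by rewrite bl// br//; ring.
  by rewrite (le_trans (ler_normD _ _))// lerD// bM.
have I2 := integrableZl mD `|M| (integrableD mD IU IW).
apply: (le_integrable mD _ _ I2); first exact/measurable_EFinP.
move=> x Dx /=; rewrite lee_fin.
have h := bM _ _ (XU x Dx) (XW x Dx).
have h0 := N0 _ (XU x Dx); have h0' := N0 _ (XW x Dx).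
apply: (le_trans h); apply: (le_trans (ler_norm _)); rewrite normrM [leRHS]normrM.
rewrite normr_id ler_wpM2l// !ger0_norm ?addr_ge0 ?sqr_ge0 ?mulr_ge0//.
by have := sqr_ge0 (N (U x) - N (W x)); have := mulr_ge0 h0 h0'; rewrite sqrrB; lra.
Unshelve. all: by end_near. Qed.

End OneSpace.

Lemma bochner_map (V V' : lmodType C) (X : set V) (X' : set V') (N : V -> R)
    (N' : V' -> R) (L : V -> V') (M : R) (U : pt3 R -> V) :
  linear_set X -> seminorm_on X N -> linear_set X' -> seminorm_on X' N' ->
  (forall p q, L (p - q) = L p - L q) -> (forall p, X p -> X' (L p)) ->
  (forall p, X p -> N' (L p) <= M * N p) ->
  bochner_L2 D X N U -> bochner_L2 D X' N' (fun x => L (U x)).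
Proof.
move=> sX sN sX' sN' LB LX LM /(bochner_elim sX sN)[XU [s [Xs ss cs]] IU].
have [N0 _ _] := sN; have [N0' _ _] := sN'.
apply: (bochner_intro sX' sN' (h := fun x => M ^+ 2 * N (U x) ^+ 2)).
- by move=> x Dx; apply: LX; exact: XU.
- exists (fun m x => L (s m x)); split.
  + by move=> m x; exact: LX.
  + by move=> m; exact: (simple3_comp L (ss m)).
  + move=> x Dx.
    have lim0 : M * N (s m x - U x) @[m --> \oo] --> (0 : R).
      by rewrite -(mulr0 M); apply: cvgMl_tmp; exact: cs.
    apply: squeeze_cvgr (cvg_cst 0) lim0.
    near=> m; have Xd := linear_setB sX (Xs m x) (XU x Dx).
    by rewrite -LB LM// N0'//; exact: LX.
- exact: (integrableZl mD _ IU).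
- move=> x Dx; have h := LM _ (XU x Dx).
  rewrite -exprMn ler_sqr ?nnegrE ?N0'//; first exact/LX/XU.
  by rewrite (le_trans _ h)// N0'//; exact/LX/XU.
Unshelve. all: by end_near. Qed.

End Bochner.

(** * Pairings of Bochner functions with values in L2 *)

Section L2Space.
Variable R : realType.
Local Notation C := R[i].
Local Notation leb := (@leb3 R).

Section Fixed.
Variables (mu : {measure set (mpt3 R) -> \bar R}) (S : set (pt3 R)).
Hypothesis mS : measurable3 S.
Implicit Types v w : vfield R.

Definition L2norm v : R := Num.sqrt (vnorm2 mu S v).

Lemma L2_linear : linear_set (L2 mu S).
Proof. by split; [exact: L2_0|exact: L2D|exact: L2Z]. Qed.

Lemma vnorm2_square_norm : square_norm_on (L2 mu S) (vnorm2 mu S).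
Proof.
split=> [v _|t v w t0 hv hw|c v hv]; first exact: vnorm2_ge0.
  exact: vnorm2D.
by rewrite vnorm2Z.
Qed.

Lemma L2_seminorm : seminorm_on (L2 mu S) L2norm.
Proof. exact: square_norm_seminorm L2_linear vnorm2_square_norm. Qed.

Lemma ipBl v v' w : L2 mu S v -> L2 mu S v' -> L2 mu S w ->
  ip mu S (v - v') w = ip mu S v w - ip mu S v' w.
Proof.
move=> hv hv' hw; rewrite -scaleN1r ipDl//; last exact: L2Z.
by rewrite ipZl// mulN1r.
Qed.

Lemma ipBr v w w' : L2 mu S v -> L2 mu S w -> L2 mu S w' ->
  ip mu S v (w - w') = ip mu S v w - ip mu S v w'.
Proof.
move=> hv hw hw'; rewrite -scaleN1r ipDr//; last exact: L2Z.
by rewrite ipZr// rmorphN rmorph1 mulN1r.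
Qed.

Lemma cauchy_schwarz v w : L2 mu S v -> L2 mu S w ->
  `|complex.Re (ip mu S v w)| <= 2 * (L2norm v * L2norm w) /\
  `|complex.Im (ip mu S v w)| <= 2 * (L2norm v * L2norm w).
Proof.
move=> hv hw; split; apply: le_opt; rewrite ?sqrtr_ge0// => t t0;
  rewrite !sqr_sqrtr ?vnorm2_ge0//; by have [] := ip_le mS t0 hv hw.
Qed.

End Fixed.

(** This allows the outer integral of a sum of inner products to be split. *)
Lemma bochner_ip (D S : set (pt3 R)) (U W : pt3 R -> vfield R) :
  measurable3 D -> measurable3 S ->
  bochner_L2 D (L2 leb S) (L2norm leb S) U ->
  bochner_L2 D (L2 leb S) (L2norm leb S) W ->
  cintegrable leb D (fun x => ip leb S (U x) (W x)).
Proof.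
move=> mD mS bU bW; split.
- apply: (bochner_form mD (L2_linear leb mS) (L2_seminorm leb mS)
    (b := fun v w => complex.Re (ip leb S v w)) (M := 2)) bU bW.
  + by move=> p q r *; rewrite ipBl// cReD; case: (ip leb S q r).
  + by move=> p q r *; rewrite ipBr// cReD; case: (ip leb S r q).
  + by move=> p q hp hq; have [] := cauchy_schwarz mS hp hq.
- apply: (bochner_form mD (L2_linear leb mS) (L2_seminorm leb mS)
    (b := fun v w => complex.Im (ip leb S v w)) (M := 2)) bU bW.
  + by move=> p q r *; rewrite ipBl// cImD; case: (ip leb S q r).
  + by move=> p q r *; rewrite ipBr// cImD; case: (ip leb S r q).
  + by move=> p q hp hq; have [] := cauchy_schwarz mS hp hq.
Qed.

End L2Space.

(** * Products with test functions *)

Section TestFunctions.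
Variable R : realType.
Local Notation C := R[i].
Local Notation leb := (@leb3 R).
Implicit Types (D K : set (pt3 R)) (h eta : pt3 R -> R) (f : sfield R).

Definition continuous_supported K h :=
  (forall x, {for x, continuous h}) /\ (forall x, ~ K x -> h x = 0).

Lemma supported_sL2 D K h : measurable3 D -> compact K ->
  continuous_supported K h -> sL2 leb D (fun x => cplx (h x)).
Proof.
move=> mD cK [ch h0]; have mK := compact_measurable3 cK.
have [M [_ bM]] : [bounded h x | x in K].
  have : compact (h @` K).
    by apply: continuous_compact => //; apply: continuous_subspaceT.
  by move/compact_bounded => [M [Mr HM]]; exists M; split=> // x xM y Ky; apply: HM => //;
    exists y.
have hM x : K x -> `|h x| <= `|M| + 1.
  by apply: bM; rewrite (le_lt_trans (ler_norm _))// ltrDl.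
apply: (@sL2_le _ leb D mD _ (fun x => (`|M| + 1) ^+ 2 * \1_K x)).
- split; first exact: continuous_measurable3.
  exact: measurable_cst.
- apply: (@integrableS _ (mpt3 R) _ leb setT) => //.
  apply: (@integrableZl _ (mpt3 R) _ leb setT _ _ (EFin \o \1_K)); first exact: measurableT.
  apply/integrableP; split.
    by apply/measurable_EFinP; exact: measurable_indic.
  rewrite (_ : (\int[_]_(x in _) _)%E = leb K); first exact: compact_finite.
  have <- : (\int[leb]_(x in setT) (\1_K x)%:E = leb K)%E.
    by rewrite (@integral_indic _ (mpt3 R)) ?setIT.
  by apply: eq_integral => x _ /=; rewrite ger0_norm.
- move=> x _; rewrite sqn_cplx indicE; have [Kx|Kx] := pselect (K x).
    by rewrite mem_set// mulr1 -(real_normK (num_real (h x))) ler_sqr ?nnegrE ?hM ?addr_ge0.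
  by rewrite h0// memNset// expr0n mulr0.
Qed.

(** Off the closed support the function vanishes in a neighbourhood, hence so do its
    partial derivatives. *)
Lemma test_function_supported D eta : test_function D eta ->
  continuous_supported (closure [set x | eta x != 0]) eta /\
  forall j, continuous_supported (closure [set x | eta x != 0]) (partial j eta).
Proof.
move=> [Ceta _ _]; split=> [|j]; split=> x.
- by have [+ _] := Ceta 0%N [::]; apply.
- by move=> Kx; apply/eqP/negP => /negP e0; apply: Kx; exact: subset_closure.
- by have [+ _] := Ceta 1%N [:: j]; apply.
- move=> Kx; rewrite /partial.
  have near0 : \forall y \near x, eta y = cst 0 y.
    have : nbhs x (~` closure [set x | eta x != 0]).
      by apply: open_nbhs_nbhs; split => //; exact/closed_openC/closed_closure.
    apply: filterS => y Ky; apply/eqP/negP => /negP e0; apply: Ky.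
    exact: subset_closure.
  rewrite (near_eq_derive _ near0) ?derive_cst//.
Qed.

(** Integrability of the products occurring in the weak definitions of curl and
    gradient; it makes those definitions linear. *)
Definition testable D f := forall eta j, test_function setT eta ->
  cintegrable leb D (fun x => f x * cplx (partial j eta x)) /\
  cintegrable leb D (fun x => f x * cplx (eta x)).

Lemma sL2_testable D f : measurable3 D -> sL2 leb D f -> testable D f.
Proof.
move=> mD hf eta j teta; have [h1 h2] := test_function_supported teta.
case: teta => _ cK _.
by split; apply: sL2M => //; apply: supported_sL2 cK _.
Qed.

Lemma cintegrable_supported K f h : compact K -> continuous_supported K h ->
  sL2 leb K f -> cintegrable leb setT (fun x => f x * cplx (h x)).
Proof.
move=> cK hK hf; have mK := compact_measurable3 cK.
have [i1 i2] := sL2M mK hf (supported_sL2 mK cK hK).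
have z x : ~ K x -> f x * cplx (h x) = 0.
  by case: hK => _ z /z ->; rewrite cplx0 mulr0.
split.
- move/(integrable_mkcond _ mK): i1; apply: eq_integrable => // x _.
  by rewrite patchE /=; case: ifPn => // /negP; rewrite inE => /z ->.
- move/(integrable_mkcond _ mK): i2; apply: eq_integrable => // x _.
  by rewrite patchE /=; case: ifPn => // /negP; rewrite inE => /z ->.
Qed.

Lemma sL2loc_testable f : sL2loc f -> testable setT f.
Proof.
move=> hf eta j teta; have [h1 h2] := test_function_supported teta.
case: teta => _ cK _.
split; [exact: cintegrable_supported cK (h2 j) (hf _ cK)|
  exact: cintegrable_supported cK h1 (hf _ cK)].
Qed.

Definition vtestable D (v : vfield R) := forall j, testable D (fun x => v x j 0).

Lemma vtestable_dot D v (eta : 'I_3 -> pt3 R -> R) : measurable3 D -> vtestable D v -> vtest setT eta ->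
  cintegrable leb D (fun x => dot (v x) (tcurl eta x)) /\
  cintegrable leb D (fun x => dot (v x) (tvec eta x)).
Proof.
move=> mD hv he; split; apply: cintegrable_sum => // j.
  apply: eq_cintegrable (cintegrableB mD (hv j _ (j + 1) (he (j + 2))).1
    (hv j _ (j + 2) (he (j + 1))).1) => // x _.
  by rewrite mxE -mulrBr; congr (_ * _); apply: complexP; rewrite ?cReD ?cImD/= ?subr0.
by apply: eq_cintegrable (hv j _ j (he j)).2 => // x _; rewrite mxE.
Qed.

End TestFunctions.

(** * Linearity of the function spaces *)

Section FunctionSpaces.
Variable R : realType.
Local Notation C := R[i].
Local Notation leb := (@leb3 R).
Implicit Types (D S : set (pt3 R)).

Lemma test_functionT D (eta : pt3 R -> R) :
  test_function D eta -> test_function setT eta.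
Proof. by case. Qed.

Lemma vtestT D (eta : 'I_3 -> pt3 R -> R) : vtest D eta -> vtest setT eta.
Proof. by move=> h j; exact: test_functionT (h j). Qed.

Lemma fldD (p q : gcurl R) x : fld (p + q) x = fld p x + fld q x. Proof. by []. Qed.
Lemma curlD (p q : gcurl R) x : curl (p + q) x = curl p x + curl q x. Proof. by []. Qed.
Lemma fldZ c (p : gcurl R) x : fld (c *: p) x = c *: fld p x. Proof. by []. Qed.
Lemma curlZ c (p : gcurl R) x : curl (c *: p) x = c *: curl p x. Proof. by []. Qed.
Lemma fld0 x : fld (0 : gcurl R) x = 0. Proof. by []. Qed.
Lemma curl0 x : curl (0 : gcurl R) x = 0. Proof. by []. Qed.
Lemma gradD (p q : ggrad R) x : gradient (p + q) x = gradient p x + gradient q x.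
Proof. by []. Qed.
Lemma gradZ c (p : ggrad R) x : gradient (c *: p) x = c *: gradient p x.
Proof. by []. Qed.
Lemma grad0 x : gradient (0 : ggrad R) x = 0. Proof. by []. Qed.

Section WeakDerivatives.
Variable D : set (pt3 R).
Hypothesis mD : measurable3 D.
Implicit Types (p q : gcurl R) (r s : ggrad R) (c : C).

Definition curl_testable p := vtestable D (fld p) /\ vtestable D (curl p).

Definition grad_testable r := testable D (sfld r) /\ vtestable D (gradient r).

Lemma weak_curl0 : weak_curl D (0 : gcurl R).
Proof.
move=> eta _; transitivity (cint leb D (fun=> 0)).
  by apply: eq_cint => x _; rewrite fld0 dot0l.
by apply: eq_cint => x _; rewrite curl0 dot0l.
Qed.

Lemma weak_curlD p q : curl_testable p -> curl_testable q ->
  weak_curl D p -> weak_curl D q -> weak_curl D (p + q).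
Proof.
move=> [fp cp] [fq cq] wp wq eta he; have heT := vtestT he.
transitivity (cint leb D (fun x => dot (fld p x) (tcurl eta x)) +
              cint leb D (fun x => dot (fld q x) (tcurl eta x))).
  rewrite -cintD//; [|exact: (vtestable_dot mD fp heT).1|exact: (vtestable_dot mD fq heT).1].
  by apply: eq_cint => x _; rewrite fldD dotDl.
rewrite wp// wq// -cintD//;
  [|exact: (vtestable_dot mD cp heT).2|exact: (vtestable_dot mD cq heT).2].
by apply: eq_cint => x _; rewrite curlD dotDl.
Qed.

Lemma weak_curlZ c p : curl_testable p -> weak_curl D p -> weak_curl D (c *: p).
Proof.
move=> [fp cp] wp eta he; have heT := vtestT he.
transitivity (c * cint leb D (fun x => dot (fld p x) (tcurl eta x))).
  rewrite -cintZ//; last exact: (vtestable_dot mD fp heT).1.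
  by apply: eq_cint => x _; rewrite fldZ dotZl.
rewrite wp// -cintZ//; last exact: (vtestable_dot mD cp heT).2.
by apply: eq_cint => x _; rewrite curlZ dotZl.
Qed.

Lemma weak_grad0 : weak_grad D (0 : ggrad R).
Proof.
move=> eta j _; transitivity (cint leb D (fun=> 0)).
  by apply: eq_cint => x _; rewrite mul0r.
rewrite cint0; apply/esym/eqP; rewrite oppr_eq0 -(cint0 leb D); apply/eqP.
by apply: eq_cint => x _; rewrite grad0 mxE mul0r.
Qed.

Lemma weak_gradD r s : grad_testable r -> grad_testable s ->
  weak_grad D r -> weak_grad D s -> weak_grad D (r + s).
Proof.
move=> [fr gr] [fs gs] wr ws eta j he; have heT := test_functionT he.
transitivity (cint leb D (fun x => sfld r x * cplx (partial j eta x)) +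
              cint leb D (fun x => sfld s x * cplx (partial j eta x))).
  rewrite -cintD//; [|exact: (fr _ j heT).1|exact: (fs _ j heT).1].
  by apply: eq_cint => x _; rewrite -mulrDl.
rewrite wr// ws// -opprD -cintD//; [|exact: (gr j _ j heT).2|exact: (gs j _ j heT).2].
by congr (- _); apply: eq_cint => x _; rewrite gradD mxE mulrDl.
Qed.

Lemma weak_gradZ c r : grad_testable r -> weak_grad D r -> weak_grad D (c *: r).
Proof.
move=> [fr gr] wr eta j he; have heT := test_functionT he.
transitivity (c * cint leb D (fun x => sfld r x * cplx (partial j eta x))).
  rewrite -cintZ//; last exact: (fr _ j heT).1.
  by apply: eq_cint => x _; rewrite mulrA.
rewrite wr// mulrN -cintZ//; last exact: (gr j _ j heT).2.
by congr (- _); apply: eq_cint => x _; rewrite gradZ mxE mulrA.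
Qed.

Lemma L2_vtestable (v : vfield R) : L2 leb D v -> vtestable D v.
Proof. by move=> hv j; exact: sL2_testable. Qed.

Lemma Hcurl_linear : linear_set (@Hcurl R D).
Proof.
have ht p : Hcurl D p -> curl_testable p by case=> h h' _; split; exact: L2_vtestable.
split.
- by split; [exact: L2_0|exact: L2_0|exact: weak_curl0].
- move=> p q hp hq; have [p1 p2 p3] := hp; have [q1 q2 q3] := hq.
  split; [exact: (L2D mD p1 q1)|exact: (L2D mD p2 q2)|].
  by apply: weak_curlD => //; exact: ht.
- move=> c p hp; have [p1 p2 p3] := hp.
  split; [exact: (L2Z mD c p1)|exact: (L2Z mD c p2)|].
  by apply: weak_curlZ => //; exact: ht.
Qed.

Lemma trace_pairing_integrable p eta : L2 leb D (fld p) -> L2 leb D (curl p) ->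
  vtest setT eta ->
  cintegrable leb D (fun x => dot (curl p x) (tvec eta x) - dot (fld p x) (tcurl eta x)).
Proof.
move=> hf hc he; apply: cintegrableB => //.
  exact: (vtestable_dot mD (L2_vtestable hc) he).2.
exact: (vtestable_dot mD (L2_vtestable hf) he).1.
Qed.

Lemma H0curl_linear : linear_set (@H0curl R D).
Proof.
have [h0 hD hZ] := Hcurl_linear; split.
- split => // eta he; rewrite /trace_pairing (_ : (fun x => _) = (fun=> 0)) ?cint0//.
  by apply/funext => x; rewrite fld0 curl0 !dot0l subr0.
- move=> p q [hp tp] [hq tq]; split; first exact: hD.
  move=> eta he; transitivity (trace_pairing D p eta + trace_pairing D q eta).
    have [p1 p2 _] := hp; have [q1 q2 _] := hq.
    rewrite /trace_pairing -cintD//; try exact: trace_pairing_integrable.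
    by apply: eq_cint => x _; rewrite fldD curlD !dotDl opprD addrACA.
  by rewrite tp// tq// addr0.
- move=> c p [hp tp]; split; first exact: hZ.
  move=> eta he; transitivity (c * trace_pairing D p eta).
    have [p1 p2 _] := hp.
    rewrite /trace_pairing -cintZ//; last exact: trace_pairing_integrable.
    by apply: eq_cint => x _; rewrite fldZ curlZ !dotZl mulrBr.
  by rewrite tp// mulr0.
Qed.

End WeakDerivatives.

Lemma sL2loc_linear (f g : sfield R) (c : C) : sL2loc f -> sL2loc g ->
  sL2loc (fun x => f x + g x) /\ sL2loc (fun x => c * f x).
Proof.
move=> hf hg; split=> K cK; have mK := compact_measurable3 cK.
  by apply: sL2D => //; [exact: hf|exact: hg].
by apply: sL2Z => //; exact: hf.
Qed.

Lemma L2loc_0 : L2loc (0 : vfield R).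
Proof. by move=> K cK; apply: L2_0; exact: compact_measurable3. Qed.

Lemma L2locD (v w : vfield R) : L2loc v -> L2loc w -> L2loc (v + w).
Proof.
move=> hv hw K cK; apply: L2D; [exact: compact_measurable3|exact: hv|exact: hw].
Qed.

Lemma L2locZ (c : C) (v : vfield R) : L2loc v -> L2loc (c *: v).
Proof. move=> hv K cK; apply: L2Z; [exact: compact_measurable3|exact: hv]. Qed.

Lemma L2loc_vtestable (v : vfield R) : L2loc v -> vtestable setT v.
Proof. by move=> hv j; apply: sL2loc_testable => K cK; exact: hv. Qed.

Lemma measurableT3 : measurable3 (@setT (pt3 R)).
Proof. exact: (@measurableT _ (mpt3 R)). Qed.

Lemma periodic3D (V : nmodType) (f g : pt3 R -> V) :
  periodic3 f -> periodic3 g -> periodic3 (f + g).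
Proof. by move=> hf hg y j; rewrite !addrfctE/= hf hg. Qed.

Lemma periodic3Z (V : lmodType C) (c : C) (f : pt3 R -> V) :
  periodic3 f -> periodic3 (c *: f).
Proof. by move=> hf y j; rewrite !scalrfctE/= hf. Qed.

Lemma Hcurl_per_linear : linear_set (@Hcurl_per R).
Proof.
have ht p : Hcurl_per p -> curl_testable setT p.
  by case=> _ _ h h' _; split; exact: L2loc_vtestable.
have mT := measurableT3; split.
- by split=> //; [exact: L2loc_0|exact: L2loc_0|exact: weak_curl0].
- move=> p q hp hq; have [p1 p2 p3 p4 p5] := hp; have [q1 q2 q3 q4 q5] := hq; split.
  + exact: (periodic3D p1 q1).
  + exact: (periodic3D p2 q2).
  + exact: (L2locD p3 q3).
  + exact: (L2locD p4 q4).
  + by apply: weak_curlD => //; exact: ht.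
- move=> c p hp; have [p1 p2 p3 p4 p5] := hp; split.
  + exact: (periodic3Z c p1).
  + exact: (periodic3Z c p2).
  + exact: (L2locZ c p3).
  + exact: (L2locZ c p4).
  + by apply: weak_curlZ => //; exact: ht.
Qed.

Lemma sL2_cintegrable D (f : sfield R) : measurable3 D -> (leb D < +oo)%E ->
  sL2 leb D f -> cintegrable leb D f.
Proof.
move=> mD Dfin hf.
by apply: eq_cintegrable (sL2M mD hf (cst_sL2 mD 1 Dfin)) => // x _; rewrite mulr1.
Qed.

Lemma Ycell_finite : (leb (@Ycell R) < +oo)%E.
Proof.
apply: le_lt_trans (cube_finite (2^-1 : R)); apply: le_measure; rewrite ?inE.
- exact: Ycell_measurable.
- exact: cube_measurable.
- exact: Ycell_sub_cube.
Qed.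

Lemma sL2loc_Ycell (f : sfield R) : sL2loc f -> cintegrable leb (@Ycell R) f.
Proof.
move=> hf; apply: sL2_cintegrable; [exact: Ycell_measurable|exact: Ycell_finite|].
apply: sL2S (@Ycell_sub_cube R) _; [exact: Ycell_measurable|exact: cube_measurable|].
by apply: hf; exact: cube_compact.
Qed.

Lemma H1_per0_linear : linear_set (@H1_per0 R).
Proof.
have ht p : H1_per0 p -> grad_testable setT p.
  by case=> [[_ _ h h'] _]; split; [exact: sL2loc_testable|exact: L2loc_vtestable].
have mT := measurableT3; have mY := @Ycell_measurable R; split.
- split; first split=> //.
  + by move=> K cK; apply: sL2_0; exact: compact_measurable3.
  + exact: L2loc_0.
  + by split; [exact: weak_grad0|exact: cint0].
- move=> p q hp hq; have [[p1 p2 p3 p4] [p5 p6]] := hp.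
  have [[q1 q2 q3 q4] [q5 q6]] := hq; split; first split.
  + exact: (periodic3D p1 q1).
  + exact: (periodic3D p2 q2).
  + exact: (sL2loc_linear 0 p3 q3).1.
  + exact: (L2locD p4 q4).
  + split; first by apply: weak_gradD => //; exact: ht.
    transitivity (cint leb (@Ycell R) (sfld p) + cint leb (@Ycell R) (sfld q)).
      by rewrite -cintD//; exact: sL2loc_Ycell.
    by rewrite p6 q6 addr0.
- move=> c p hp; have [[p1 p2 p3 p4] [p5 p6]] := hp; split; first split.
  + exact: (periodic3Z (V := C) c p1).
  + exact: (periodic3Z c p2).
  + exact: (sL2loc_linear c p3 p3).2.
  + exact: (L2locZ c p4).
  + split; first by apply: weak_gradZ => //; exact: ht.
    transitivity (c * cint leb (@Ycell R) (sfld p)).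
      by rewrite -cintZ//; exact: sL2loc_Ycell.
    by rewrite p6 mulr0.
Qed.

Lemma restr_linear (V W : lmodType C) D (X : set ((pt3 R -> V) * (pt3 R -> W))) :
  linear_set X -> linear_set (restr D X).
Proof.
move=> [X0 XD XZ]; split.
- by exists 0.
- move=> p q [p' Xp pp'] [q' Xq qq']; exists (p' + q'); first exact: XD.
  move=> y Dy; have [a b] := pp' y Dy; have [a' b'] := qq' y Dy.
  by split; [exact: (f_equal2 +%R a a')|exact: (f_equal2 +%R b b')].
- move=> c p [p' Xp pp']; exists (c *: p'); first exact: XZ.
  move=> y Dy; have [a b] := pp' y Dy.
  by split; [exact: (f_equal (GRing.scale c) a)|exact: (f_equal (GRing.scale c) b)].
Qed.

Lemma ae_zeroD (V : nmodType) D (f g : pt3 R -> V) :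
  ae_zero D f -> ae_zero D g -> ae_zero D (f + g).
Proof.
move=> hf hg; apply: ae_imp (ae_and hf hg) => y [h1 h2] Dy.
by rewrite addrfctE/= h1// h2// addr0.
Qed.

Lemma ae_zeroZ (V : lmodType C) D (c : C) (f : pt3 R -> V) :
  ae_zero D f -> ae_zero D (c *: f).
Proof.
by move=> hf; apply: ae_imp hf => y h Dy; rewrite scalrfctE/= h// scaler0.
Qed.

Lemma ae_zero0 (V : nmodType) D : ae_zero D (0 : pt3 R -> V).
Proof. exact: aeW. Qed.

Lemma Hcurl_per_on_linear D : linear_set (@Hcurl_per_on R D).
Proof. exact: restr_linear Hcurl_per_linear. Qed.

Lemma H1_per0_on_linear D : linear_set (@H1_per0_on R D).
Proof. exact: (restr_linear (V := C)) H1_per0_linear. Qed.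

Lemma ker_curl_linear D : linear_set (@ker_curl R D).
Proof.
have [h0 hD hZ] := Hcurl_per_on_linear D; split.
- by split; [exact: h0|exact: ae_zero0].
- by move=> p q [hp p0] [hq q0]; split; [exact: hD|exact: (ae_zeroD p0 q0)].
- by move=> c p [hp p0]; split; [exact: hZ|exact: (ae_zeroZ c p0)].
Qed.

End FunctionSpaces.

(** * Norms of the function spaces and their Bochner functions *)

Section FieldNorms.
Variable R : realType.
Local Notation C := R[i].
Local Notation leb := (@leb3 R).
Implicit Types (D S : set (pt3 R)) (v : vfield R).

Lemma square_norm_pullback (V V' : lmodType C) (X : set V) (X' : set V')
    (Q : V' -> R) (L : V -> V') :
  (forall p q, L (p + q) = L p + L q) -> (forall c p, L (c *: p) = c *: L p) ->
  (forall p, X p -> X' (L p)) -> square_norm_on X' Q ->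
  square_norm_on X (fun p => Q (L p)).
Proof.
move=> LD LZ LX [Q0 QD QZ]; split=> [p /LX/Q0//|t p q t0 Xp Xq|c p Xp].
  by rewrite LD; apply: QD => //; exact: LX.
by rewrite LZ; apply: QZ; exact: LX.
Qed.

Lemma eq_seminorm_on (V : lmodType C) (X : set V) (N N' : V -> R) :
  linear_set X -> (forall p, X p -> N p = N' p) -> seminorm_on X N ->
  seminorm_on X N'.
Proof.
move=> [X0 XD XZ] NN [N0 ND NZ]; split=> [p Xp|p q Xp Xq|c p Xp].
- by rewrite -NN// N0.
- by rewrite -!NN ?ND//; exact: XD.
- by rewrite -!NN ?NZ//; exact: XZ.
Qed.

Section OnSet.
Variable S : set (pt3 R).
Hypothesis mS : measurable3 S.

Definition L2_pair (p : gcurl R) := L2 leb S (fld p) /\ L2 leb S (curl p).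

Definition L2_spair (p : ggrad R) := sL2 leb S (sfld p) /\ L2 leb S (gradient p).

Lemma norm_HcurlE p : L2_pair p ->
  norm_Hcurl S p = Num.sqrt (vnorm2 leb S (fld p) + vnorm2 leb S (curl p)).
Proof.
move=> [hf hc]; rewrite /norm_Hcurl -!Rintegral_sqnv// -RintegralD//;
  exact: integrable_sqnv.
Qed.

Lemma norm_H1E p : L2_spair p ->
  norm_H1 S p = Num.sqrt (snorm2 leb S (sfld p) + vnorm2 leb S (gradient p)).
Proof.
move=> [/sL2P[_ hf] hc]; rewrite /norm_H1 -!Rintegral_sqnv// -RintegralD//.
exact: integrable_sqnv.
Qed.

Lemma norm_Hcurl_seminorm (X : set (gcurl R)) : linear_set X ->
  (forall p, X p -> L2_pair p) -> seminorm_on X (norm_Hcurl S).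
Proof.
move=> sX hX.
apply: (eq_seminorm_on sX (N := fun p =>
  Num.sqrt (vnorm2 leb S (fld p) + vnorm2 leb S (curl p)))).
  by move=> p /hX/norm_HcurlE.
apply: square_norm_seminorm => //; apply: square_normD;
  apply: square_norm_pullback (vnorm2_square_norm leb mS) => // p /hX[]//.
Qed.

Lemma norm_H1_seminorm (X : set (ggrad R)) : linear_set X ->
  (forall p, X p -> L2_spair p) -> seminorm_on X (norm_H1 S).
Proof.
move=> sX hX.
apply: (eq_seminorm_on sX (N := fun p =>
  Num.sqrt (snorm2 leb S (sfld p) + vnorm2 leb S (gradient p)))).
  by move=> p /hX/norm_H1E.
apply: square_norm_seminorm => //; apply: square_normD; last first.
  by apply: square_norm_pullback (vnorm2_square_norm leb mS) => // p /hX[].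
split=> [p _|t p q t0 /hX[hp _] /hX[hq _]|c p /hX[hp _]]; first exact: snorm2_ge0.
  exact: (snorm2D mS t0 hp hq).
by rewrite (_ : snorm2 _ _ _ = sqn c * snorm2 leb S (sfld p)) //; exact: snorm2Z.
Qed.

Lemma L2norm_curl_le p : L2_pair p -> L2norm leb S (curl p) <= norm_Hcurl S p.
Proof. by move=> hp; rewrite norm_HcurlE// ler_wsqrtr// lerDr vnorm2_ge0. Qed.

Lemma L2norm_fld_le p : L2_pair p -> L2norm leb S (fld p) <= norm_Hcurl S p.
Proof. by move=> hp; rewrite norm_HcurlE// ler_wsqrtr// lerDl vnorm2_ge0. Qed.

Lemma L2norm_grad_le p : L2_spair p -> L2norm leb S (gradient p) <= norm_H1 S p.
Proof. by move=> hp; rewrite norm_H1E// ler_wsqrtr// lerDr snorm2_ge0. Qed.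

Lemma ip_self v : L2 leb S v -> ip leb S v v = cplx (vnorm2 leb S v).
Proof.
move=> hv; rewrite -Rintegral_sqnv//; apply: complexP => /=.
  by apply: eq_Rintegral => x _; rewrite dot_conj.
rewrite /Rintegral (eq_integral (cst 0)); last by move=> x _; rewrite dot_conj.
by rewrite integral0.
Qed.

Lemma vnorm2_ae0 v : L2 leb S v -> ae_zero S v -> vnorm2 leb S v = 0.
Proof.
move=> hv v0; apply: (@cplx_inj R); rewrite -ip_self//.
rewrite (ae_eq_ip mS hv (L2_0 leb mS) hv v0).
by transitivity (cint leb S (fun=> 0)); [apply: eq_cint => x _; rewrite dot0l|
  rewrite cint0].
Qed.

Lemma vnorm2_eq0 v : L2 leb S v -> vnorm2 leb S v = 0 -> ae_zero S v.
Proof.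
move=> hv v0.
have i1 := ip_integrable mS hv hv.
have pos : {ae leb, forall x, S x -> 0 <= complex.Re (dot (v x) (conjv (v x)))}.
  by apply: aeW => x _; rewrite dot_conj /= sqnv_ge0.
have := Re_cint_eq0 mS i1 pos; rewrite -/(ip leb S v v) ip_self// => /(_ v0).
by apply: ae_imp => x h /h; rewrite dot_conj /=; exact: sqnv_eq0.
Qed.

(** The quotient seminorm of H(curl) controls the curl: elements of
    the kernel change the representative but not its curl. *)
Lemma L2norm_curl_le_qnorm (X : set (gcurl R)) p : linear_set X ->
  (forall q, X q -> L2_pair q) -> X p -> ker_curl S `<=` X ->
  L2norm leb S (curl p) <= qnorm_Hcurl S p.
Proof.
move=> sX hX Xp KX; apply: le_quotient_norm; first exact: ker_curl_linear.
move=> q Kq; have Xpq := linear_setB sX Xp (KX _ Kq).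
have [_ hp] := hX _ Xp; have [_ hq] := hX _ (KX _ Kq).
have [_ ND _] := L2_seminorm leb mS.
apply: le_trans (L2norm_curl_le (hX _ Xpq)).
have h := ND (curl (p - q)) (curl q) (hX _ Xpq).2 hq.
have q0 : L2norm leb S (curl q) = 0 by rewrite /L2norm (vnorm2_ae0 hq Kq.2) sqrtr0.
rewrite q0 addr0 in h.
apply: le_trans h; rewrite le_eqVlt; apply/orP; left; apply/eqP.
by congr (L2norm _ _ _); apply/esym/(subrK (curl q) (curl p)).
Qed.

End OnSet.

Section Restrictions.
Variable S : set (pt3 R).
Hypotheses (mS : measurable3 S) (SY : S `<=` @Ycell R).

Lemma sub_cell_finite : (leb S < +oo)%E.
Proof.
apply: le_lt_trans (Ycell_finite R); apply: le_measure; rewrite ?inE//.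
exact: Ycell_measurable.
Qed.

Lemma sL2loc_sub (f : sfield R) : sL2loc f -> sL2 leb S f.
Proof.
move=> hf; apply: (@sL2S _ _ S (cube (2^-1 : R))) => //.
- exact: cube_measurable.
- by move=> x /SY/Ycell_sub_cube.
- by apply: hf; exact: cube_compact.
Qed.

Lemma Hcurl_per_on_L2 p : Hcurl_per_on S p -> L2_pair S p.
Proof.
move=> [q [_ _ hf hc _] pq]; split.
  apply: (@eq_L2 _ leb S (fld q)) => [x Sx|]; first by rewrite /fld (pq x Sx).1.
  by move=> j; apply: sL2loc_sub => K cK; exact: hf.
apply: (@eq_L2 _ leb S (curl q)) => [x Sx|]; first by rewrite /curl (pq x Sx).2.
by move=> j; apply: sL2loc_sub => K cK; exact: hc.
Qed.

Lemma H1_per0_on_L2 p : H1_per0_on S p -> L2_spair S p.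
Proof.
move=> [q [[_ _ hf hg] _] pq]; split.
  apply: (@eq_sL2 _ leb S (sfld q)) => [x Sx|]; first by rewrite /sfld (pq x Sx).1.
  exact: sL2loc_sub.
apply: (@eq_L2 _ leb S (gradient q)) => [x Sx|]; first by rewrite /gradient (pq x Sx).2.
by move=> j; apply: sL2loc_sub => K cK; exact: hg.
Qed.

Lemma qnorm_seminorm : seminorm_on (Hcurl_per_on S) (qnorm_Hcurl S).
Proof.
apply: quotient_norm_seminorm.
- exact: Hcurl_per_on_linear.
- exact: ker_curl_linear.
- by move=> p [].
- by apply: norm_Hcurl_seminorm => //; [exact: Hcurl_per_on_linear|
    exact: Hcurl_per_on_L2].
Qed.

Lemma norm_H1_per0_seminorm : seminorm_on (H1_per0_on S) (norm_H1 S).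
Proof.
by apply: norm_H1_seminorm => //; [exact: H1_per0_on_linear|exact: H1_per0_on_L2].
Qed.

End Restrictions.

Lemma H0curl_L2 S p : H0curl S p -> L2_pair S p.
Proof. by case=> [[]]. Qed.

Lemma norm_H0curl_seminorm S : measurable3 S ->
  seminorm_on (H0curl S) (norm_Hcurl S).
Proof.
by move=> mS; apply: norm_Hcurl_seminorm => //; [exact: H0curl_linear|exact: H0curl_L2].
Qed.

Section BochnerFields.
Variables D S : set (pt3 R).
Hypotheses (mD : measurable3 D) (mS : measurable3 S).
Local Notation bochner_L2_fields := (bochner_L2 D (L2 leb S) (L2norm leb S)).

Lemma bochner_curl_per (U : pt3 R -> gcurl R) : S `<=` @Ycell R ->
  bochner_L2 D (Hcurl_per_on S) (qnorm_Hcurl S) U ->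
  bochner_L2_fields (fun x => curl (U x)).
Proof.
move=> SY; apply: (bochner_map mD (M := 1) (Hcurl_per_on_linear S)
    (qnorm_seminorm mS SY) (L2_linear leb mS) (L2_seminorm leb mS)) => //.
  by move=> p /(Hcurl_per_on_L2 mS SY)[].
move=> p Xp; rewrite mul1r; apply: L2norm_curl_le_qnorm (Hcurl_per_on_linear S) _ Xp _ => //.
  exact: Hcurl_per_on_L2.
by move=> q [].
Qed.

Lemma bochner_gradient (U : pt3 R -> ggrad R) : S `<=` @Ycell R ->
  bochner_L2 D (H1_per0_on S) (norm_H1 S) U ->
  bochner_L2_fields (fun x => gradient (U x)).
Proof.
move=> SY; apply: (bochner_map mD (M := 1) (H1_per0_on_linear S)
    (norm_H1_per0_seminorm mS SY) (L2_linear leb mS) (L2_seminorm leb mS)) => //.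
  by move=> p /(H1_per0_on_L2 mS SY)[].
by move=> p Xp; rewrite mul1r; apply: L2norm_grad_le => //; exact: H1_per0_on_L2.
Qed.

Lemma bochner_curl0 (U : pt3 R -> gcurl R) :
  bochner_L2 D (H0curl S) (norm_Hcurl S) U ->
  bochner_L2_fields (fun x => curl (U x)).
Proof.
apply: (bochner_map mD (M := 1) (H0curl_linear mS)
    (norm_H0curl_seminorm mS) (L2_linear leb mS) (L2_seminorm leb mS)) => //.
  by move=> p /H0curl_L2[].
by move=> p Xp; rewrite mul1r; apply: L2norm_curl_le => //; exact: H0curl_L2.
Qed.

Lemma bochner_fld0 (U : pt3 R -> gcurl R) :
  bochner_L2 D (H0curl S) (norm_Hcurl S) U ->
  bochner_L2_fields (fun x => fld (U x)).
Proof.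
apply: (bochner_map mD (M := 1) (H0curl_linear mS)
    (norm_H0curl_seminorm mS) (L2_linear leb mS) (L2_seminorm leb mS)) => //.
  by move=> p /H0curl_L2[].
by move=> p Xp; rewrite mul1r; apply: L2norm_fld_le => //; exact: H0curl_L2.
Qed.

Lemma vec_decomp (b : 'cV[C]_3) : b = \sum_j b j 0 *: evec R j.
Proof.
apply/colP => i; rewrite summxE (bigD1 i)//= big1 => [|j ji].
  by rewrite /evec !mxE !eqxx mulr1 addr0.
by rewrite /evec !mxE eq_sym (negbTE ji) mulr0.
Qed.

Lemma macro_decomp (b : 'cV[C]_3) :
  (fun=> b) = \sum_j b j 0 *: ((fun=> evec R j) : vfield R).
Proof. by apply/funext => y; rewrite fct_sumE [LHS]vec_decomp. Qed.

(** A macroscopic L2 field, seen as constant in the microscopic variable, is a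
    combination of three fixed constant fields with scalar L2 coefficients. *)
Lemma bochner_macro (b : vfield R) : (leb S < +oo)%E -> L2 leb D b ->
  bochner_L2_fields (fun x => fun=> b x).
Proof.
move=> Sfin hb.
have -> : (fun x => (fun=> b x) : vfield R) =
    (fun x => \sum_j b x j 0 *: ((fun=> evec R j) : vfield R)).
  by apply/funext => x; exact: macro_decomp.
apply: (bochner_sum mD (L2_linear leb mS) (L2_seminorm leb mS)) => j.
apply: (bochner_scale mD (L2_linear leb mS) (L2_seminorm leb mS)); first exact: hb.
exact: cst_L2.
Qed.

Lemma bochner_amul (M : R) (a : sfield R) (U : pt3 R -> vfield R) : 0 <= M ->
  ess_bounded leb S M a -> bochner_L2_fields U ->
  bochner_L2_fields (fun x => amul a (U x)).
Proof.
move=> M0 ha; apply: (bochner_map mD (M := Num.sqrt M) (L2_linear leb mS)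
  (L2_seminorm leb mS) (L2_linear leb mS) (L2_seminorm leb mS)).
- by move=> p q; apply/funext => x; rewrite /amul scalerBr.
- by move=> p hp; have [] := amul_L2 mS M0 ha hp.
- move=> p hp; rewrite /L2norm -sqrtrM// ler_wsqrtr//.
  by have [] := amul_L2 mS M0 ha hp.
Qed.

End BochnerFields.

End FieldNorms.

(** * Coefficients *)

Section Coefficients.
Variable R : realType.
Local Notation leb := (@leb3 R).
Variable S : set (pt3 R).
Hypotheses (mS : measurable3 S) (SY : S `<=` @Ycell R).

Lemma Linfty_per_bounded (f : sfield R) : Linfty_per f ->
  exists2 M : R, 0 <= M & ess_bounded leb S M f.
Proof.
move=> [_ [m1 m2] [M fM]]; exists `|M|; first exact: normr_ge0.
split; first by split; [apply: measurable_funS m1|apply: measurable_funS m2] => //;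
  exact: Ycell_measurable.
by apply: ae_imp fM => y h /SY/h h'; rewrite (le_trans h')// ler_norm.
Qed.

Lemma measurable_inv (D : set (pt3 R)) (f : pt3 R -> R) :
  @measurable_fun _ _ (mpt3 R) R D f ->
  @measurable_fun _ _ (mpt3 R) R D (fun x => (f x)^-1).
Proof.
(* 1 / t = t (t^2)^(-1), also at t = 0, and real powers are measurable. *)
move=> mf; have -> : (fun x => (f x)^-1) = (fun x => f x * (f x ^+ 2) `^ (-1)).
  apply/funext => x; rewrite powR_inv1 ?sqr_ge0//.
  by have [->|fx] := eqVneq (f x) 0; [rewrite invr0 mul0r|field].
apply: measurable_funM => //.
apply: (measurableT_comp (measurable_powR (-1))).
exact: measurable_funX.
Qed.

Lemma eps0V_bounded (eps0 : pt3 R -> R) :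
  Linfty_per (fun y => cplx (eps0 y)) ->
  (exists2 c : R, 0 < c & {ae leb, forall y, @Ycell R y -> c <= eps0 y}) ->
  exists2 M : R, 0 <= M & ess_bounded leb S M (eps0V eps0).
Proof.
move=> [_ [m1 _] _] [c c0 hc]; exists (c^-1 ^+ 2); first exact: sqr_ge0.
split.
  split; last exact: measurable_cst.
  apply: measurable_inv; apply: measurable_funS m1 => //; exact: Ycell_measurable.
apply: ae_imp hc => y h /SY/h cy; have e0 := lt_le_trans c0 cy.
have ie : (eps0 y)^-1 <= c^-1 by rewrite lef_pV2.
by rewrite /eps0V sqn_cplx lerXn2r// nnegrE invr_ge0 ltW.
Qed.

End Coefficients.


(** * Averages of the cell fields *)

Section CellAlgebra.
Variable R : realType.
Local Notation C := R[i].
Local Notation leb := (@leb3 R).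
Implicit Types (S : set (pt3 R)).

Lemma conj_evec (l : 'I_3) : conjv (evec R l) = evec R l.
Proof. by apply/colP => i; rewrite !mxE rmorph_nat. Qed.

Lemma dot_mulmx (A : 'M[C]_3) (a b : 'cV[C]_3) :
  dot (A *m a) (conjv b) = \sum_j \sum_l a j 0 * Num.conj (b l 0) * A l j.
Proof.
rewrite exchange_big; apply: eq_bigr => l _; rewrite !mxE mulr_suml.
by apply: eq_bigr => j _; rewrite -mulrA mulrC.
Qed.

(** The double sum only contains cell averages, from which the homogenised matrices are
    made; the last sum collects the products that the cell problems evaluate. *)
Lemma ip_cell_combination S (F : 'I_3 -> vfield R) (a b : 'cV[C]_3) (w : vfield R) :
  measurable3 S -> (leb S < +oo)%E -> (forall j, L2 leb S (F j)) -> L2 leb S w ->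
  ip leb S (\sum_j a j 0 *: F j) ((fun=> b) + w) =
  \sum_j \sum_l a j 0 * Num.conj (b l 0) * ip leb S (F j) (fun=> evec R l) +
  \sum_j a j 0 * ip leb S (F j) w.
Proof.
move=> mS Sfin hF hw.
have hb (c : 'cV[C]_3) : L2 leb S (fun=> c) by exact: cst_L2.
have hbw : L2 leb S ((fun=> b) + w) by exact: L2D.
rewrite ip_suml//; last by move=> j; exact: L2Z.
rewrite -big_split/=; apply: eq_bigr => j _; rewrite ipZl// ipDr// mulrDr; congr (_ + _).
rewrite macro_decomp.
elim: (index_enum _) => [|l s IH].
  rewrite !big_nil; transitivity (a j 0 * cint leb S (fun=> 0)); last by rewrite cint0 mulr0.
  congr (_ * _); apply: eq_cint => y _; by rewrite conjv0 dot0r.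
rewrite !big_cons ipDr//.
- by rewrite mulrDr IH ipZr// mulrA.
- exact: L2Z.
- by apply: (big_ind (L2 leb S)) => [|v v' *|i _]; [exact: L2_0|exact: L2D|exact: L2Z].
Qed.

End CellAlgebra.

Section Boundary.
Variable R : realType.
Local Notation leb := (@leb3 R).
Implicit Types (D S Sigma Omega G : set (pt3 R)).

Lemma bdry_measurable D : measurable3 (bdry D).
Proof.
apply: (@measurableD _ (mpt3 R)).
  by apply: closed_measurable3; exact: closed_closure.
by apply: open_measurable3; exact: open_interior.
Qed.

End Boundary.

(** * The two-scale form at one macroscopic point *)

Section TwoScaleForm.
Variable R : realType.
Local Notation C := R[i].
Local Notation leb := (@leb3 R).
Variables (Omega G Sigma : set (pt3 R)) (n : pt3 R -> 'cV[R]_3)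
  (sigma : {measure set (mpt3 R) -> \bar R})
  (k : R) (eps0 : pt3 R -> R) (eps1 : pt3 R -> C).
Variables (w1 : 'I_3 -> gcurl R) (w2 : 'I_3 -> ggrad R) (w3 : 'I_3 -> gcurl R).
Local Notation Y := (@Ycell R).
Local Notation Sstar := (Sigma_star Sigma).
Local Notation k2 := (cplx (k ^+ 2)).
Local Notation e0 := (eps0V eps0).
Local Notation e1 := (fun y => (eps1 y)^-1).
Local Notation H1 := (Hcurl_per_on Sstar).
Local Notation H2 := (H1_per0_on Sstar).
Local Notation H3 := (H0curl Sigma).
Local Notation L1 := (bochner_L2 Omega H1 (qnorm_Hcurl Sstar)).
Local Notation L2' := (bochner_L2 Omega H2 (norm_H1 Sstar)).
Local Notation L3 := (bochner_L2 Omega H3 (norm_Hcurl Sigma)).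

Hypotheses (mO : measurable3 Omega) (mG : measurable3 G) (mS : measurable3 Sigma).
Hypotheses (SY : Sigma `<=` Y) (OG : Omega `<=` G).
Hypothesis he0 : exists2 M : R, 0 <= M & ess_bounded leb Sstar M e0.
Hypothesis he1 : exists2 M : R, 0 <= M & ess_bounded leb Sigma M e1.
Hypotheses (hw1 : forall l, cell1 Sigma eps0 l (w1 l))
  (hw2 : forall l, cell2 Sigma k l (w2 l))
  (hw3 : forall l, cell3 Sigma k eps1 l (w3 l)).

Let mY := @Ycell_measurable R.
Let mSstar : measurable3 Sstar. Proof. exact: (@measurableD _ (mpt3 R)). Qed.
Let SstarY : Sstar `<=` Y. Proof. by move=> y []. Qed.
Let Sstar_fin := sub_cell_finite mSstar SstarY.
Let Sigma_fin := sub_cell_finite mS SY.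

Lemma Ycell_split : Y = Sstar `|` Sigma.
Proof.
apply/seteqP; split=> [y Yy|y [[]//|/SY//]].
by have [Sy|Sy] := pselect (Sigma y); [right|left].
Qed.

Lemma Sigma_star_disjoint : [disjoint Sstar & Sigma].
Proof. by apply/disj_setPS => y [[_ ]]. Qed.

Lemma cint_Ycell (f g h : sfield R) : (forall y, Sstar y -> f y = g y) ->
  (forall y, Sigma y -> f y = h y) ->
  cintegrable leb Sstar g -> cintegrable leb Sigma h ->
  cint leb Y f = cint leb Sstar g + cint leb Sigma h.
Proof.
move=> fg fh ig ih; rewrite Ycell_split cint_setU//; last 2 first.
- exact: Sigma_star_disjoint.
- apply: cintegrable_setU => //; first exact: Sigma_star_disjoint.
    by apply: eq_cintegrable ig => // y /fg.
  by apply: eq_cintegrable ih => // y /fh.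
by congr (_ + _); apply: eq_cint.
Qed.

Lemma chi_in (D : set (pt3 R)) y : D y -> chi D y = 1.
Proof. by move=> Dy; rewrite /chi indicE mem_set. Qed.

Lemma chi_out (D : set (pt3 R)) y : ~ D y -> chi D y = 0.
Proof. by move=> Dy; rewrite /chi indicE memNset. Qed.

Lemma ip0r (S : set (pt3 R)) (v : vfield R) : ip leb S v 0 = 0.
Proof. by rewrite -(cint0 leb S); apply: eq_cint => y _; rewrite conjv0 dot0r. Qed.

(** The whole fields of the cell problems, unit field plus corrector: the rotation in
    the exterior of the inclusion, and the field itself outside and inside it. *)
Definition cell_rot j : vfield R := (fun=> evec R j) + curl (w1 j).
Definition cell_ext j : vfield R := (fun=> evec R j) + k2 *: gradient (w2 j).
Definition cell_int j : vfield R := (fun=> evec R j) + k2 *: fld (w3 j).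

Let w1H j : H1 (w1 j). Proof. by case: (hw1 j). Qed.
Let w2H j : H2 (w2 j). Proof. by case: (hw2 j). Qed.
Let w3H j : H3 (w3 j). Proof. by case: (hw3 j). Qed.

Let L2H1 p : H1 p -> L2 leb Sstar (curl p).
Proof. by case/(Hcurl_per_on_L2 mSstar SstarY). Qed.
Let L2H2 p : H2 p -> L2 leb Sstar (gradient p).
Proof. by case/(H1_per0_on_L2 mSstar SstarY). Qed.
Let L2H3 p : H3 p -> L2 leb Sigma (curl p).
Proof. by case/H0curl_L2. Qed.
Let L2H3f p : H3 p -> L2 leb Sigma (fld p).
Proof. by case/H0curl_L2. Qed.

Let L2e0 v : L2 leb Sstar v -> L2 leb Sstar (amul e0 v).
Proof. by case: he0 => M M0 hM hv; have [] := amul_L2 mSstar M0 hM hv. Qed.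
Let L2e1 v : L2 leb Sigma v -> L2 leb Sigma (amul e1 v).
Proof. by case: he1 => M M0 hM hv; have [] := amul_L2 mS M0 hM hv. Qed.

Let L2macro S (b : 'cV[C]_3) : measurable3 S -> (leb S < +oo)%E ->
  L2 leb S (fun=> b).
Proof. by move=> ? ?; exact: cst_L2. Qed.

Lemma cell_rot_L2 j : L2 leb Sstar (cell_rot j).
Proof. exact: (L2D mSstar (L2macro _ mSstar Sstar_fin) (L2H1 (w1H j))). Qed.
Lemma cell_ext_L2 j : L2 leb Sstar (cell_ext j).
Proof.
exact: (L2D mSstar (L2macro _ mSstar Sstar_fin) (L2Z mSstar k2 (L2H2 (w2H j)))).
Qed.
Lemma cell_int_L2 j : L2 leb Sigma (cell_int j).
Proof. exact: (L2D mS (L2macro _ mS Sigma_fin) (L2Z mS k2 (L2H3f (w3H j)))). Qed.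

Lemma cell_rot_orth j psi : H1 psi -> ip leb Sstar (amul e0 (cell_rot j)) (curl psi) = 0.
Proof. by move=> hp; have [_ h] := hw1 j; rewrite -(h _ hp) -ip_amul. Qed.

Lemma cell_ext_orth j psi : H2 psi -> ip leb Sstar (cell_ext j) (gradient psi) = 0.
Proof. by move=> hp; have [_ h] := hw2 j; rewrite -(h _ hp). Qed.

(** The zeroth-order term of the third cell problem combines with its source to the
    whole field in the inclusion. *)
Lemma cell_int_weak j psi : H3 psi ->
  ip leb Sigma (amul e1 (curl (w3 j))) (curl psi) = ip leb Sigma (cell_int j) (fld psi).
Proof.
move=> hp; have [_ /(_ _ hp) h] := hw3 j.
have hw := L2H3f (w3H j); have hf := L2H3f hp.
rewrite /cell_int (ipDl mS (L2macro _ mS Sigma_fin) (L2Z mS k2 hw) hf) (ipZl mS k2 hw hf).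
move: h; rewrite cintB//; last 2 first.
- apply: eq_cintegrable (ip_integrable mS (L2e1 (L2H3 (w3H j))) (L2H3 hp)) => // y _.
  by rewrite dotZl.
- by apply: cintegrableZ => //; exact: (ip_integrable mS hw hf).
rewrite (cintZ mS k2 (ip_integrable mS hw hf)).
by rewrite ip_amul => /eqP; rewrite subr_eq => /eqP.
Qed.

Lemma eps_hom_cellE l j : eps_hom_cell Sigma eps0 w1 l j =
  ip leb Sstar (amul e0 (cell_rot j)) (fun=> evec R l).
Proof. by rewrite mxE -ip_amul; apply: eq_cint => y _; rewrite conj_evec. Qed.

Lemma mu_hom_cellE l j : mu_hom_cell Sigma k w2 w3 l j =
  ip leb Sstar (cell_ext j) (fun=> evec R l) + ip leb Sigma (cell_int j) (fun=> evec R l).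
Proof.
rewrite mxE; apply: cint_Ycell.
- move=> y Sy; rewrite chi_in// (chi_out (D := Sigma)); last by case: Sy.
  by rewrite mulr1 mulr0 scale0r addr0 conj_evec.
- move=> y Sy; rewrite (chi_in Sy) chi_out; last by case.
  by rewrite mulr1 mulr0 scale0r addr0 conj_evec.
- exact: (ip_integrable mSstar (cell_ext_L2 j) (L2macro _ mSstar Sstar_fin)).
- exact: (ip_integrable mS (cell_int_L2 j) (L2macro _ mS Sigma_fin)).
Qed.

Definition rot_star (v : gimp R) (v1 : pt3 R -> gcurl R) x : vfield R :=
  (fun=> curl v.1 x) + curl (v1 x).
Definition ind_star (v : gimp R) (v2 : pt3 R -> ggrad R) x : vfield R :=
  (fun=> fld v.1 x) + gradient (v2 x).
Definition ind_incl (v : gimp R) (v3 : pt3 R -> gcurl R) x : vfield R :=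
  (fun=> fld v.1 x) + fld (v3 x).

(** The microscopic part of the two-scale form, at one macroscopic point. *)
Definition micro v v1 v2 v3 psi psi1 psi2 psi3 x : C :=
  ip leb Sstar (amul e0 (rot_star v v1 x)) (rot_star psi psi1 x)
  + ip leb Sigma (amul e1 (curl (v3 x))) (curl (psi3 x))
  - k2 * (ip leb Sstar (ind_star v v2 x) (ind_star psi psi2 x)
          + ip leb Sigma (ind_incl v v3 x) (ind_incl psi psi3 x)).

Definition macro_density (A M : 'M[C]_3) (u psi : gimp R) x : C :=
  dot (A *m curl u.1 x) (conjv (curl psi.1 x))
  - k2 * dot (M *m fld u.1 x) (conjv (fld psi.1 x)).

Definition outer_form (u psi : gimp R) : C :=
  cint leb (G `\` closure Omega) (macro_density 1%:M 1%:M u psi)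
  - imagi R * cplx k *
    cint sigma (bdry G) (fun x => dot (utan n u x) (conjv (utan n psi x))).

Section Integrability.
Variables (v psi : gimp R) (v1 psi1 : pt3 R -> gcurl R) (v2 psi2 : pt3 R -> ggrad R)
  (v3 psi3 : pt3 R -> gcurl R).
Hypotheses (hp : HH Omega G Sigma n sigma (v, v1, v2, v3))
  (hq : HH Omega G Sigma n sigma (psi, psi1, psi2, psi3)).

Lemma Himp_L2 (u : gimp R) (D : set (pt3 R)) : measurable3 D -> D `<=` G ->
  Himp G n sigma u -> L2 leb D (fld u.1) /\ L2 leb D (curl u.1).
Proof.
by move=> mD DG [[hf hc _] _ _ _]; split=> j; [apply: sL2S (hf j)|apply: sL2S (hc j)].
Qed.

Let bS1 := bochner_L2 Omega (L2 leb Sstar) (L2norm leb Sstar).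
Let bS2 := bochner_L2 Omega (L2 leb Sigma) (L2norm leb Sigma).

Lemma rot_star_bochner u u1 : Himp G n sigma u -> L1 u1 -> bS1 (rot_star u u1).
Proof.
move=> /(Himp_L2 mO OG)[_ hc] hu1.
apply: (bochnerD mO (L2_linear leb mSstar) (L2_seminorm leb mSstar)).
  exact: bochner_macro.
exact: bochner_curl_per.
Qed.

Lemma ind_star_bochner u u2 : Himp G n sigma u -> L2' u2 -> bS1 (ind_star u u2).
Proof.
move=> /(Himp_L2 mO OG)[hf _] hu2.
apply: (bochnerD mO (L2_linear leb mSstar) (L2_seminorm leb mSstar)).
  exact: bochner_macro.
exact: bochner_gradient.
Qed.

Lemma ind_incl_bochner u u3 : Himp G n sigma u -> L3 u3 -> bS2 (ind_incl u u3).
Proof.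
move=> /(Himp_L2 mO OG)[hf _] hu3.
apply: (bochnerD mO (L2_linear leb mS) (L2_seminorm leb mS)).
  exact: bochner_macro.
exact: bochner_fld0.
Qed.

Let i1 : cintegrable leb Omega
  (fun x => ip leb Sstar (amul e0 (rot_star v v1 x)) (rot_star psi psi1 x)).
Proof.
have [hv hv1 _ _] := hp; have [hpsi hpsi1 _ _] := hq; have [M M0 hM] := he0.
apply: (bochner_ip mO mSstar); last exact: rot_star_bochner.
by apply: (bochner_amul mO mSstar M0 hM); exact: rot_star_bochner.
Qed.

Let i2 : cintegrable leb Omega
  (fun x => ip leb Sigma (amul e1 (curl (v3 x))) (curl (psi3 x))).
Proof.
have [_ _ _ hv3] := hp; have [_ _ _ hpsi3] := hq; have [M M0 hM] := he1.
apply: (bochner_ip mO mS); last exact: bochner_curl0.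
by apply: (bochner_amul mO mS M0 hM); exact: bochner_curl0.
Qed.

Let i3 : cintegrable leb Omega
  (fun x => ip leb Sstar (ind_star v v2 x) (ind_star psi psi2 x)).
Proof.
have [hv _ hv2 _] := hp; have [hpsi _ hpsi2 _] := hq.
by apply: (bochner_ip mO mSstar); exact: ind_star_bochner.
Qed.

Let i4 : cintegrable leb Omega
  (fun x => ip leb Sigma (ind_incl v v3 x) (ind_incl psi psi3 x)).
Proof.
have [hv _ _ hv3] := hp; have [hpsi _ _ hpsi3] := hq.
by apply: (bochner_ip mO mS); exact: ind_incl_bochner.
Qed.

Lemma micro_integrable : cintegrable leb Omega (micro v v1 v2 v3 psi psi1 psi2 psi3).
Proof.
exact: (cintegrableB mO (cintegrableD mO i1 i2)
  (cintegrableZ mO k2 (cintegrableD mO i3 i4))).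
Qed.

Lemma ind_Ycell x : Omega x ->
  cint leb Y (fun y =>
      dot (fld v.1 x + chi Sstar y *: gradient (v2 x) y + chi Sigma y *: fld (v3 x) y)
          (conjv (fld psi.1 x + chi Sstar y *: gradient (psi2 x) y
                              + chi Sigma y *: fld (psi3 x) y))) =
  ip leb Sstar (ind_star v v2 x) (ind_star psi psi2 x)
  + ip leb Sigma (ind_incl v v3 x) (ind_incl psi psi3 x).
Proof.
move=> Ox; have [hv _ [hv2 _ _] [hv3 _ _]] := hp; have [hpsi _ [hpsi2 _ _] [hpsi3 _ _]] := hq.
apply: cint_Ycell.
- move=> y Sy; rewrite (chi_in Sy) (chi_out (D := Sigma)); last by case: Sy.
  by rewrite !scale1r !scale0r !addr0.
- move=> y Sy; rewrite (chi_in Sy) chi_out; last by case.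
  by rewrite !scale1r !scale0r !addr0.
- apply: (ip_integrable mSstar); apply: (L2D mSstar (L2macro _ mSstar Sstar_fin)).
    exact: (L2H2 (hv2 x Ox)).
  exact: (L2H2 (hpsi2 x Ox)).
- apply: (ip_integrable mS); apply: (L2D mS (L2macro _ mS Sigma_fin)).
    exact: (L2H3f (hv3 x Ox)).
  exact: (L2H3f (hpsi3 x Ox)).
Qed.

Lemma BB_micro :
  BB Omega G Sigma n sigma k eps0 eps1 (v, v1, v2, v3) (psi, psi1, psi2, psi3) =
  cint leb Omega (micro v v1 v2 v3 psi psi1 psi2 psi3) + outer_form v psi.
Proof.
have i34 := cintegrableD mO i3 i4.
rewrite /micro (cintB mO (cintegrableD mO i1 i2) (cintegrableZ mO k2 i34)).
rewrite (cintD mO i1 i2) (cintZ mO k2 i34).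
rewrite /outer_form [RHS]addrA; lazy beta iota delta [BB].
have congr4 (a b c d a' b' c' d' s e : C) : a = a' -> b = b' -> c = c' -> d = d' ->
    a + b - s * c + d - e = a' + b' - s * c' + d' - e by move=> -> -> -> ->.
apply: congr4.
- by apply: eq_cint => x _; rewrite -ip_amul.
- by apply: eq_cint => x _; rewrite -ip_amul.
- by apply: eq_cint => x Ox; rewrite ind_Ycell.
- by apply: eq_cint => x _; rewrite /macro_density !mul1mx.
Qed.

End Integrability.

(** The deviation of the microscopic fields from the correctors. *)
Definition res1 (u : gimp R) (u1 : pt3 R -> gcurl R) x : gcurl R :=
  u1 x - \sum_j curl u.1 x j 0 *: w1 j.
Definition res2 (u : gimp R) (u2 : pt3 R -> ggrad R) x : ggrad R :=
  u2 x - \sum_j (k2 * fld u.1 x j 0) *: w2 j.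
Definition res3 (u : gimp R) (u3 : pt3 R -> gcurl R) x : gcurl R :=
  u3 x - \sum_j (k2 * fld u.1 x j 0) *: w3 j.

Lemma curl_sum (a : 'I_3 -> C) (w : 'I_3 -> gcurl R) (p : gcurl R) :
  curl p = \sum_j a j *: curl (w j) + curl (p - \sum_j a j *: w j).
Proof.
have -> : \sum_j a j *: curl (w j) = curl (\sum_j a j *: w j).
  by elim/big_rec2: _ => // j p' v _ ->.
by rewrite /curl/= addrC subrK.
Qed.

Lemma fld_sum (a : 'I_3 -> C) (w : 'I_3 -> gcurl R) (p : gcurl R) :
  fld p = \sum_j a j *: fld (w j) + fld (p - \sum_j a j *: w j).
Proof.
have -> : \sum_j a j *: fld (w j) = fld (\sum_j a j *: w j).
  by elim/big_rec2: _ => // j p' v _ ->.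
by rewrite /fld/= addrC subrK.
Qed.

Lemma grad_sum (a : 'I_3 -> C) (w : 'I_3 -> ggrad R) (p : ggrad R) :
  gradient p = \sum_j a j *: gradient (w j) + gradient (p - \sum_j a j *: w j).
Proof.
have -> : \sum_j a j *: gradient (w j) = gradient (\sum_j a j *: w j).
  by elim/big_rec2: _ => // j p' v _ ->.
by rewrite /gradient/= addrC subrK.
Qed.

Let A := eps_hom_cell Sigma eps0 w1.
Let M := mu_hom_cell Sigma k w2 w3.

(** * Decomposition into cell fields and residuals *)

Lemma rot_star_residual u u1 x :
  rot_star u u1 x = \sum_j curl u.1 x j 0 *: cell_rot j + curl (res1 u u1 x).
Proof.
rewrite /rot_star (curl_sum (fun j => curl u.1 x j 0) w1 (u1 x)) addrA.
congr (_ + _); rewrite [in LHS]macro_decomp -big_split/=; apply: eq_bigr => j _.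
by rewrite /cell_rot scalerDr.
Qed.

Lemma ind_star_residual u u2 x :
  ind_star u u2 x = \sum_j fld u.1 x j 0 *: cell_ext j + gradient (res2 u u2 x).
Proof.
rewrite /ind_star (grad_sum (fun j => k2 * fld u.1 x j 0) w2 (u2 x)) addrA.
congr (_ + _); rewrite [in LHS]macro_decomp -big_split/=; apply: eq_bigr => j _.
by rewrite /cell_ext scalerDr scalerA [k2 * _]mulrC.
Qed.

Lemma ind_incl_residual u u3 x :
  ind_incl u u3 x = \sum_j fld u.1 x j 0 *: cell_int j + fld (res3 u u3 x).
Proof.
rewrite /ind_incl (fld_sum (fun j => k2 * fld u.1 x j 0) w3 (u3 x)) addrA.
congr (_ + _); rewrite [in LHS]macro_decomp -big_split/=; apply: eq_bigr => j _.
by rewrite /cell_int scalerDr scalerA [k2 * _]mulrC.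
Qed.

Section Residual.
Variables (u psi : gimp R) (u1 psi1 : pt3 R -> gcurl R) (u2 psi2 : pt3 R -> ggrad R)
  (u3 psi3 : pt3 R -> gcurl R) (x : pt3 R).
Hypotheses (hu1 : H1 (u1 x)) (hu2 : H2 (u2 x)) (hu3 : H3 (u3 x)).
Hypotheses (hpsi1 : H1 (psi1 x)) (hpsi2 : H2 (psi2 x)) (hpsi3 : H3 (psi3 x)).

Lemma res1H : H1 (res1 u u1 x).
Proof.
apply: (linear_setB (Hcurl_per_on_linear Sstar) hu1).
apply: (linear_set_sum (Hcurl_per_on_linear Sstar)) => j.
by have [_ _ hZ] := Hcurl_per_on_linear Sstar; exact: hZ.
Qed.

Lemma res2H : H2 (res2 u u2 x).
Proof.
apply: (linear_setB (H1_per0_on_linear Sstar) hu2).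
apply: (linear_set_sum (H1_per0_on_linear Sstar)) => j.
by have [_ _ hZ] := H1_per0_on_linear Sstar; exact: hZ.
Qed.

Lemma res3H : H3 (res3 u u3 x).
Proof.
apply: (linear_setB (H0curl_linear mS) hu3).
apply: (linear_set_sum (H0curl_linear mS)) => j.
by have [_ _ hZ] := H0curl_linear mS; exact: hZ.
Qed.

Definition residual_form : C :=
  ip leb Sstar (amul e0 (curl (res1 u u1 x))) (rot_star psi psi1 x)
  + ip leb Sigma (amul e1 (curl (res3 u u3 x))) (curl (psi3 x))
  - k2 * (ip leb Sstar (gradient (res2 u u2 x)) (ind_star psi psi2 x)
          + ip leb Sigma (fld (res3 u u3 x)) (ind_incl psi psi3 x)).

Let rot_star_L2 : L2 leb Sstar (rot_star psi psi1 x).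
Proof. exact: (L2D mSstar (L2macro _ mSstar Sstar_fin) (L2H1 hpsi1)). Qed.
Let ind_star_L2 : L2 leb Sstar (ind_star psi psi2 x).
Proof. exact: (L2D mSstar (L2macro _ mSstar Sstar_fin) (L2H2 hpsi2)). Qed.
Let ind_incl_L2 : L2 leb Sigma (ind_incl psi psi3 x).
Proof. exact: (L2D mS (L2macro _ mS Sigma_fin) (L2H3f hpsi3)). Qed.

Let cell_sum_L2 S (a : 'I_3 -> C) (F : 'I_3 -> vfield R) : measurable3 S ->
  (forall j, L2 leb S (F j)) -> L2 leb S (\sum_j a j *: F j).
Proof.
by move=> mS' hF; apply: (linear_set_sum (L2_linear leb mS')) => j; exact: (L2Z mS').
Qed.

(** The cell problems remove all products of cell fields with microscopic test
    fields, except those in the inclusion, which cancel between the rotation and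
    the induction terms; what is left is the homogenised density and a form in the
    residuals. *)
Lemma micro_residual :
  micro u u1 u2 u3 psi psi1 psi2 psi3 x = macro_density A M u psi x + residual_form.
Proof.
have hr1 := L2e0 (L2H1 res1H); have hr2 := L2H2 res2H.
have hr3 := L2e1 (L2H3 res3H); have hr4 := L2H3f res3H.
have hc j := L2e0 (cell_rot_L2 j); have hd j := L2e1 (L2H3 (w3H j)).
pose Q := \sum_j fld u.1 x j 0 * ip leb Sigma (cell_int j) (fld (psi3 x)).
have T1 : ip leb Sstar (amul e0 (rot_star u u1 x)) (rot_star psi psi1 x) =
    dot (A *m curl u.1 x) (conjv (curl psi.1 x)) +
    ip leb Sstar (amul e0 (curl (res1 u u1 x))) (rot_star psi psi1 x).
  rewrite rot_star_residual [amul _ (_ + curl (res1 u u1 x))]amulD amul_sum.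
  etransitivity; first exact: (ipDl mSstar (cell_sum_L2 _ mSstar hc) hr1 rot_star_L2).
  congr (_ + _); etransitivity; first exact:
    (ip_cell_combination (curl u.1 x) (curl psi.1 x) mSstar Sstar_fin hc (L2H1 hpsi1)).
  rewrite [X in _ + X]big1 ?addr0 => [|j _]; last by rewrite cell_rot_orth// mulr0.
  rewrite dot_mulmx; apply: eq_bigr => j _; apply: eq_bigr => l _.
  by rewrite /A eps_hom_cellE.
have T2 : ip leb Sigma (amul e1 (curl (u3 x))) (curl (psi3 x)) =
    k2 * Q + ip leb Sigma (amul e1 (curl (res3 u u3 x))) (curl (psi3 x)).
  rewrite {1}(curl_sum (fun j => k2 * fld u.1 x j 0) w3 (u3 x)) -/(res3 u u3 x).
  rewrite [amul _ (_ + curl (res3 u u3 x))]amulD amul_sum.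
  etransitivity; first exact: (ipDl mS (cell_sum_L2 _ mS hd) hr3 (L2H3 hpsi3)).
  congr (_ + _); rewrite (ip_suml mS _ (L2H3 hpsi3)) => [|j]; last exact: L2Z.
  rewrite /Q mulr_sumr; apply: eq_bigr => j _.
  by rewrite (ipZl mS _ (hd j) (L2H3 hpsi3)) cell_int_weak// mulrA.
pose P3 := \sum_j \sum_l fld u.1 x j 0 * Num.conj (fld psi.1 x l 0) *
  ip leb Sstar (cell_ext j) (fun=> evec R l).
pose P4 := \sum_j \sum_l fld u.1 x j 0 * Num.conj (fld psi.1 x l 0) *
  ip leb Sigma (cell_int j) (fun=> evec R l).
have T3 : ip leb Sstar (ind_star u u2 x) (ind_star psi psi2 x) =
    P3 + ip leb Sstar (gradient (res2 u u2 x)) (ind_star psi psi2 x).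
  rewrite ind_star_residual.
  etransitivity; first exact: (ipDl mSstar (cell_sum_L2 _ mSstar cell_ext_L2) hr2 ind_star_L2).
  congr (_ + _); etransitivity; first exact:
    (ip_cell_combination (fld u.1 x) (fld psi.1 x) mSstar Sstar_fin cell_ext_L2 (L2H2 hpsi2)).
  by rewrite [X in _ + X]big1 ?addr0 => [//|j _]; rewrite cell_ext_orth// mulr0.
have T4 : ip leb Sigma (ind_incl u u3 x) (ind_incl psi psi3 x) =
    P4 + Q + ip leb Sigma (fld (res3 u u3 x)) (ind_incl psi psi3 x).
  rewrite ind_incl_residual.
  etransitivity; first exact: (ipDl mS (cell_sum_L2 _ mS cell_int_L2) hr4 ind_incl_L2).
  by congr (_ + _); exact:
    (ip_cell_combination (fld u.1 x) (fld psi.1 x) mS Sigma_fin cell_int_L2 (L2H3f hpsi3)).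
have PM : dot (M *m fld u.1 x) (conjv (fld psi.1 x)) = P3 + P4.
  rewrite dot_mulmx -big_split/=; apply: eq_bigr => j _; rewrite -big_split/=.
  by apply: eq_bigr => l _; rewrite /M mu_hom_cellE mulrDr.
rewrite /micro /residual_form /macro_density T1 T2 T3 T4 PM.
move: (ip leb Sstar _ _) (ip leb Sigma _ _) (dot _ _) (ip leb Sstar _ _) (ip leb Sigma _ _).
by move=> a b c d e; ring.
Qed.

End Residual.

Lemma ip_ae0l (S : set (pt3 R)) (v w : vfield R) : measurable3 S ->
  L2 leb S v -> ae_zero S v -> L2 leb S w -> ip leb S v w = 0.
Proof.
move=> mS' hv v0 hw; rewrite (ae_eq_ip mS' hv (L2_0 leb mS') hw v0).
by rewrite -(cint0 leb S); apply: eq_cint => y _; rewrite dot0l.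
Qed.

Lemma amul_ae0 (S : set (pt3 R)) (a : sfield R) (v : vfield R) :
  ae_zero S v -> ae_zero S (amul a v).
Proof. by apply: ae_imp => y h /h; rewrite /amul => ->; rewrite scaler0. Qed.

Section MacroDensity.
Variables (D : set (pt3 R)).
Hypotheses (mD : measurable3 D) (DG : D `<=` G).

Lemma sL2_sum (F : 'I_3 -> sfield R) : (forall j, sL2 leb D (F j)) ->
  sL2 leb D (fun x => \sum_j F j x).
Proof.
move=> hF; elim: (index_enum _) => [|j s IH].
  by apply: eq_sL2 (sL2_0 leb mD) => // x _; rewrite big_nil.
by apply: eq_sL2 (sL2D mD (hF j) IH) => // x _; rewrite big_cons.
Qed.

Lemma L2_mulmx (B : 'M[C]_3) (v : vfield R) : L2 leb D v ->
  L2 leb D (fun x => B *m v x).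
Proof.
move=> hv l; apply: eq_sL2 (sL2_sum (fun j => sL2Z mD (B l j) (hv j))) => // x _.
by rewrite mxE.
Qed.

Lemma macro_density_integrable (B B' : 'M[C]_3) u psi :
  Himp G n sigma u -> Himp G n sigma psi ->
  cintegrable leb D (macro_density B B' u psi).
Proof.
move=> /(Himp_L2 mD DG)[uf uc] /(Himp_L2 mD DG)[pf pc].
apply: (cintegrableB mD); first exact: (ip_integrable mD (L2_mulmx B uc) pc).
by apply: (cintegrableZ mD k2); exact: (ip_integrable mD (L2_mulmx B' uf) pf).
Qed.

End MacroDensity.

(** * The equivalence *)

Lemma outer_integrable_sets :
  measurable3 (G `\` closure Omega) /\ [disjoint G `\` closure Omega & Omega].
Proof.
split.
  apply: (@measurableD _ (mpt3 R)) => //.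
  by apply: closed_measurable3; exact: closed_closure.
by apply/disj_setPS => x [[_ nx] Ox]; apply: nx; exact: subset_closure.
Qed.

Lemma cint_zero_integrand (mu : {measure set (mpt3 R) -> \bar R}) (D : set (pt3 R))
  (f : sfield R) : (forall x, D x -> f x = 0) -> cint mu D f = 0.
Proof. by move=> f0; rewrite -(cint0 mu D); exact: eq_cint. Qed.

(** The effective coefficients vanish on the interface between the two regions, so the
    integral over G is the sum of those over Omega and over the exterior. *)
Lemma effective_form u psi : Himp G n sigma u -> Himp G n sigma psi ->
  cint leb G (fun x =>
      dot (effective Omega G A x *m curl u.1 x) (conjv (curl psi.1 x))
      - k2 * dot (effective Omega G M x *m fld u.1 x) (conjv (fld psi.1 x)))
  - imagi R * cplx k *
      cint sigma (bdry G) (fun x => dot (utan n u x) (conjv (utan n psi x))) =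
  cint leb Omega (macro_density A M u psi) + outer_form u psi.
Proof.
move=> hu hpsi; have [mE disj] := outer_integrable_sets.
set E := G `\` closure Omega in mE disj *.
have EG : E `<=` G by move=> x [].
have mEO : measurable3 (E `|` Omega) by exact: (@measurableU _ (mpt3 R)).
have EOG : E `|` Omega `<=` G by move=> x [/EG|/OG].
have mN : measurable3 (G `\` (E `|` Omega)) by exact: (@measurableD _ (mpt3 R)).
set f := (fun x => _ - k2 * _).
have fE x : E x -> f x = macro_density 1%:M 1%:M u psi x.
  move=> Ex; have nO : ~ Omega x by move=> Ox; case: Ex => _; apply; exact: subset_closure.
  by rewrite /f /effective (chi_in Ex) (chi_out nO) !scale1r !scale0r !addr0.
have fO x : Omega x -> f x = macro_density A M u psi x.
  move=> Ox; have nE : ~ E x by case=> _; apply; exact: subset_closure.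
  by rewrite /f /effective (chi_in Ox) (chi_out nE) !scale1r !scale0r !add0r.
have fN x : (G `\` (E `|` Omega)) x -> f x = 0.
  move=> [_ nEO]; have nE : ~ E x by move=> ?; apply: nEO; left.
  have nO : ~ Omega x by move=> ?; apply: nEO; right.
  rewrite /f /effective (chi_out nE) (chi_out nO) !scale0r !addr0 !mul0mx !dot0l.
  by rewrite mulr0 subr0.
have iE : cintegrable leb E f.
  exact: (eq_cintegrable mE (fun x Ex => esym (fE x Ex))
    (macro_density_integrable mE EG 1%:M 1%:M hu hpsi)).
have iO : cintegrable leb Omega f.
  exact: (eq_cintegrable mO (fun x Ox => esym (fO x Ox))
    (macro_density_integrable mO OG A M hu hpsi)).
have iN : cintegrable leb (G `\` (E `|` Omega)) f.
  by apply: eq_cintegrable (cintegrable0 leb (G `\` (E `|` Omega))) => // x /fN ->.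
have dN : [disjoint E `|` Omega & G `\` (E `|` Omega)].
  by apply/disj_setPS => x [h [_ /(_ h)]].
have GE : G = (E `|` Omega) `|` (G `\` (E `|` Omega)) by rewrite setDUK.
have iEO := cintegrable_setU mE mO disj iE iO.
have -> : cint leb G f = cint leb E f + cint leb Omega f.
  rewrite {1}GE (cint_setU mEO mN dN (cintegrable_setU mEO mN dN iEO iN)).
  by rewrite (cint_setU mE mO disj iEO) (cint_zero_integrand leb fN) addr0.
have hE : cint leb E f = cint leb E (macro_density 1%:M 1%:M u psi) := eq_cint leb fE.
have hO : cint leb Omega f = cint leb Omega (macro_density A M u psi) := eq_cint leb fO.
have arith (a b c : C) : a + b - c = b + (a - c) by ring.
rewrite hE hO /outer_form; exact: arith.
Qed.

Section Solution.
Variables (g : vfield R) (u : gimp R) (u1 : pt3 R -> gcurl R) (u2 : pt3 R -> ggrad R)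
  (u3 : pt3 R -> gcurl R).
Hypothesis hu : HH Omega G Sigma n sigma (u, u1, u2, u3).

Let uG : Himp G n sigma u. Proof. by case: hu. Qed.
Let u1L : L1 u1. Proof. by case: hu. Qed.
Let u2L : L2' u2. Proof. by case: hu. Qed.
Let u3L : L3 u3. Proof. by case: hu. Qed.
Let u1H x : Omega x -> H1 (u1 x). Proof. by case: u1L => h _ _; exact: h. Qed.
Let u2H x : Omega x -> H2 (u2 x). Proof. by case: u2L => h _ _; exact: h. Qed.
Let u3H x : Omega x -> H3 (u3 x). Proof. by case: u3L => h _ _; exact: h. Qed.

Lemma BB_correctors psi psi1 psi2 psi3 :
  correctors Omega Sigma k w1 w2 w3 (u, u1, u2, u3) ->
  HH Omega G Sigma n sigma (psi, psi1, psi2, psi3) ->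
  BB Omega G Sigma n sigma k eps0 eps1 (u, u1, u2, u3) (psi, psi1, psi2, psi3) =
  cint leb Omega (macro_density A M u psi) + outer_form u psi.
Proof.
move=> [c1 c2 c3] hq; rewrite (BB_micro hu hq); congr (_ + _).
have [psiG [hp1 _ _] [hp2 _ _] [hp3 _ _]] := hq.
apply: (ae_eq_cint mO (micro_integrable hu hq) (macro_density_integrable mO OG A M uG psiG)).
apply: ae_imp (ae_and c1 (ae_and c2 c3)) => x [r1 [r2 r3]] Ox.
have {r1}[_ r1] := r1 Ox; have {r2}[_ r2] := r2 Ox; have {r3}[r3 r4] := r3 Ox.
have hx1 := hp1 x Ox; have hx2 := hp2 x Ox; have hx3 := hp3 x Ox.
rewrite (micro_residual u psi (u1H Ox) (u2H Ox) (u3H Ox) hx1 hx2 hx3) /residual_form.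
rewrite (ip_ae0l mSstar (L2e0 (L2H1 (res1H u (u1H Ox)))) (amul_ae0 _ r1)); last first.
  exact: (L2D mSstar (L2macro _ mSstar Sstar_fin) (L2H1 hx1)).
rewrite (ip_ae0l mS (L2e1 (L2H3 (res3H u (u3H Ox)))) (amul_ae0 _ r4) (L2H3 hx3)).
rewrite (ip_ae0l mSstar (L2H2 (res2H u (u2H Ox))) r2); last first.
  exact: (L2D mSstar (L2macro _ mSstar Sstar_fin) (L2H2 hx2)).
rewrite (ip_ae0l mS (L2H3f (res3H u (u3H Ox))) r3); last first.
  exact: (L2D mS (L2macro _ mS Sigma_fin) (L2H3f hx3)).
by rewrite !addr0 mulr0 subr0 addr0.
Qed.

Lemma bochner_residual (V : lmodType C) (X : set V) (N : V -> R) (U : pt3 R -> V)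
    (c : 'I_3 -> sfield R) (w : 'I_3 -> V) : linear_set X -> seminorm_on X N ->
  bochner_L2 Omega X N U -> (forall j, sL2 leb Omega (c j)) -> (forall j, X (w j)) ->
  bochner_L2 Omega X N (fun x => U x - \sum_j c j x *: w j).
Proof.
move=> sX sN hU hc hw; apply: (bochnerD mO sX sN hU).
have -> : (fun x => - \sum_j c j x *: w j) = (fun x => \sum_j (-1 * c j x) *: w j).
  by apply/funext => x; rewrite -sumrN; apply: eq_bigr => j _; rewrite mulN1r scaleNr.
apply: (bochner_sum mO sX sN) => j; apply: (bochner_scale mO sX sN) => //.
exact: sL2Z.
Qed.

Let uL2 := Himp_L2 mO OG uG.

Lemma res1_bochner : L1 (res1 u u1).
Proof.
apply: (bochner_residual (Hcurl_per_on_linear Sstar) (qnorm_seminorm mSstar SstarY)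
  u1L _ w1H) => j; exact: uL2.2.
Qed.

Lemma res2_bochner : L2' (res2 u u2).
Proof.
apply: (bochner_residual (H1_per0_on_linear Sstar) (norm_H1_per0_seminorm mSstar SstarY)
  u2L _ w2H) => j; exact: (sL2Z mO k2 (uL2.1 j)).
Qed.

Lemma res3_bochner : L3 (res3 u u3).
Proof.
apply: (bochner_residual (H0curl_linear mS) (norm_H0curl_seminorm mS)
  u3L _ w3H) => j; exact: (sL2Z mO k2 (uL2.1 j)).
Qed.

Lemma utan0 : utan n (0 : gimp R) = fun=> 0.
Proof.
by apply/funext => x; apply/colP => j; rewrite /utan /cross !mxE !mul0r subr0.
Qed.

Lemma Himp0 : Himp G n sigma 0.
Proof.
have mB := @bdry_measurable R G.
have T0 : L2T G n sigma (fun=> 0).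
  by split; [exact: (L2_0 sigma mB)|apply: aeW => x _; rewrite dot0l].
split; [by have [] := Hcurl_linear mG|exact: T0|by rewrite utan0|].
move=> eta _; transitivity (cint leb G (fun=> 0)).
  by apply: eq_cint => x _; rewrite fld0 curl0 !dot0l subr0.
by rewrite cint0 -(cint0 sigma (bdry G)); apply: eq_cint => x _; rewrite dot0l.
Qed.

Lemma zero_bochner1 : L1 (fun=> 0).
Proof.
exact: (bochner0 mO (Hcurl_per_on_linear Sstar) (qnorm_seminorm mSstar SstarY)).
Qed.
Lemma zero_bochner2 : L2' (fun=> 0).
Proof.
exact: (bochner0 mO (H1_per0_on_linear Sstar) (norm_H1_per0_seminorm mSstar SstarY)).
Qed.
Lemma zero_bochner3 : L3 (fun=> 0).
Proof.
exact: (bochner0 mO (H0curl_linear mS) (norm_H0curl_seminorm mS)).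
Qed.

Lemma macro_density0r (B B' : 'M[C]_3) v x : macro_density B B' v 0 x = 0.
Proof. by rewrite /macro_density /= conjv0 !dot0r mulr0 subr0. Qed.

(** Purely microscopic test fields see neither the exterior nor the boundary. *)
Lemma micro_test psi1 psi2 psi3 :
  two_scale_solution Omega G Sigma n sigma k eps0 eps1 g (u, u1, u2, u3) ->
  L1 psi1 -> L2' psi2 -> L3 psi3 ->
  cintegrable leb Omega (micro u u1 u2 u3 0 psi1 psi2 psi3) /\
  cint leb Omega (micro u u1 u2 u3 0 psi1 psi2 psi3) = 0.
Proof.
move=> sol h1 h2 h3.
have hq : HH Omega G Sigma n sigma (0, psi1, psi2, psi3) by split; [exact: Himp0|exact: h1|exact: h2|exact: h3].
split; first exact: (micro_integrable hu hq).
have := sol _ hq; rewrite (BB_micro hu hq) /= /boundary_load /outer_form utan0.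
rewrite (cint_zero_integrand leb (fun x _ => macro_density0r _ _ u x)).
have z (v : vfield R) : cint sigma (bdry G) (fun x => dot (v x) (conjv 0)) = 0.
  by apply: cint_zero_integrand => x _; rewrite conjv0 dot0r.
rewrite !z.
by rewrite mulr0 subr0 addr0.
Qed.

Lemma rot_star0 v1 x : rot_star 0 v1 x = curl (v1 x).
Proof. by apply/funext => y; rewrite /rot_star addrfctE/= add0r. Qed.
Lemma ind_star0 v2 x : ind_star 0 v2 x = gradient (v2 x).
Proof. by apply/funext => y; rewrite /ind_star addrfctE/= add0r. Qed.
Lemma ind_incl0 v3 x : ind_incl 0 v3 x = fld (v3 x).
Proof. by apply/funext => y; rewrite /ind_incl addrfctE/= add0r. Qed.

(** The form is the integral of [s * a] times the squared modulus of [v]. The factor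
    [s] selects the part of the weight that has a sign: the real part for [s = 1], minus
    the imaginary part for [s] the imaginary unit. *)
Lemma ip_amul_definite (S : set (pt3 R)) (a : sfield R) (s : C) (v : vfield R) :
  measurable3 S -> L2 leb S v -> L2 leb S (amul a v) ->
  {ae leb, forall y, S y -> 0 < complex.Re (s * a y)} ->
  0 <= complex.Re (s * ip leb S (amul a v) v) /\
  (complex.Re (s * ip leb S (amul a v) v) = 0 -> ae_zero S v).
Proof.
move=> mS' hv hav pos; have i := ip_integrable mS' hav hv.
rewrite /ip -(cintZ mS' s i); have is' := cintegrableZ mS' s i.
have reE y : complex.Re (s * dot (amul a v y) (conjv (v y))) =
    complex.Re (s * a y) * sqnv (v y).
  by rewrite dotZl dot_conj mulrA cReM /= mulr0 subr0.
have ge0 : {ae leb, forall y, S y ->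
    0 <= complex.Re (s * dot (amul a v y) (conjv (v y)))}.
  by apply: ae_imp pos => y h Sy; rewrite reE mulr_ge0 ?sqnv_ge0// ltW// h.
split; first exact: (Re_cint_ge0 mS' is' ge0).
move/(Re_cint_eq0 mS' is' ge0) => z.
apply: ae_imp (ae_and pos z) => y [h1 h2] Sy; move: (h2 Sy); rewrite reE => /eqP.
by rewrite mulf_eq0 gt_eqF ?h1//= => /eqP/sqnv_eq0.
Qed.

Section Converse.
Hypothesis sol : two_scale_solution Omega G Sigma n sigma k eps0 eps1 g (u, u1, u2, u3).
Hypothesis k_gt0 : 0 < k.
Hypothesis eps0_gt0 : {ae leb, forall y, Sstar y -> 0 < eps0 y}.
Hypothesis eps1_gt0 : {ae leb, forall y, Sigma y -> 0 < complex.Im (eps1 y)}.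

(** Tested with the residual itself, the form reduces to the squared rotation of the
    residual, weighted by the positive inverse of [eps0]. *)
Lemma corrector1 : {ae leb, forall x, Omega x -> ker_curl Sstar (res1 u u1 x)}.
Proof.
have [i I0] := micro_test sol res1_bochner zero_bochner2 zero_bochner3.
have mE x : Omega x -> micro u u1 u2 u3 0 (res1 u u1) (fun=> 0) (fun=> 0) x =
    ip leb Sstar (amul e0 (curl (res1 u u1 x))) (curl (res1 u u1 x)).
  move=> Ox; rewrite (micro_residual u 0 (u1H Ox) (u2H Ox) (u3H Ox) (res1H u (u1H Ox))).
  - rewrite /residual_form rot_star0 ind_star0 ind_incl0.
    have arith (a b s c d e : C) : e = 0 -> b = 0 -> c = 0 -> d = 0 ->
      e + (a + b - s * (c + d)) = a by move=> -> -> -> ->; ring.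
    by apply: arith; [exact: macro_density0r|exact: ip0r..].
  - by case: (H1_per0_on_linear Sstar).
  - by case: (H0curl_linear mS).
have pos : {ae leb, forall y, Sstar y -> 0 < complex.Re (1 * e0 y)}.
  by apply: ae_imp eps0_gt0 => y h Sy; rewrite mul1r /= invr_gt0 h.
have def x (Ox : Omega x) := let c := L2H1 (res1H u (u1H Ox)) in
  ip_amul_definite mSstar c (L2e0 c) pos.
have ge0 : {ae leb, forall x, Omega x ->
    0 <= complex.Re (micro u u1 u2 u3 0 (res1 u u1) (fun=> 0) (fun=> 0) x)}.
  by apply: aeW => x Ox; rewrite mE// -[ip _ _ _ _]mul1r; exact: (def x Ox).1.
have := Re_cint_eq0 mO i ge0; rewrite I0 => /(_ erefl).
apply: ae_imp => x h Ox; split; first exact: (res1H u (u1H Ox)).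
by apply: (def x Ox).2; rewrite mul1r -mE// h.
Qed.

(** Tested with the residual itself, the form reduces to [- k ^+ 2] times the squared
    norm of the gradient of the residual. *)
Lemma corrector2 : {ae leb, forall x, Omega x -> ker_grad Sstar (res2 u u2 x)}.
Proof.
have [i I0] := micro_test sol zero_bochner1 res2_bochner zero_bochner3.
have mE x : Omega x -> micro u u1 u2 u3 0 (fun=> 0) (res2 u u2) (fun=> 0) x =
    - cplx (k ^+ 2 * vnorm2 leb Sstar (gradient (res2 u u2 x))).
  move=> Ox; have r2 := res2H u (u2H Ox).
  rewrite (micro_residual u 0 (u1H Ox) (u2H Ox) (u3H Ox) _ r2).
  - rewrite /residual_form rot_star0 ind_star0 ind_incl0 cplxM.
    have arith (a b s c c' d e : C) : e = 0 -> a = 0 -> b = 0 -> d = 0 -> c = c' ->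
      e + (a + b - s * (c + d)) = - (s * c') by move=> -> -> -> -> ->; ring.
    apply: arith; [exact: macro_density0r|exact: ip0r..|].
    exact: (ip_self mSstar (L2H2 r2)).
  - by case: (Hcurl_per_on_linear Sstar).
  - by case: (H0curl_linear mS).
have i' := cintegrableZ mO (-1) i.
have ge0 : {ae leb, forall x, Omega x ->
    0 <= complex.Re (-1 * micro u u1 u2 u3 0 (fun=> 0) (res2 u u2) (fun=> 0) x)}.
  by apply: aeW => x Ox; rewrite mE// mulN1r opprK /= mulr_ge0 ?sqr_ge0 ?vnorm2_ge0.
have := Re_cint_eq0 mO i' ge0; rewrite (cintZ mO (-1) i) I0 mulr0 => /(_ erefl).
apply: ae_imp => x h Ox; split; first exact: (res2H u (u2H Ox)).
apply: (vnorm2_eq0 mSstar (L2H2 (res2H u (u2H Ox)))).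
move: (h Ox); rewrite mE// mulN1r opprK /= => /eqP.
by rewrite mulf_eq0 sqrf_eq0 gt_eqF//= => /eqP.
Qed.

(** In the inclusion the form is indefinite: its imaginary part controls the
    rotation of the residual, and once that vanishes the real part controls the
    residual itself. *)
Lemma corrector3 : {ae leb, forall x, Omega x -> null_curl Sigma (res3 u u3 x)}.
Proof.
have [i I0] := micro_test sol zero_bochner1 zero_bochner2 res3_bochner.
pose m := micro u u1 u2 u3 0 (fun=> 0) (fun=> 0) (res3 u u3).
have mE x : Omega x -> m x =
    ip leb Sigma (amul e1 (curl (res3 u u3 x))) (curl (res3 u u3 x))
    - cplx (k ^+ 2 * vnorm2 leb Sigma (fld (res3 u u3 x))).
  move=> Ox; have r3 := res3H u (u3H Ox).
  rewrite /m (micro_residual u 0 (u1H Ox) (u2H Ox) (u3H Ox) _ _ r3).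
  - rewrite /residual_form rot_star0 ind_star0 ind_incl0 cplxM.
    have arith (a b s c d d' e : C) : e = 0 -> a = 0 -> c = 0 -> d = d' ->
      e + (a + b - s * (c + d)) = b - s * d' by move=> -> -> -> ->; ring.
    apply: arith; [exact: macro_density0r|exact: ip0r..|].
    exact: (ip_self mS (L2H3f r3)).
  - by case: (Hcurl_per_on_linear Sstar).
  - by case: (H1_per0_on_linear Sstar).
have im_pos : {ae leb, forall y, Sigma y -> 0 < complex.Re (imagi R * e1 y)}.
  apply: ae_imp eps1_gt0 => y h Sy; move: (h Sy); rewrite cReM /= mul0r sub0r mul1r.
  case: (eps1 y) => a b /= b0; rewrite opprK divr_gt0//.
  by rewrite ltr_wpDl ?sqr_ge0// exprn_gt0.
have def x (Ox : Omega x) := let c := L2H3 (res3H u (u3H Ox)) in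
  ip_amul_definite mS c (L2e1 c) im_pos.
have imE x : Omega x -> complex.Re (imagi R * m x) =
    complex.Re (imagi R * ip leb Sigma (amul e1 (curl (res3 u u3 x))) (curl (res3 u u3 x))).
  by move=> Ox; rewrite mE//; case: (ip _ _ _ _) => a b; rewrite !cReM /=; ring.
have curl0 : {ae leb, forall x, Omega x -> ae_zero Sigma (curl (res3 u u3 x))}.
  have i' := cintegrableZ mO (imagi R) i.
  have ge0 : {ae leb, forall x, Omega x -> 0 <= complex.Re (imagi R * m x)}.
    by apply: aeW => x Ox; rewrite imE//; exact: (def x Ox).1.
  have := Re_cint_eq0 mO i' ge0; rewrite (cintZ mO _ i) I0 mulr0 => /(_ erefl).
  by apply: ae_imp => x h Ox; apply: (def x Ox).2; rewrite -imE// h.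
have reE : {ae leb, forall x, Omega x ->
    complex.Re (-1 * m x) = k ^+ 2 * vnorm2 leb Sigma (fld (res3 u u3 x))}.
  apply: ae_imp curl0 => x h Ox; have r3 := res3H u (u3H Ox); rewrite mE//.
  rewrite (ip_ae0l mS (L2e1 (L2H3 r3)) (amul_ae0 _ (h Ox)) (L2H3 r3)) sub0r mulN1r.
  by rewrite opprK.
have i' := cintegrableZ mO (-1) i.
have ge0 : {ae leb, forall x, Omega x -> 0 <= complex.Re (-1 * m x)}.
  by apply: ae_imp reE => x h Ox; rewrite h// mulr_ge0 ?sqr_ge0 ?vnorm2_ge0.
have := Re_cint_eq0 mO i' ge0; rewrite (cintZ mO (-1) i) I0 mulr0 => /(_ erefl) z.
apply: ae_imp (ae_and curl0 (ae_and reE z)) => x [h1 [h2 h3]] Ox; split; last exact: h1.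
apply: (vnorm2_eq0 mS (L2H3f (res3H u (u3H Ox)))).
move: (h2 Ox); rewrite h3// => /esym/eqP.
by rewrite mulf_eq0 sqrf_eq0 gt_eqF//= => /eqP.
Qed.

Lemma two_scale_correctors : correctors Omega Sigma k w1 w2 w3 (u, u1, u2, u3).
Proof. by split; [exact: corrector1|exact: corrector2|exact: corrector3]. Qed.

End Converse.

Lemma two_scale_iff : 0 < k ->
  {ae leb, forall y, Sstar y -> 0 < eps0 y} ->
  {ae leb, forall y, Sigma y -> 0 < complex.Im (eps1 y)} ->
  two_scale_solution Omega G Sigma n sigma k eps0 eps1 g (u, u1, u2, u3) <->
  (Himp G n sigma u /\
   effective_solution Omega G Sigma n sigma k eps0 w1 w2 w3 g u) /\
  correctors Omega Sigma k w1 w2 w3 (u, u1, u2, u3).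
Proof.
move=> k0 e0pos e1pos; split=> [sol|[[_ eff] cor] [[[psi psi1] psi2] psi3] hq].
  have cor := two_scale_correctors sol k0 e0pos e1pos.
  split=> //; split=> // psi hpsi.
  have hq : HH Omega G Sigma n sigma (psi, fun=> 0, fun=> 0, fun=> 0).
    by split; [exact: hpsi|exact: zero_bochner1|exact: zero_bochner2|exact: zero_bochner3].
  etransitivity; first exact: (effective_form uG hpsi).
  etransitivity; first exact: (esym (BB_correctors cor hq)).
  exact: (sol _ hq).
have hpsi : Himp G n sigma psi by case: hq.
etransitivity; first exact: (BB_correctors cor hq).
etransitivity; first exact: (esym (effective_form uG hpsi)).
exact: (eff _ hpsi).
Qed.

End Solution.
End TwoScaleForm.

Theorem theorem3p2 (R : realType)
  (Omega G Sigma : set (pt3 R))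
  (hG : domain3 G) (hGb : bounded3 G) (hGs : simply_connected G)
  (hGC2 : C2_boundary G)
  (hO : domain3 Omega) (hOb : bounded3 Omega) (hOs : simply_connected Omega)
  (hOC2 : C2_boundary Omega) (hOG : cpt_included Omega G)
  (hS : domain3 Sigma) (hSC2 : C2_boundary Sigma)
  (hSY : cpt_included Sigma (@Ycell R))
  (hSs : simply_connected (Sigma_star Sigma))
  (n : pt3 R -> 'cV[R]_3) (hn : outer_unit_normal G n)
  (sigma : {measure set (mpt3 R) -> \bar R}) (hsigma : surface_measure G sigma)
  (k0 k : R) (hk0 : 0 < k0) (hk : k0 <= k)
  (eps0 : pt3 R -> R) (heps0 : Linfty_per (fun y => cplx (eps0 y)))
  (heps0_pos : exists2 c : R, 0 < c &
     {ae @leb3 R, forall y, @Ycell R y -> c <= eps0 y})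
  (eps1 : pt3 R -> R[i]) (heps1 : Linfty_per (fun y => (eps1 y)^-1))
  (heps1_pos : {ae @leb3 R, forall y, @Ycell R y ->
     0 < complex.Im (eps1 y) /\ 0 < complex.Re (eps1 y)})
  (w1 : 'I_3 -> gcurl R) (w2 : 'I_3 -> ggrad R) (w3 : 'I_3 -> gcurl R)
  (hw1 : forall l, cell1 Sigma eps0 l (w1 l))
  (hw2 : forall l, cell2 Sigma k l (w2 l))
  (hw3 : forall l, cell3 Sigma k eps1 l (w3 l))
  (g : vfield R) (hg : L2T G n sigma g)
  (u : gimp R) (u1 : pt3 R -> gcurl R) (u2 : pt3 R -> ggrad R)
  (u3 : pt3 R -> gcurl R)
  (hu : HH Omega G Sigma n sigma (u, u1, u2, u3)) :
  two_scale_solution Omega G Sigma n sigma k eps0 eps1 g (u, u1, u2, u3)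
  <->
  (Himp G n sigma u /\
   effective_solution Omega G Sigma n sigma k eps0 w1 w2 w3 g u) /\
  correctors Omega Sigma k w1 w2 w3 (u, u1, u2, u3).
Proof.
have mO : measurable3 Omega by case: hO => _ oO _; exact: open_measurable3.
have mG : measurable3 G by case: hG => _ oG _; exact: open_measurable3.
have mS : measurable3 Sigma by case: hS => _ oS _; exact: open_measurable3.
have SY : Sigma `<=` @Ycell R.
  by case: hSY => _ h y /subset_closure/h/interior_subset.
have OG : Omega `<=` G by case: hOG => _ h y /subset_closure/h/interior_subset.
have mSstar : measurable3 (Sigma_star Sigma).
  by apply: (@measurableD _ (mpt3 R)) => //; exact: Ycell_measurable.
have SstarY : Sigma_star Sigma `<=` @Ycell R by move=> y [].
have he0 := eps0V_bounded SstarY heps0 heps0_pos.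
have he1 := Linfty_per_bounded SY heps1.
have eps0_gt0 : {ae @leb3 R, forall y, Sigma_star Sigma y -> 0 < eps0 y}.
  have [c c0 hc] := heps0_pos.
  by apply: ae_imp hc => y h /SstarY/h; exact: lt_le_trans.
have eps1_gt0 : {ae @leb3 R, forall y, Sigma y -> 0 < complex.Im (eps1 y)}.
  by apply: ae_imp heps1_pos => y h /SY/h[].
exact: (two_scale_iff mO mG mS SY OG he0 he1 hw1 hw2 hw3 g hu (lt_le_trans hk0 hk)
  eps0_gt0 eps1_gt0).
Qed.
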